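(* Let $n\geq2$, $p,q>1$ and $c>0$ be real, and set $$\Gamma_{GG}(p,q,n):=\max\Big\{\frac{p+1}{pq-1},\frac{q+1}{pq-1}\Big\}-\frac{n-1}{2},\qquad \Gamma_{GG}^{*}(p,q,n):=\max\Big\{\frac{p}{pq-1},\frac{q}{pq-1}\Big\}-\frac{n-1}{2},$$ $$\Gamma_{SG}(p,q,n):=\max\Big\{\frac{p+1+q^{-1}}{pq-1},\frac{2+p^{-1}}{pq-1}\Big\}-\frac{n-1}{2},$$ $$M(p,q,n):=\min\{\Gamma_{GG}(p,q,n),\Gamma_{SG}(p,q,n)\},\qquad M^{*}(p,q,n):=\min\{\Gamma_{GG}^{*}(p,q,n),\Gamma_{SG}(p,q,n)\}.$$ Assume $$M(p,q,n)>0\ \text{ if } c=1,\qquad M^{*}(p,q,n)>0\ \text{ if } c\neq1.$$ Let $(\mathbb{R}^n,\mathfrak{g})$ be an asymptotically Euclidean manifold (as defined in the context), and consider the Cauchy problem $$\begin{cases}\partial_t^2u-c^2\Delta_{\mathfrak{g}}u=|v|^p, & (t,x)\in(0,T)\times\mathbb{R}^n,\\ \partial_t^2v-\Delta_{\mathfrak{g}}v=|u_t|^q, & (t,x)\in(0,T)\times\mathbb{R}^n,\\ u(0,x)=\varepsilon u_0(x),\quad u_t(0,x)=\varepsilon u_1(x),\\ v(0,x)=\varepsilon v_0(x),\quad v_t(0,x)=\varepsilon v_1(x),\end{cases}$$ where $u_0,u_1,v_0,v_1\in C_c^\infty(\mathbb{R}^n)$ are supported in $B_R=\{x\in\mathbb{R}^n:|x|\le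 R\}$ for some $R>0$, the data are nontrivial, and they satisfy, for $i=0,1$, $$\int_{\mathbb{R}^n}u_i\,dv_{\mathfrak{g}}>0,\quad \int_{\mathbb{R}^n}u_0\phi_\lambda\,dv_{\mathfrak{g}}>0,\quad \int_{\mathbb{R}^n}(u_1-c\lambda u_0)\phi_\lambda\,dv_{\mathfrak{g}}>0,$$ $$\int_{\mathbb{R}^n}v_i\,dv_{\mathfrak{g}}>0,\quad \int_{\mathbb{R}^n}v_0\phi_\lambda\,dv_{\mathfrak{g}}>0,\quad \int_{\mathbb{R}^n}(v_1-\lambda v_0)\phi_\lambda\,dv_{\mathfrak{g}}>0.$$ Suppose the problem has a weak solution $u,v\in C^2([0,T_\varepsilon);\mathcal{D}'(\mathbb{R}^n))$ with $|v|^p,|u_t|^q\in C([0,T_\varepsilon);\mathcal{D}'(\mathbb{R}^n))$ and with $$\operatorname{supp}u\subset D_1:=\Big\{(t,x):\int_0^{|x|}K(\tau)\,d\tau\le ct+R_1\Big\},\qquad \operatorname{supp}v\subset D_2:=\Big\{(t,x):\int_0^{|x|}K(\tau)\,d\tau\le t+R_1\Big\}.$$ Then there exists a constant $\varepsilon_0>0$ such that for any $\varepsilon\in(0,\varepsilon_0)$ the solution blows up at finite time. Moreover, there is a constant $C>0$ independent of $\varepsilon\in(0,\varepsilon_0)$ such that the lifespan satisfies $$T_\varepsilon\le\begin{cases}C\,\varepsilon^{-M(p,q,n)^{-1}}, & c=1,\\ C\,\varepsilon^{-M^{*}(p,q,n)^{-1}}, & c\neq1.\end{cases}$$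
   Context: Notation: $\langle r\rangle=\sqrt{1+r^2}$; $A\lesssim B$ means $A\le CB$ for some constant $C>0$; repeated indices are summed. Asymptotically Euclidean manifold: a Riemannian metric $\mathfrak{g}=g_{jk}(x)dx^jdx^k$ on $\mathbb{R}^n$ that decomposes as $\mathfrak{g}=\mathfrak{g}_1+\mathfrak{g}_2$, where: (i) in polar coordinates $x=r\omega$, $\mathfrak{g}_1=K^2(r)dr^2+r^2d\omega^2$, with $d\omega^2$ the standard metric on $\mathbb{S}^{n-1}$, and for some constant $\rho>0$, $|\partial_r^m(K-1)|\lesssim\langle r\rangle^{-m-\rho}$ for $m=0,1,2$; (ii) $\mathfrak{g}_2=g_{2,jk}(x)dx^jdx^k$ and for some $\beta>0$, $|\nabla g_{2,jk}|+|g_{2,jk}|\lesssim e^{-\beta\int_0^rK(\tau)d\tau}$ and $|\nabla^2g_{2,jk}|\lesssim1$ (with $r=|x|$); (iii) there is $\delta_0\in(0,1)$ with $\delta_0|\xi|^2\le g^{jk}\xi_j\xi_k\le\delta_0^{-1}|\xi|^2$ for all $\xi\in\mathbb{R}^n$, and $K\in(\delta_0,1/\delta_0)$, where $(g^{jk})$ is the inverse of $(g_{jk})$. $\Delta_{\mathfrak{g}}$ is the Laplace–Beltrami operator and $dv_{\mathfrak{g}}$ the Riemannian volume measure of $\mathfrak{g}$. The function $\phi_\lambda$: it is known (from earlier work) that there are $\lambda_0,c_0>0$ such that for every $0<\lambda\le\lambda_0$ there is a solution $\phi_\lambda$ on $\mathbb{R}^n$ of $\Delta_{\mathfrak{g}}\phi_\lambda=\lambda^2\phi_\lambda$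 with $c_0<\phi_\lambda(x)<c_0^{-1}\langle\lambda r\rangle^{-\frac{n-1}{2}}e^{\lambda\int_0^rK(\tau)d\tau}$, $r=|x|$. Here $\lambda\in(0,\lambda_0]$ and such a $\phi_\lambda$ are fixed. $R_1$ is a fixed constant, independent of $\varepsilon$, with $R_1\ge\int_0^{R}K(\tau)d\tau$. Weak solution means that the equations hold in the sense of distributions and the initial conditions are attained; $T_\varepsilon$ denotes the lifespan of the solution. *)

(* Defs.v *)
From HB Require Import structures.
From mathcomp Require Import all_boot all_order all_algebra.
From mathcomp Require Import all_classical all_reals all_analysis.

Set Implicit Arguments.
Unset Strict Implicit.
Unset Printing Implicit Defensive.

Import Order.TTheory GRing.Theory Num.Theory.
Import numFieldNormedType.Exports.

Local Open Scope classical_set_scope.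
Local Open Scope ring_scope.

(* Lebesgue measure on R^n, built on n-tuples as an iterated product of the
   one-dimensional Lebesgue measure. *)
Section lebesgue_tuple.
Context {R : realType}.
Local Notation RT := (measurableTypeR R).

Definition tcons n (p : RT * n.-tuple RT) : n.+1.-tuple RT :=
  [tuple of p.1 :: p.2].

Lemma measurable_tcons n : measurable_fun [set: RT * n.-tuple RT] (@tcons n).
Proof. by apply: measurable_cons => //. Qed.

Section step.
Variables (n : nat) (m : {sigma_finite_measure set (n.-tuple RT) -> \bar R}).

Definition lebn_step : set (n.+1.-tuple RT) -> \bar R :=
  pushforward (@lebesgue_measure R \x m)%E (@tcons n).

Let lebn_step0 : lebn_step set0 = 0%E.
Proof. by rewrite /lebn_step /pushforward preimage_set0 measure0. Qed.

Let lebn_step_ge0 A : (0 <= lebn_step A)%E.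
Proof. by rewrite /lebn_step /pushforward; exact: measure_ge0. Qed.

Let lebn_step_sigma_additive : semi_sigma_additive lebn_step.
Proof.
move=> F mF tF mUF; rewrite /lebn_step /pushforward preimage_bigcup.
apply: measure_semi_sigma_additive.
- by move=> k; rewrite -[X in measurable X]setTI; exact: measurable_tcons.
- apply/trivIsetP => /= i j _ _ ij; rewrite -preimage_setI.
  by move/trivIsetP : tF => /(_ _ _ _ _ ij) ->//; rewrite preimage_set0.
- by rewrite -preimage_bigcup -[X in measurable X]setTI;
    exact: measurable_tcons.
Qed.

HB.instance Definition _ := isMeasure.Build _ _ _ lebn_step
  lebn_step0 lebn_step_ge0 lebn_step_sigma_additive.

Lemma sigma_finite_lebn_step : sigma_finite setT lebn_step.
Proof.
have [F FT Ffin] : sigma_finite setT (@lebesgue_measure R \x m)%E.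
  have /sigma_finiteP[F [TF ndF Foo]] := sigma_finiteT (@lebesgue_measure R).
  have /sigma_finiteP[G [TG ndG Goo]] := sigma_finiteT m.
  exists (fun k => F k `*` G k).
    rewrite -setXTT TF TG predeqE => -[x y]; split.
      move=> [/= [k _ Fkx] [l _ Gly]]; exists (maxn k l) => //; split.
      - by move: x Fkx; exact/subsetPset/ndF/leq_maxl.
      - by move: y Gly; exact/subsetPset/ndG/leq_maxr.
    by move=> [k _ []/= ? ?]; split; exists k.
  move=> k; have [? ?] := Foo k; have [? ?] := Goo k.
  split; first exact: measurableX.
  rewrite product_measure1E// lte_mul_pinfty// ge0_fin_numE//.
pose uncons (t : n.+1.-tuple RT) : RT * n.-tuple RT := (thead t, [tuple of behead t]).
have tconsK : cancel (@tcons n) uncons.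
  by move=> [x t]; congr pair; apply/val_inj.
have munc : measurable_fun setT uncons.
  by apply: measurable_fun_pair; [exact: measurable_tnth|exact: measurable_behead].
exists (fun k => uncons @^-1` F k).
  by rewrite -preimage_bigcup -FT preimage_setT.
move=> k; have [mF Fk] := Ffin k; split.
  by rewrite -[X in measurable X]setTI; exact: munc.
rewrite /lebn_step /pushforward -comp_preimage.
by rewrite (_ : uncons \o _ = id) //; apply/funext => z /=; rewrite tconsK.
Qed.

HB.instance Definition _ :=
  Measure_isSigmaFinite.Build _ _ _ lebn_step sigma_finite_lebn_step.

End step.

Fixpoint lebn n : {sigma_finite_measure set (n.-tuple RT) -> \bar R} :=
  match n with
  | 0 => \d_([tuple] : 0.-tuple RT)
  | n'.+1 => lebn_step (lebn n')
  end.

End lebesgue_tuple.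

Section calculus.
Context {R : realType} {n : nat}.
Local Notation Rn := ('rV[R]_n).

(* The library norm on row vectors is the sup norm. *)
Definition enorm (x : Rn) : R := Num.sqrt (\sum_i x 0 i ^+ 2).

Definition jap (r : R) : R := Num.sqrt (1 + r ^+ 2).

Definition partial (i : 'I_n) (f : Rn -> R) (x : Rn) : R :=
  derive f x (delta_mx 0 i).

Fixpoint Ck (k : nat) (f : Rn -> R) : Prop :=
  match k with
  | 0 => continuous f
  | k'.+1 => [/\ continuous f,
                 forall i x, derivable f x (delta_mx 0 i)
               & forall i, Ck k' (partial i f)]
  end.

Definition smooth (f : Rn -> R) := forall k, Ck k f.

(* C_c^oo(R^n) *)
Definition test (f : Rn -> R) :=
  smooth f /\ exists rho : R, forall x, rho < enorm x -> f x = 0.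

Definition row_of_tuple (t : n.-tuple (measurableTypeR R)) : Rn :=
  \row_i tnth t i.

Definition loc_integrable (f : Rn -> R) :=
  measurable_fun setT (f \o row_of_tuple : n.-tuple _ -> measurableTypeR R) /\
  forall rho : R, (lebn n).-integrable [set t | enorm (row_of_tuple t) <= rho]
    (EFin \o f \o row_of_tuple).

(* Distributions on R^n: functionals that are linear on test functions and of
   finite order on each ball; s ranges over sequences of indices, and
   foldr partial phi s is the corresponding iterated derivative of phi. *)
Definition is_distribution (L : (Rn -> R) -> R) :=
  (forall a phi psi, test phi -> test psi ->
     L (fun x => a * phi x + psi x) = a * L phi + L psi) /\
  forall rho : R, exists (C : R) (N : nat), forall phi (B : R), test phi ->
    (forall x, rho < enorm x -> phi x = 0) ->
    (forall s : seq 'I_n, (size s <= N)%N ->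
       forall x, `|foldr partial phi s x| <= B) ->
    `|L phi| <= C * B.

End calculus.

Section geometry.
Context {R : realType} {n : nat}.
Local Notation Rn := ('rV[R]_n).
Implicit Types g : Rn -> 'M[R]_n.

Definition riemannian_metric g :=
  [/\ forall j k, smooth (fun x => g x j k),
      forall x, (g x)^T = g x
    & forall x (xi : Rn), xi != 0 -> 0 < (xi *m g x *m xi^T) 0 0].

(* integral against the Riemannian volume dv_g *)
Definition vint g (f : Rn -> R) : R :=
  (\int[lebn n]_t (f (row_of_tuple t) * Num.sqrt (\det (g (row_of_tuple t)))))%R.

Definition laplace_beltrami g (f : Rn -> R) (x : Rn) : R :=
  (Num.sqrt (\det (g x)))^-1 *
  \sum_j partial j (fun y => \sum_k Num.sqrt (\det (g y)) *
                               invmx (g y) j k * partial k f y) x.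

(* int_0^r K *)
Definition radial (K : R -> R) (r : R) : R :=
  (\int[lebesgue_measure]_(tau in `[0, r]) K tau)%R.

(* K(r)^2 dr^2 + r^2 domega^2 in Cartesian coordinates, for x != 0:
   dr = sum_j (x_j / r) dx_j and r^2 domega^2 = sum_j dx_j^2 - dr^2. *)
Definition polar_metric (K : R -> R) (x : Rn) : 'M[R]_n :=
  let r := enorm x in
  let drdr := r ^- 2 *: (x^T *m x) in
  K r ^+ 2 *: drdr + (1%:M - drdr).

Definition asymptotically_euclidean g (K : R -> R) :=
  riemannian_metric g /\
  exists (g2 : Rn -> 'M[R]_n) (rho beta delta0 C : R),
  [/\ 0 < rho, 0 < beta, 0 < delta0 < 1,
      forall x, x != 0 -> g x = polar_metric K x + g2 x &
  [/\ (forall r, 0 < r ->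
         [/\ derivable K r 1, derivable (derive1 K) r 1
           & {for r, continuous (derive1n 2 K)}]) /\
      (forall (m : nat) r, (m <= 2)%N -> 0 < r ->
         `|derive1n m (fun s => K s - 1) r| <= C * jap r `^ (- m%:R - rho)),
      (forall j k, Ck 2 (fun x => g2 x j k)) /\
      (forall j k x,
         Num.sqrt (\sum_i partial i (fun y => g2 y j k) x ^+ 2) + `|g2 x j k|
           <= C * expR (- beta * radial K (enorm x)) /\
         Num.sqrt (\sum_i \sum_l
           partial i (partial l (fun y => g2 y j k)) x ^+ 2) <= C),
      forall x (xi : Rn),
        delta0 * enorm xi ^+ 2 <= (xi *m invmx (g x) *m xi^T) 0 0
          <= delta0^-1 * enorm xi ^+ 2
    & forall r, 0 < r -> delta0 < K r < delta0^-1]].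

Definition is_phi g K (lam c0 : R) (phi : Rn -> R) :=
  [/\ smooth phi,
      forall x, laplace_beltrami g phi x = lam ^+ 2 * phi x
    & forall x, c0 < phi x <
        c0^-1 * jap (lam * enorm x) `^ (- ((n%:R - 1) / 2)) *
        expR (lam * radial K (enorm x))].

End geometry.

Section time_dependent.
Context {R : realType} {n : nat}.
Local Notation Rn := ('rV[R]_n).
Local Notation functional := ((Rn -> R) -> R).
Implicit Types (g : Rn -> 'M[R]_n) (T : \bar R).

Definition time_interval T : set R := [set t | 0 <= t /\ (t%:E < T)%E].

(* f1 is the derivative of f on [0, T), one-sided at 0 *)
Definition has_derivative_on T (f f1 : R -> R) :=
  forall t, time_interval T t ->
    (f s - f t) / (s - t) @[s --> within (time_interval T) t^'] --> f1 t.

(* u is in C^2([0, T); D'(R^n)), with time derivatives u1 and u2. D' has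
   its weak-* topology; by the Banach-Steinhaus theorem the strong topology
   gives the same functions. *)
Definition C2_distribution T (u u1 u2 : R -> functional) :=
  (forall t, time_interval T t ->
     [/\ is_distribution (u t), is_distribution (u1 t)
       & is_distribution (u2 t)]) /\
  (forall phi, test phi ->
     [/\ has_derivative_on T (u^~ phi) (u1^~ phi),
         has_derivative_on T (u1^~ phi) (u2^~ phi)
       & {within time_interval T, continuous (u2^~ phi)}]).

(* Functions are identified with distributions through dv_g. *)
Definition represents g (f : Rn -> R) (L : functional) :=
  loc_integrable f /\
  forall phi, test phi -> L phi = vint g (fun x => f x * phi x).

(* w(t) is a function for each t, and N = |w|^a is in C([0, T); D'(R^n)) *)
Definition abs_power g T (a : R) (w N : R -> functional) :=
  exists f : R -> Rn -> R,
    (forall t, time_interval T t ->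
       represents g (f t) (w t) /\
       represents g (fun x => `|f t x| `^ a) (N t)) /\
    (forall phi, test phi -> {within time_interval T, continuous (N^~ phi)}).

(* dv_g makes Delta_g formally self-adjoint, hence its action by duality. *)
Definition weak_solution g (c p q eps : R) (u0 u1 v0 v1 : Rn -> R) T
    (u v : R -> functional) :=
  (0 < T)%E /\
  exists ut utt vt vtt Np Nq : R -> functional,
  [/\ C2_distribution T u ut utt /\ C2_distribution T v vt vtt,
      abs_power g T p v Np /\ abs_power g T q ut Nq,
      (forall t phi, 0 < t -> (t%:E < T)%E -> test phi ->
         utt t phi - c ^+ 2 * u t (laplace_beltrami g phi) = Np t phi /\
         vtt t phi - v t (laplace_beltrami g phi) = Nq t phi)
    & (forall phi, test phi ->
         [/\ u 0 phi = vint g (fun x => eps * u0 x * phi x),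
             ut 0 phi = vint g (fun x => eps * u1 x * phi x),
             v 0 phi = vint g (fun x => eps * v0 x * phi x)
           & vt 0 phi = vint g (fun x => eps * v1 x * phi x)])].

(* Space-time support in [0, T) x R^n. Testing u at each time, instead of
   testing against functions of (t, x), gives the same set when u is
   continuous in time. *)
Definition st_support T (u : R -> functional) : set (R * Rn) :=
  [set z | time_interval T z.1 /\
     ~ exists2 delta : R, 0 < delta &
         forall s phi, time_interval T s -> `|s - z.1| < delta -> test phi ->
           (forall x, phi x != 0 -> enorm (x - z.2) < delta) -> u s phi = 0].

Definition light_cone (K : R -> R) (c R1 : R) : set (R * Rn) :=
  [set z | radial K (enorm z.2) <= c * z.1 + R1].

Definition lifespan g K (c p q R1 eps : R) (u0 u1 v0 v1 : Rn -> R) : \bar R :=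
  ereal_sup [set T | exists u v : R -> functional,
    [/\ weak_solution g c p q eps u0 u1 v0 v1 T u v,
        st_support T u `<=` light_cone K c R1
      & st_support T v `<=` light_cone K 1 R1]].

End time_dependent.

Section exponents.
Context {R : realType}.
Implicit Types (p q : R) (n : nat).

Definition Gamma_GG p q n : R :=
  Num.max ((p + 1) / (p * q - 1)) ((q + 1) / (p * q - 1)) - (n%:R - 1) / 2.

Definition Gamma_GG_star p q n : R :=
  Num.max (p / (p * q - 1)) (q / (p * q - 1)) - (n%:R - 1) / 2.

Definition Gamma_SG p q n : R :=
  Num.max ((p + 1 + q^-1) / (p * q - 1)) ((2 + p^-1) / (p * q - 1))
  - (n%:R - 1) / 2.

Definition M_exp p q n : R := Num.min (Gamma_GG p q n) (Gamma_SG p q n).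

Definition M_star p q n : R := Num.min (Gamma_GG_star p q n) (Gamma_SG p q n).

End exponents.

(* Main.v *)
Require Import Defs.
From mathcomp Require Import all_boot all_order all_algebra perm.
From mathcomp Require Import all_classical all_reals all_analysis measurable_realfun.
From mathcomp Require Import ring lra.

Set Implicit Arguments.
Unset Strict Implicit.
Unset Printing Implicit Defensive.

Import Order.TTheory GRing.Theory Num.Theory.
Import numFieldNormedType.Exports.

Local Open Scope classical_set_scope.
Local Open Scope ring_scope.

(** Pairing the equations with functions of x only reduces the problem to a
    system of ordinary differential inequalities for the two quantities
    W = int u_t and V = int v.  By finite speed of propagation the integrals
    may be taken against any cutoff chi that is 1 on the cone, and there the
    Laplace-Beltrami term disappears, so that W' = int |v|^p and
    V'' = int |u_t|^q.  The right-hand sides are bounded from below in two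
    ways.

    Testing against chi itself, Hoelder's inequality on the cone, whose
    section at time t has volume of order t^n, gives
      W' >= k |V|^p (1+t)^(-n(p-1)),   V'' >= k |W|^q (1+t)^(-n(q-1)).

    Testing against chi phi, where phi is the eigenfunction, gives
    F'' >= (c lam)^2 F for F = <u, chi phi>, and likewise for v; with the sign
    conditions on the data the pairings <u_t, chi phi> and <v, chi phi> are
    at least eps e^(c lam t) and eps e^(lam t), up to constants
    (eigenfunction_growth).  The growth bound on phi makes
    int phi^(p/(p-1)) over the cone at most of order
    e^(lam t p/(p-1)) (1+t)^(n-1-(n-1)/2 p/(p-1)), because the weight is
    concentrated in a shell of bounded width at the boundary of the cone and
    such a shell has volume of order t^(n-1) (weighted_vint_le).
    Hoelder's inequality then gives
      W' >= k eps^p (1+t)^((n-1)(1-p/2)),  V'' >= k eps^q (1+t)^((n-1)(1-q/2))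
    (source_from_eigenfunction).

    On the time scale tau these four inequalities force a blow-up before 2 tau
    as soon as eps tau^Gamma_SG is large (blowup_at_scale): integrating the
    lower bound by a power of eps for V'' (or W') up to tau produces a value
    from which on the first two inequalities multiply V by a fixed factor
    over time steps that shrink geometrically.  The two entries of the
    maximum in Gamma_SG correspond to starting from V and to starting from W.
    Hence the lifespan is at most a constant times eps^(-1/Gamma_SG); since
    Gamma_SG is an entry of the minima M and M_star, this is at most a constant
    times eps^(-1/M), respectively eps^(-1/M_star), when eps < 1. *)

(** * Functions with k continuous derivatives *)

Section Ck_calculus.
Context {R : realType} {n : nat}.
Local Notation Rn := ('rV[R]_n).
Implicit Types (f h : Rn -> R) (k : nat).

Lemma CkW k f : Ck k.+1 f -> Ck k f.
Proof.
elim: k f => [|k IH] f [cf df pf] //=.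
by split => // i; apply: IH; exact: pf.
Qed.

Lemma partial_cst i a : partial i (fun=> a) = (fun=> 0) :> (Rn -> R).
Proof. by apply/funext => x; rewrite /partial derive_cst. Qed.

Lemma Ck_cst k a : Ck k ((fun=> a) : Rn -> R).
Proof.
elim: k a => [|k IH] a /=; first exact: cst_continuous.
split; first exact: cst_continuous.
  by move=> i x; exact: derivable_cst.
by move=> i; rewrite partial_cst.
Qed.

Lemma Ck_add k f h : Ck k f -> Ck k h -> Ck k (fun x => f x + h x).
Proof.
elim: k f h => [|k IH] f h /=.
  by move=> cf ch x; apply: (@continuousD _ _ _ f h); [exact: cf|exact: ch].
move=> [cf df pf] [ch dh ph]; split.
- by move=> x; apply: (@continuousD _ _ _ f h); [exact: cf|exact: ch].
- by move=> i x; apply: derivableD.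
- move=> i; rewrite (_ : partial i _ = fun x => partial i f x + partial i h x).
    exact: IH.
  by apply/funext => x; rewrite /partial (@deriveD _ _ _ f h).
Qed.

Lemma Ck_mul k f h : Ck k f -> Ck k h -> Ck k (fun x => f x * h x).
Proof.
elim: k f h => [|k IH] f h.
  by move=> cf ch x; apply: (@continuousM _ _ f h); [exact: cf|exact: ch].
move=> Cf Ch; have [cf df pf] := Cf; have [ch dh ph] := Ch; split.
- by move=> x; apply: (@continuousM _ _ f h); [exact: cf|exact: ch].
- by move=> i x; apply: derivableM.
- move=> i; rewrite (_ : partial i _ =
      fun x => f x * partial i h x + h x * partial i f x).
    by apply: Ck_add; apply: IH; [exact: CkW Cf|exact: ph|exact: CkW Ch|exact: pf].
  by apply/funext => x; rewrite /partial (@deriveM _ _ f h).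
Qed.

Lemma Ck_inv k f : (forall x, f x != 0) -> Ck k f -> Ck k (fun x => (f x)^-1).
Proof.
move=> f0; elim: k => [|k IH].
  by move=> cf x; apply: (@continuousV _ _ f); [exact: f0|exact: cf].
move=> Cf; have [cf df pf] := Cf; split.
- by move=> x; apply: (@continuousV _ _ f); [exact: f0|exact: cf].
- by move=> i x; apply: derivableV.
- move=> i; rewrite (_ : partial i _ =
      fun x => -1 * ((f x)^-1 * ((f x)^-1 * partial i f x))).
    apply: Ck_mul; first exact: Ck_cst.
    by do 2?[apply: Ck_mul]; [exact/IH/CkW|exact/IH/CkW|exact: pf].
  apply/funext => x; rewrite /partial (@deriveV _ _ f)// /GRing.scale/=.
  by rewrite expr2 invfM; ring.
Qed.

(** The chain rule along a coordinate direction, obtained by restricting f to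
    the line through x and using the chain rule on R. *)
Lemma partial_comp i (F : R -> R) f x : derivable F (f x) 1 ->
  derivable f x (delta_mx 0 i) ->
  derivable (F \o f) x (delta_mx 0 i) /\
  partial i (F \o f) x = derive1 F (f x) * partial i f x.
Proof.
move=> dF df.
pose v : Rn := delta_mx 0 i.
pose l (t : R) := f (t *: v + x).
have dl : derivable l 0 1 by move/derivable1P : df.
have l0 : l 0 = f x by rewrite /l scale0r add0r.
have dF0 : derivable F (l 0) 1 by rewrite l0.
have H : is_derive (0:R) 1 (F \o l) (derive1 F (l 0) * derive1 l 0).
  rewrite !derive1E.
  exact: (is_derive1_comp (derivableP dF0) (derivableP dl)).
have line (u : R -> R) : (fun h : R => h^-1 *: ((u \o l) (h *: (1:R) + 0) - (u \o l) 0))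
    = (fun h : R => h^-1 *: ((u \o f) (h *: v + x) - (u \o f) x)).
  by apply/funext => h; rewrite /= addr0 l0 /l /GRing.scale/= mulr1.
have E : partial i f x = derive1 l 0.
  by rewrite derive1E /partial /derive /=; have := line id; rewrite /= => ->.
have [d e] := H.
split; first by apply/derivable1P.
by rewrite E -l0 -e /partial /derive /=; have := line F; rewrite /= => ->.
Qed.

End Ck_calculus.

Section Ck_constructions.
Context {R : realType} {n : nat}.
Local Notation Rn := ('rV[R]_n).
Implicit Types (f h : Rn -> R) (k : nat).

(** The derivative of sqrt f involves sqrt f again only through its inverse,
    so the induction on k goes through [Ck_inv]. *)
Lemma Ck_sqrt k f : (forall x, 0 < f x) -> Ck k f -> Ck k (fun x => Num.sqrt (f x)).
Proof.
move=> f0; elim: k => [|k IH].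
  move=> cf x; apply: (@continuous_comp _ _ _ f Num.sqrt); [exact: cf|exact: sqrt_continuous].
move=> Cf; have [cf df pf] := Cf.
have der x := @is_derive1_sqrt R (f x) (f0 x).
have part i x := @partial_comp R n i Num.sqrt f x
  (@ex_derive _ _ _ _ _ _ _ (der x)) (df i x).
split.
- by move=> x; apply: (@continuous_comp _ _ _ f Num.sqrt); [exact: cf|exact: sqrt_continuous].
- by move=> i x; case: (part i x).
- move=> i; rewrite (_ : partial i _ =
      fun x => (2 * Num.sqrt (f x))^-1 * partial i f x).
    apply: Ck_mul; last exact: pf.
    apply: Ck_inv => [x|]; first by rewrite mulf_neq0// sqrtr_eq0 -ltNge.
    by apply: Ck_mul; [exact: Ck_cst|exact/IH/CkW].
  apply/funext => x; case: (part i x) => _ ->.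
  by rewrite derive1E (derive_val (is_derive := der x)).
Qed.

Lemma Ck_sum k (I : Type) (r : seq I) (F : I -> Rn -> R) :
  (forall i, Ck k (F i)) -> Ck k (fun x => \sum_(i <- r) F i x).
Proof.
move=> CF; elim: r => [|a r IH].
  rewrite (_ : (fun x => _) = fun=> 0); first exact: Ck_cst.
  by apply/funext => x; rewrite big_nil.
rewrite (_ : (fun x => _) = fun x => F a x + \sum_(i <- r) F i x).
  exact: Ck_add.
by apply/funext => x; rewrite big_cons.
Qed.

Lemma Ck_prod k (I : Type) (r : seq I) (F : I -> Rn -> R) :
  (forall i, Ck k (F i)) -> Ck k (fun x => \prod_(i <- r) F i x).
Proof.
move=> CF; elim: r => [|a r IH].
  rewrite (_ : (fun x => _) = fun=> 1); first exact: Ck_cst.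
  by apply/funext => x; rewrite big_nil.
rewrite (_ : (fun x => _) = fun x => F a x * \prod_(i <- r) F i x).
  exact: Ck_mul.
by apply/funext => x; rewrite big_cons.
Qed.

Lemma Ck_det k m (A : Rn -> 'M[R]_m) :
  (forall i j, Ck k (fun x => A x i j)) -> Ck k (fun x => \det (A x)).
Proof.
move=> CA; apply: Ck_sum => s.
by apply: Ck_mul; [exact: Ck_cst|apply: Ck_prod].
Qed.

Lemma Ck_invmx k m (A : Rn -> 'M[R]_m) :
  (forall x, \det (A x) != 0) -> (forall i j, Ck k (fun x => A x i j)) ->
  forall i j, Ck k (fun x => invmx (A x) i j).
Proof.
move=> A0 CA i j.
rewrite (_ : (fun x => _) = fun x => (\det (A x))^-1 *
   ((-1) ^+ (j + i) * \det (row' j (col' i (A x))))).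
  apply: Ck_mul; first by apply: Ck_inv => //; exact: Ck_det.
  apply: Ck_mul; first exact: Ck_cst.
  apply: Ck_det => a b.
  rewrite (_ : (fun x => _) = fun x => A x (lift j a) (lift i b)) => //.
  by apply/funext => x; rewrite !mxE.
apply/funext => x; rewrite /invmx unitmxE unitfE A0.
by rewrite !mxE /cofactor.
Qed.

Lemma partial_coord i j : partial i (fun x : Rn => x 0 j) = fun=> (i == j)%:R.
Proof.
apply/funext => x; rewrite /partial.
have := @derive_mx R Rn 1 n id x (delta_mx 0 i) (@derivable_id _ _ _ _).
rewrite derive_id => /(congr1 (fun M : 'rV[R]_n => M 0 j)).
by rewrite !mxE eqxx /= eq_sym => ->.
Qed.

Lemma Ck_coord k j : Ck k (fun x : Rn => x 0 j).
Proof.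
case: k => [|k]; first exact: coord_continuous.
split; first exact: coord_continuous.
- by move=> i x; have /derivable_mxP := @derivable_id R Rn x (delta_mx 0 i); exact.
- by move=> i; rewrite partial_coord; exact: Ck_cst.
Qed.

Lemma Ck_partial k f i : Ck k.+1 f -> Ck k (partial i f).
Proof. by move=> [_ _]; exact. Qed.

End Ck_constructions.

(** * Smooth cutoff functions *)

Section flat_function.
Context {R : realType}.

(** The classical flat function and, with m, the terms x^-m e^(-1/x) that occur
    in its derivatives: this family is closed under differentiation up to
    linear combinations, which makes smoothness an induction on k for all m
    at once. *)
Definition flat (m : nat) (x : R) : R :=
  if 0 < x then x^-1 ^+ m * expR (- x^-1) else 0.

Lemma flat_ge0 m x : 0 <= flat m x.
Proof.
rewrite /flat; case: ifPn => // x0.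
by rewrite mulr_ge0 ?expR_ge0// exprn_ge0// invr_ge0 ltW.
Qed.

Lemma flat_eq0 m (x : R) : x <= 0 -> flat m x = 0.
Proof. by move=> x0; rewrite /flat ltNge x0. Qed.

(** Taylor's bound e^y >= y^(m+2) / (m+2)! at y = 1/x; the power 2 on the right
    is what makes every [flat m] differentiable at 0. *)
Lemma flat_le m x : flat m x <= (m.+2)`!%:R * x ^+ 2.
Proof.
rewrite /flat; case: ifPn => x0; last by rewrite mulr_ge0// sqr_ge0.
have y0 : 0 < x^-1 by rewrite invr_gt0.
have := @expR_ge1Dxn R x^-1 m.+1 (ltW y0).
set F := (m.+2)`!%:R; have F0 : 0 < F by rewrite ltr0n fact_gt0.
move=> H; have {}H : x^-1 ^+ m.+2 <= F * expR x^-1.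
  rewrite -ler_pdivrMl// mulrC; apply: le_trans H; lra.
rewrite expRN ler_pdivrMr ?expR_gt0// -mulrA [x ^+ 2 * _]mulrC mulrA.
have x20 : 0 < x ^+ 2 by rewrite exprn_gt0.
rewrite -ler_pdivrMr// -exprVn -exprD addn2; exact: H.
Qed.

Lemma is_derive_flat m (x : R) :
  is_derive x 1 (flat m) (flat m.+2 x - m%:R * flat m.+1 x).
Proof.
have [x0|x0|->] := ltgtP x 0.
- apply: (@near_eq_is_derive _ _ _ (cst 0)).
  + near=> y; rewrite flat_eq0// ltW//.
    by near: y; exact: lt_nbhsl.
  + rewrite !flat_eq0 ?(ltW x0)// mulr0 subr0; exact: is_derive_cst.
- apply: (@near_eq_is_derive _ _ _ ((fun y => y ^+ m * expR (- y)) \o (fun z => z^-1))).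
  + near=> y; rewrite /flat ifT//.
    by near: y; exact: lt_nbhsr.
  + have xn0 : x != 0 by rewrite gt_eqF.
    have dV : is_derive x 1 (fun z : R => z^-1) (- x^-1 ^+ 2).
      split; first exact: derivableV.
      by rewrite (@deriveV _ _ id)// derive_id /GRing.scale/= mulr1 exprVn.
    have dG (y : R) : is_derive y 1 (fun y => y ^+ m * expR (- y))
        (y ^+ m * (- expR (- y)) + expR (- y) * (m%:R * y ^+ m.-1)).
      have d1 : is_derive y 1 (fun y : R => y ^+ m) (m%:R * y ^+ m.-1).
        split; first exact: exprn_derivable.
        by rewrite exp_derive /GRing.scale/= mulr1.
      have d2 : is_derive y 1 (fun y : R => expR (- y)) (- expR (- y)).
        have := is_derive1_comp (is_derive_expR (- y)) (is_deriveNid y 1).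
        by rewrite mulrN1.
      have := is_deriveM d1 d2.
      by move/is_derive_eq; apply; rewrite /GRing.scale.
    have := is_derive1_comp (dG x^-1) dV.
    move/is_derive_eq; apply.
    rewrite /flat x0; case: m dG => [|m] dG /=; rewrite ?exprS; ring.
- rewrite /flat ltxx mulr0 subr0.
  have lim0 : (fun h : R => h^-1 *: ((flat m \o shift 0) (h *: (1:R)) - flat m 0))
       @ 0^' --> (0:R).
    apply/cvgr0Pnorm_le => e e0.
    near=> h.
    have h0 : h != 0 by near: h; exact: nbhs_dnbhs_neq.
    rewrite /= {2}/flat ltxx subr0 addr0 /GRing.scale/= mulr1 normrM normfV.
    rewrite (ger0_norm (flat_ge0 _ _)) mulrC ler_pdivrMr ?normr_gt0//.
    apply: (le_trans (flat_le _ _)).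
    rewrite -normr_id -[h ^+ 2]real_normK ?num_real// expr2 mulrA normr_id ler_wpM2r//.
    rewrite -ler_pdivlMl ?ltr0n ?fact_gt0//.
    rewrite ltW//; near: h; apply: dnbhs0_lt.
    by rewrite mulr_gt0// invr_gt0 ltr0n fact_gt0.
  split; first by apply/cvg_ex; exists 0.
  by apply/cvg_lim.
Unshelve. all: by end_near. Qed.

Lemma flat_continuous m : continuous (flat m).
Proof.
move=> x; apply: differentiable_continuous; apply/derivable1_diffP.
exact: (@ex_derive _ _ _ _ _ _ _ (is_derive_flat m x)).
Qed.

Lemma flat_gt0 m (x : R) : 0 < x -> 0 < flat m x.
Proof. by move=> x0; rewrite /flat x0 mulr_gt0 ?expR_gt0// exprn_gt0// invr_gt0. Qed.

Lemma flat0_mono (x y : R) : x <= y -> flat 0 x <= flat 0 y.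
Proof.
move=> xy; rewrite /flat; case: ifPn => x0; last first.
  by case: ifPn => // _; rewrite expr0 mul1r expR_ge0.
by rewrite (lt_le_trans x0 xy) !expr0 !mul1r ler_expR lerN2 lef_pV2 ?posrE//
  (lt_le_trans x0 xy).
Qed.

End flat_function.

Lemma Ck_flat (R : realType) n k m (f : 'rV[R]_n -> R) :
  Ck k f -> Ck k (fun x => flat m (f x)).
Proof.
elim: k m f => [|k IH] m f.
  by move=> cf x; apply: (@continuous_comp _ _ _ f (flat m));
    [exact: cf|exact: flat_continuous].
move=> Cf; have [cf df pf] := Cf.
have part i x := @partial_comp R n i (flat m) f x
  (@ex_derive _ _ _ _ _ _ _ (is_derive_flat m (f x))) (df i x).
split.
- by move=> x; apply: (@continuous_comp _ _ _ f (flat m));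
    [exact: cf|exact: flat_continuous].
- by move=> i x; case: (part i x).
- move=> i; rewrite (_ : partial i _ = fun x =>
     (flat m.+2 (f x) + (- m%:R) * flat m.+1 (f x)) * partial i f x).
    apply: Ck_mul; last exact: pf.
    apply: Ck_add; first exact/IH/CkW.
    by apply: Ck_mul; [exact: Ck_cst|exact/IH/CkW].
  apply/funext => x; case: (part i x) => _ ->.
  by rewrite derive1E (derive_val (is_derive := is_derive_flat m (f x))) mulNr.
Qed.

Section cutoff_functions.
Context {R : realType} {n : nat}.
Local Notation Rn := ('rV[R]_n).
Implicit Types (f h : Rn -> R) (a b : R) (x y z : Rn).

(** A smooth transition from 1 to 0 on [a, b] as a composition of two flat
    functions: the inner one vanishes for s <= a, where the quotient is 1, and
    is at least its value at b for s >= b, where the outer one vanishes.  The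
    denominator is a constant. *)
Definition step a b (s : R) : R :=
  flat 0 (flat 0 (b - a) - flat 0 (s - a)) / flat 0 (flat 0 (b - a)).

Lemma step_denom_gt0 a b : a < b -> 0 < flat 0 (flat 0 (b - a)).
Proof. by move=> ab; do 2 apply: flat_gt0; rewrite subr_gt0. Qed.

Lemma step_eq1 a b s : a < b -> s <= a -> step a b s = 1.
Proof.
move=> ab sa; rewrite /step [flat 0 (s - a)]flat_eq0 ?subr_le0// subr0 divff//.
by rewrite gt_eqF// step_denom_gt0.
Qed.

Lemma step_eq0 a b s : b <= s -> step a b s = 0.
Proof.
move=> bs; rewrite /step [X in X / _]flat_eq0 ?mul0r// subr_le0.
by apply: flat0_mono; rewrite lerD2r.
Qed.

Lemma step_ge0 a b s : 0 <= step a b s.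
Proof. by rewrite divr_ge0 ?flat_ge0. Qed.

Lemma step_le1 a b s : a < b -> step a b s <= 1.
Proof.
move=> ab; rewrite ler_pdivrMr ?step_denom_gt0// mul1r; apply: flat0_mono.
by rewrite lerBlDr lerDl flat_ge0.
Qed.

(** The transition is taken in the squared distance, a polynomial, which keeps
    the function smooth at the centre z. *)
Definition cutoff z a b x : R := step (a ^+ 2) (b ^+ 2) (enorm (x - z) ^+ 2).

Lemma enorm_ge0 x : 0 <= enorm x. Proof. exact: sqrtr_ge0. Qed.

Lemma sqr_enorm x : enorm x ^+ 2 = \sum_i x 0 i ^+ 2.
Proof. by rewrite sqr_sqrtr// sumr_ge0// => i _; exact: sqr_ge0. Qed.

Lemma coord_le_enorm x i : `|x 0 i| <= enorm x.
Proof.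
rewrite -(@ler_pXn2r _ 2)// ?nnegrE ?enorm_ge0// sqr_enorm real_normK ?num_real//.
by rewrite (bigD1 i)//= lerDl sumr_ge0// => j _; exact: sqr_ge0.
Qed.

Lemma smooth_sqr_enorm z : smooth (fun x => enorm (x - z) ^+ 2).
Proof.
move=> k; rewrite (_ : (fun x => _) =
    fun x => \sum_i ((x 0 i + - z 0 i) * (x 0 i + - z 0 i))).
  apply: Ck_sum => i; apply: Ck_mul; apply: Ck_add;
    by [exact: Ck_coord|exact: Ck_cst].
by apply/funext => x; rewrite sqr_enorm; apply: eq_bigr => i _; rewrite !mxE expr2.
Qed.

Lemma smooth_continuous f : smooth f -> continuous f.
Proof. by move=> /(_ 0%N). Qed.

Lemma continuous_sqr_enorm z : continuous (fun x => enorm (x - z) ^+ 2).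
Proof. exact/smooth_continuous/smooth_sqr_enorm. Qed.

Lemma continuous_enorm : continuous (@enorm R n).
Proof.
move=> x; rewrite (_ : @enorm R n = Num.sqrt \o (fun x => enorm (x - 0) ^+ 2)).
  by apply: continuous_comp; [exact: continuous_sqr_enorm|exact: sqrt_continuous].
by apply/funext => y; rewrite /= subr0 sqrtr_sqr ger0_norm// enorm_ge0.
Qed.

Lemma smooth_cutoff z a b : smooth (cutoff z a b).
Proof.
move=> k; apply: Ck_mul; last exact: Ck_cst.
apply: Ck_flat; apply: Ck_add; first exact: Ck_cst.
rewrite (_ : (fun x => _) = fun x => (-1) * flat 0 (enorm (x - z) ^+ 2 + - a ^+ 2)).
  apply: Ck_mul; first exact: Ck_cst.
  by apply: Ck_flat; apply: Ck_add; [exact: smooth_sqr_enorm|exact: Ck_cst].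
by apply/funext => x; rewrite mulN1r.
Qed.

Lemma cutoff_eq1 z a b x : 0 <= a < b -> enorm (x - z) <= a -> cutoff z a b x = 1.
Proof.
move=> /andP[a0 ab] xa; apply: step_eq1.
  by rewrite ltr_pXn2r// nnegrE// (le_trans a0)// ltW.
by rewrite ler_pXn2r// nnegrE// enorm_ge0.
Qed.

Lemma cutoff_eq0 z a b x : 0 <= b -> b <= enorm (x - z) -> cutoff z a b x = 0.
Proof. by move=> b0 xa; apply: step_eq0; rewrite ler_pXn2r// nnegrE enorm_ge0. Qed.

Lemma cutoff_ge0 z a b x : 0 <= cutoff z a b x. Proof. exact: step_ge0. Qed.

Lemma cutoff_le1 z a b x : 0 <= a < b -> cutoff z a b x <= 1.
Proof.
move=> /andP[a0 ab]; apply: step_le1.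
by rewrite ltr_pXn2r// nnegrE// (le_trans a0)// ltW.
Qed.

Lemma test_mul f h : test f -> smooth h -> test (fun x => f x * h x).
Proof.
move=> [sf [r fr]] sh; split; first by move=> k; exact: Ck_mul.
by exists r => x /fr ->; rewrite mul0r.
Qed.

Lemma test_lin a f h : test f -> test h -> test (fun x => a * f x + h x).
Proof.
move=> [sf [r fr]] [sh [r' fr']]; split.
  by move=> k; apply: Ck_add => //; apply: Ck_mul => //; exact: Ck_cst.
exists (Num.max r r') => x; rewrite gt_max => /andP[/fr -> /fr' ->].
by rewrite mulr0 addr0.
Qed.

Lemma test0 : test ((fun=> 0) : Rn -> R).
Proof. by split; [move=> k; exact: Ck_cst|exists 0]. Qed.

Lemma test_cutoff a b : 0 <= b -> test (cutoff 0 a b).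
Proof.
move=> b0; split; first exact: smooth_cutoff.
by exists b => x bx; rewrite cutoff_eq0// subr0 ltW.
Qed.

Definition linear_on_tests (L : (Rn -> R) -> R) := forall a f h, test f -> test h ->
  L (fun x => a * f x + h x) = a * L f + L h.

Lemma linear_on_tests0 L : linear_on_tests L -> L (fun=> 0) = 0.
Proof.
move=> /(_ (-1) _ _ test0 test0).
rewrite (_ : (fun x : Rn => _) = fun=> 0); first by rewrite mulN1r addNr.
by apply/funext => x; rewrite mulr0 addr0.
Qed.

(** A functional that vanishes on test functions supported near each point of a
    compact set vanishes on those supported in the set.  For a finite cover by
    balls with cutoffs b_i, a test function f is decomposed as
    f = f b_1 + f (1 - b_1), the second summand being supported in the union
    of the remaining balls; this replaces a partition of unity. *)
Lemma locally_null_functional L (A : set Rn) : linear_on_tests L -> compact A ->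
  (forall x, A x -> exists2 d : R, 0 < d & forall f, test f ->
      (forall y, f y != 0 -> enorm (y - x) < d) -> L f = 0) ->
  forall f, test f -> (forall x, f x != 0 -> A x) -> L f = 0.
Proof.
move=> lL cA locA.
pose d x := if pselect (A x) is left Ax then sval (cid2 (locA x Ax)) else 1.
have dP x : A x -> 0 < d x /\ forall f, test f ->
      (forall y, f y != 0 -> enorm (y - x) < d x) -> L f = 0.
  by move=> Ax; rewrite /d; case: pselect => // Ax'; case: cid2.
pose U x : set Rn := [set y | enorm (y - x) ^+ 2 < (d x / 2) ^+ 2].
have oU x : open (U x).
  apply: (@open_comp _ _ (fun y => enorm (y - x) ^+ 2) [set t : R | t < (d x / 2) ^+ 2]).
    by move=> y _; exact: continuous_sqr_enorm.
  exact: open_lt.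
have AU : A `<=` cover A U.
  move=> x Ax; exists x => //; rewrite /U/= subrr.
  have [d0 _] := dP x Ax.
  rewrite (_ : enorm 0 = 0) ?expr0n/= ?exprn_gt0 ?divr_gt0//.
  by rewrite /enorm big1 ?sqrtr0// => i _; rewrite mxE expr0n.
move: cA; rewrite compact_cover => /(_ _ A U (fun x _ => oU x) AU) [D DA AD].
have main (s : seq Rn) : {in s, forall x, A x} -> forall f, test f ->
    (forall y, f y != 0 -> exists2 x, x \in s & U x y) -> L f = 0.
  elim: s => [_ f tf fs|x s IH sA f tf fs].
    rewrite (_ : f = fun=> 0) ?linear_on_tests0//.
    apply/funext => y; apply/eqP/negPn/negP => /fs[x]; by rewrite in_nil.
  have Ax : A x by apply: sA; rewrite mem_head.
  have [d0 Lx] := dP x Ax.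
  pose b := cutoff x (d x / 2) (d x).
  have t1 : test (fun y => f y * b y) by apply: test_mul => //; exact: smooth_cutoff.
  have t2 : test (fun y => f y * (1 + (-1) * b y)).
    apply: test_mul => // k; apply: Ck_add; first exact: Ck_cst.
    by apply: Ck_mul; [exact: Ck_cst|exact: smooth_cutoff].
  rewrite (_ : f = fun y => 1 * (f y * b y) + f y * (1 + (-1) * b y)); last first.
    by apply/funext => y; ring.
  rewrite lL// mul1r Lx ?add0r//.
  - apply: IH => //; first by move=> y ys; apply: sA; rewrite inE ys orbT.
    move=> y; rewrite mulf_eq0 negb_or => /andP[/fs[x' + Ux'] by1].
    rewrite inE => /predU1P[x'x|]; last by exists x'.
    move: by1; rewrite /b cutoff_eq1 ?mulr1 ?subrr ?eqxx//.
      by rewrite divr_ge0 ?ltW//= ltr_pdivrMr// ltr_pMr// ltr1n.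
    have d20 : 0 <= d x / 2 by rewrite divr_ge0// ltW.
    by move: Ux'; rewrite x'x /U/= ltr_pXn2r ?nnegrE ?enorm_ge0//; exact: ltW.
  - move=> y; rewrite mulf_eq0 negb_or => /andP[_]; rewrite ltNge; apply: contra.
    by move=> yd; rewrite /b cutoff_eq0 ?eqxx// (ltW d0).
move=> f tf fA; apply: (main (finmap.enum_fset D)) => //.
  by move=> x xD; have /set_mem := DA x xD.
by move=> y /fA /AD [x Dx Uxy]; exists x.
Qed.

Lemma compact_enorm_annulus a b : compact [set x : Rn | a <= enorm x <= b].
Proof.
apply: bounded_closed_compact.
  exists b; split; first exact: num_real.
  move=> M bM x /= /andP[_ xb].
  rewrite (le_trans _ (ltW bM))//.
  have b0 : 0 <= b by apply: le_trans xb; exact: enorm_ge0.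
  rewrite /Num.norm/= mx_normrE; apply/bigmax_leP; split => // -[i j] _ /=.
  by rewrite (ord1 i) (le_trans _ xb)// coord_le_enorm.
rewrite (_ : [set x | _] = (@enorm R n) @^-1` [set t | a <= t] `&` (@enorm R n) @^-1` [set t | t <= b]).
  apply: closedI; apply: closed_comp => //; by [move=> x _; exact: continuous_enorm|exact: closed_ge|exact: closed_le].
by apply/seteqP; split=> x /= => [/andP[]|[-> ->]].
Qed.

End cutoff_functions.

(** * The Laplace-Beltrami operator and the volume density *)

Section laplacian.
Context {R : realType} {n : nat}.
Local Notation Rn := ('rV[R]_n).
Implicit Types (f h : Rn -> R) (g : Rn -> 'M[R]_n).

Lemma partial_local f h x i : {near x, f =1 h} -> partial i f x = partial i h x.
Proof. by move=> fh; apply: near_eq_derive. Qed.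

Lemma laplace_beltrami_local g f h x : {near x, f =1 h} ->
  laplace_beltrami g f x = laplace_beltrami g h x.
Proof.
move=> fh; rewrite /laplace_beltrami.
apply: (congr1 (fun s => _ * s)); apply: eq_bigr => j _.
apply: partial_local.
have : \forall y \near x, {near y, f =1 h} by exact: near_join.
apply: filterS => y fhy; apply: eq_bigr => k _.
by rewrite (partial_local k fhy).
Qed.

Lemma laplace_beltrami_cst g a x : laplace_beltrami g (fun=> a) x = 0.
Proof.
rewrite /laplace_beltrami big1 ?mulr0// => j _.
rewrite (_ : (fun y => _) = fun=> 0) ?partial_cst//.
by apply/funext => y; rewrite big1// => k _; rewrite partial_cst mulr0.
Qed.

(** The determinant of (1 - s) I + s A is a polynomial in s, without root in
    [0, 1] since these matrices are positive definite, and equal to 1 at 0. *)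
Lemma posdef_det_gt0 (A : 'M[R]_n) :
  (forall xi : Rn, xi != 0 -> 0 < (xi *m A *m xi^T) 0 0) -> 0 < \det A.
Proof.
move=> pA.
(* the segment from the identity to A, as a matrix of polynomials in s *)
pose B : 'M[{poly R}]_n := \matrix_(i, j) ((1 - 'X) * (1%:M i j)%:P + 'X * (A i j)%:P).
have BE s : (\det B).[s] = \det ((1 - s) *: 1%:M + s *: A).
  rewrite -[LHS]/(horner_eval s (\det B)) -det_map_mx; congr (\det _).
  by apply/matrixP => i j; rewrite !mxE /= /horner_eval !hornerE.
have B0 s : 0 <= s <= 1 -> (\det B).[s] != 0.
  move=> /andP[s0 s1]; rewrite BE; apply/negP => /det0P[v v0 vB].
  have : (v *m ((1 - s) *: 1%:M + s *: A) *m v^T) 0 0 = 0 by rewrite vB mul0mx mxE.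
  rewrite mulmxDr -!scalemxAr mulmx1 mulmxDl -!scalemxAl !mxE => H.
  have vv : 0 < \sum_j v 0 j * v^T j 0.
    have [j vj] : exists j, v 0 j != 0.
      apply/existsP; move: v0; apply: contraR; rewrite negb_exists => /forallP v0.
      by apply/eqP/rowP => j; rewrite mxE; apply/eqP; move: (v0 j); rewrite negbK.
    rewrite (bigD1 j)//= mxE -expr2 ltr_pwDl ?exprn_even_gt0//.
    by rewrite sumr_ge0// => k _; rewrite mxE -expr2 sqr_ge0.
  have := pA v v0; rewrite mxE => vAv.
  have [s1'|s1'] := eqVneq s 1; first by move: H; rewrite s1' subrr mul0r add0r mul1r; lra.
  have : 0 < (1 - s) * \sum_j v 0 j * v^T j 0 by rewrite mulr_gt0// subr_gt0 lt_neqAle s1'.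
  have : 0 <= s * \sum_j (v *m A) 0 j * v^T j 0 by rewrite mulr_ge0// ltW.
  lra.
rewrite ltNge; apply/negP => dA.
have [|s /andP[s0 s1] rs] := @poly_ivt R (- \det B) 0 1 ler01.
  rewrite !hornerN !BE subr0 scale1r scale0r addr0 det1 lerN10 subrr scale0r add0r scale1r.
  by rewrite oppr_ge0.
by move: rs; rewrite rootN /root (negbTE (B0 s _))// s0.
Qed.

(** Evaluating the lower bound for the inverse at the i-th row e_i A of A gives
    d |e_i A|^2 <= A_ii <= |e_i A|. *)
Lemma posdef_entry_le (A : 'M[R]_n) (d : R) : 0 < d -> A^T = A ->
  A \in unitmx ->
  (forall xi : Rn, d * enorm xi ^+ 2 <= (xi *m invmx A *m xi^T) 0 0) ->
  forall i j, `|A i j| <= d^-1.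
Proof.
move=> d0 sA uA H i j.
pose e : Rn := delta_mx 0 i.
have rowE k : (e *m A) 0 k = A i k by rewrite /e -rowE mxE.
have := H (e *m A).
rewrite mulmxK// trmx_mul sA.
have -> : (e *m (A *m e^T)) 0 0 = A i i.
  rewrite mulmxA /e mxE (bigD1 i)//= big1 => [|k ki].
    by rewrite rowE !mxE !eqxx mulr1 addr0.
  by rewrite !mxE (negbTE ki) andbF mulr0.
have Ai k : `|A i k| <= enorm (e *m A) by rewrite -rowE; exact: coord_le_enorm.
move=> H1.
have E0 := enorm_ge0 (e *m A).
apply: (le_trans (Ai j)).
have H2 : d * enorm (e *m A) ^+ 2 <= enorm (e *m A).
  by rewrite (le_trans H1)// (le_trans _ (Ai i))// ler_norm//.
have [->|E1] := eqVneq (enorm (e *m A)) 0; first by rewrite invr_ge0 (ltW d0).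
have {E1}E0 : 0 < enorm (e *m A) by rewrite lt_neqAle eq_sym E1.
move: H2; rewrite expr2 mulrA ger_pMl// => H2.
by rewrite -[_^-1]mul1r ler_pdivlMr// mulrC.
Qed.

Lemma det_le (A : 'M[R]_n) (M : R) : (forall i j, `|A i j| <= M) ->
  `|\det A| <= (n`!)%:R * M ^+ n.
Proof.
move=> AM; apply: (le_trans (ler_norm_sum _ _ _)).
apply: (@le_trans _ _ (\sum_(s : 'S_n) M ^+ n)).
  apply: ler_sum => s _; rewrite normrM normrX normrN1 expr1n mul1r normr_prod.
  rewrite -[X in _ ^+ X]card_ord -prodr_const; apply: ler_prod => i _.
  by rewrite normr_ge0 AM.
by rewrite sumr_const card_Sn mulr_natl lexx.
Qed.

Section metric.
Variable g : Rn -> 'M[R]_n.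
Hypothesis gP : riemannian_metric g.

Lemma metric_det_gt0 x : 0 < \det (g x).
Proof. by case: gP => _ _ pd; apply: posdef_det_gt0; exact: pd. Qed.

Lemma smooth_density : smooth (fun x => Num.sqrt (\det (g x))).
Proof.
move=> k; apply: Ck_sqrt; first exact: metric_det_gt0.
by apply: Ck_det => i j; case: gP => sg _ _; exact: sg.
Qed.

Lemma density_gt0 x : 0 < Num.sqrt (\det (g x)).
Proof. by rewrite sqrtr_gt0 metric_det_gt0. Qed.

Lemma smooth_laplace_beltrami f : smooth f -> smooth (laplace_beltrami g f).
Proof.
move=> sf k; apply: Ck_mul.
  apply: Ck_inv => [x|]; last exact: smooth_density.
  by rewrite gt_eqF// density_gt0.
apply: Ck_sum => j; apply: Ck_partial; apply: Ck_sum => l.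
apply: Ck_mul; last by apply: Ck_partial; exact: sf.
apply: Ck_mul; first exact: smooth_density.
apply: Ck_invmx => [x|a b]; first by rewrite gt_eqF// metric_det_gt0.
by case: gP => sg _ _; exact: sg.
Qed.

Lemma test_laplace_beltrami f : test f -> test (laplace_beltrami g f).
Proof.
move=> [sf [r fr]]; split; first exact: smooth_laplace_beltrami.
exists r => x rx; rewrite -(laplace_beltrami_cst g 0 x).
apply: laplace_beltrami_local.
have : nbhs x ((@enorm R n) @^-1` [set t | r < t]).
  by apply: continuous_enorm; exact: lt_nbhsr.
by apply: filterS => y /= /fr.
Qed.

End metric.
End laplacian.

(** * Lebesgue measure of balls and shells *)

Section measurability_on_tuples.
Context {R : realType} {n : nat}.
Local Notation Rn := ('rV[R]_n).
Local Notation RT := (measurableTypeR R).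

Let box (q : 'rV[rat]_n * nat) : set Rn :=
  [set x | forall i, `|x 0 i - ratr (q.1 0 i)| < q.2.+1%:R^-1].

Let open_boxes (U : set Rn) : open U -> U = \bigcup_q (if `[< box q `<=` U >] then box q else set0).
Proof.
move=> oU; apply/seteqP; split; last first.
  by move=> x [q _]; case: asboolP => // + qx; exact.
move=> x Ux.
have /nbhs_ballP[e /= e0 xeU] : nbhs x U by exact: open_nbhs_nbhs.
have [k ke] : exists k, k.+1%:R^-1 < e / 2.
  have e20 : 0 < e / 2 by rewrite divr_gt0.
  by have [k] := ltr_add_invr e20; rewrite add0r; exists k.
have k0 : (0:R) < k.+1%:R^-1 by rewrite invr_gt0 ltr0n.
have qP i : exists q : rat, `|x 0 i - ratr q| < k.+1%:R^-1.
  have /rat_in_itvoo[q] : x 0 i - k.+1%:R^-1 < x 0 i + k.+1%:R^-1.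
    by move: (_^-1) k0 => d d0; lra.
  rewrite in_itv/= => /andP[q1 q2]; exists q; rewrite ltr_norml.
  by move: (_^-1) q1 q2 => d q1 q2; apply/andP; split; lra.
have [r rP] : exists r : 'rV[rat]_n, forall i, `|x 0 i - ratr (r 0 i)| < k.+1%:R^-1.
  by exists (\row_i sval (cid (qP i))) => i; rewrite mxE; case: cid.
exists (r, k) => //.
have xb : box (r, k) x by [].
case: asboolP => // -[] y yb; apply: xeU; split => // i j; rewrite (ord1 i).
move: (xb j) (yb j); rewrite /= /ball/= !ltr_norml => /andP[+ +] /andP[+ +].
move: (ratr _) (_.+1%:R^-1) ke => s d *.
by apply/andP; split; lra.
Qed.

(** The sigma-algebra on tuples is generated by the coordinates, and an open set
    is a countable union of boxes with rational centres and widths. *)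
Lemma measurable_open_row (U : set Rn) : open U ->
  measurable (row_of_tuple @^-1` U : set (n.-tuple RT)).
Proof.
move=> /open_boxes ->; rewrite preimage_bigcup.
apply: countable_bigcupT_measurable => // q.
case: asboolP => _; last by rewrite preimage_set0.
rewrite (_ : _ @^-1` _ = \bigcap_(i in [set: 'I_n])
   ((fun t : n.-tuple RT => tnth t i) @^-1` [set s : R | `|s - ratr (q.1 0 i)| < q.2.+1%:R^-1])).
  apply: fin_bigcap_measurable => [|i _]; first exact: finite_finset.
  rewrite -[X in measurable X]setTI; apply: measurable_tnth => //.
  rewrite (_ : [set s | _] = ball (ratr (q.1 0 i) : R) q.2.+1%:R^-1).
    exact: measurable_ball.
  by apply/seteqP; split => s /=; rewrite /ball/= distrC.
apply/seteqP; split => t /= H i; first by move=> _; have := H i; rewrite mxE.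
by rewrite mxE; exact: H.
Qed.

Lemma continuous_measurable_row (f : Rn -> R) : continuous f ->
  measurable_fun setT (f \o row_of_tuple : n.-tuple RT -> RT).
Proof.
move=> cf; apply: (measurability _ (RGenOInfty.measurableE R)).
move=> _ [_ [a ->] <-]; rewrite setTI.
rewrite (_ : _ @^-1` _ = row_of_tuple @^-1` (f @^-1` `]a, +oo[)) //.
apply: measurable_open_row; apply: open_comp; first by move=> x _; exact: cf.
exact: interval_open.
Qed.

End measurability_on_tuples.

Section scaling.
Context {R : realType}.
Local Notation RT := (measurableTypeR R).
Local Notation mu := (@lebesgue_measure R).

Lemma measurable_mulR (a : R) : measurable_fun setT ( *%R a : RT -> RT).
Proof. exact: mulrl_measurable. Qed.

(** Both sides are measures that agree on half-open intervals. *)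
Lemma lebesgue_measure_scale (a : R) (A : set RT) : 0 < a -> measurable A ->
  mu A = (a%:E * mu ( *%R a @^-1` A))%E.
Proof.
move=> a0 mA.
pose a' : {nonneg R} := NngNum (ltW a0).
pose nu : measure RT R := mscale a' (pushforward mu ( *%R a : RT -> RT)).
have -> : (a%:E * mu ( *%R a @^-1` A))%E = nu (measurable_mulR a) A by [].
apply: lebesgue_measure_unique => // _ [[c d] _ <-] /=.
rewrite /nu /= /mscale /= /pushforward (_ : _ @^-1` _ = `]c / a, d / a]%classic); last first.
  by apply/seteqP; split => x /=; rewrite !in_itv/= ltr_pdivrMr// ler_pdivlMr// ![x * a]mulrC.
rewrite !lebesgue_measure_itv /= !lte_fin ltr_pM2r ?invr_gt0//.
case: ifPn => _; last by rewrite mule0.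
by rewrite -!EFinD -EFinM; congr EFin; field; rewrite gt_eqF.
Qed.

Definition tscale n (a : R) (t : n.-tuple RT) : n.-tuple RT := [tuple of map ( *%R a) t].

Lemma measurable_tscale n a : measurable_fun setT (@tscale n a).
Proof.
apply/measurable_fun_tnthP => i.
rewrite (_ : _ \o _ = *%R a \o (fun t => tnth t i)).
  by apply: measurableT_comp; [exact: measurable_mulR|exact: measurable_tnth].
by apply/funext => t /=; rewrite tnth_map.
Qed.

(** Induction on n: the sections of a dilated set are dilated sections, so one
    dimension contributes one factor a. *)
Lemma lebn_scale n (a : R) (A : set (n.-tuple RT)) : 0 < a -> measurable A ->
  lebn n A = ((a ^+ n)%:E * lebn n (tscale a @^-1` A))%E.
Proof.
move=> a0; elim: n A => [|n IH] A mA.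
  rewrite expr0 mul1e /= !diracE; congr ((_ _)%:R%:E).
  apply/idP/idP; rewrite !inE /=; by rewrite (_ : tscale _ _ = [tuple]) //; exact/val_inj.
pose B : set (RT * n.-tuple RT) := @tcons R n @^-1` A.
have mB : measurable B by rewrite -[B]setTI; exact: measurable_tcons.
pose h y := lebn n (xsection B y).
have mh : measurable_fun setT h by exact: measurable_fun_xsection.
have mBy y : measurable (xsection B y) by exact: measurable_xsection.
pose nu0 : measure RT R := mscale (NngNum (ltW a0)) (pushforward mu ( *%R a : RT -> RT)).
pose nu := nu0 (measurable_mulR a).
transitivity (\int[mu]_y h y)%E; first by [].
rewrite (eq_measure_integral nu); last first.
  by move=> C mC _; rewrite /nu /nu0 /= /mscale /= /pushforward -lebesgue_measure_scale.
rewrite ge0_integral_mscale//=.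
rewrite ge0_integral_pushforward//= preimage_setT.
pose B' : set (RT * n.-tuple RT) := @tcons R n @^-1` (tscale a @^-1` A).
have mB' : measurable B'.
  rewrite -[B']setTI; apply: measurable_tcons => //.
  by rewrite -[X in measurable X]setTI; exact: measurable_tscale.
have B'E y : xsection B' y = tscale a @^-1` (xsection B (a * y)).
  apply/seteqP; split => t; rewrite /xsection /= !inE /B' /B /tcons /=;
    by rewrite (_ : tscale a _ = [tuple of a * y :: tscale a t]) //; exact/val_inj.
have -> : lebn_step (lebn n) (tscale a @^-1` A) = (\int[mu]_y lebn n (xsection B' y))%E by [].
rewrite exprS EFinM -muleA; congr (_ * _)%E.
rewrite -ge0_integralZl//=.
- by apply: eq_integral => y _ /=; rewrite /h IH// B'E.
- exact: measurable_fun_xsection.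
- by rewrite lee_fin exprn_ge0// ltW.
Qed.

Definition eball n (r : R) : set (n.-tuple RT) := [set t | enorm (row_of_tuple t) <= r].
Arguments eball n r : clear implicits.

Lemma measurable_eball n r : measurable (eball n r).
Proof.
rewrite (_ : eball n r = (@enorm R n \o row_of_tuple) @^-1` `]-oo, r]); last first.
  by apply/seteqP; split => t; rewrite /eball /= in_itv.
rewrite -[X in measurable X]setTI.
by apply: continuous_measurable_row => //; exact: continuous_enorm.
Qed.

Lemma enorm_tscale n a (t : n.-tuple RT) : 0 <= a ->
  enorm (row_of_tuple (tscale a t)) = a * enorm (row_of_tuple t).
Proof.
move=> a0; rewrite /enorm -[in RHS](ger0_norm a0) -sqrtr_sqr -sqrtrM ?sqr_ge0//.
congr Num.sqrt; rewrite mulr_sumr; apply: eq_bigr => i _.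
by rewrite !mxE tnth_map exprMn.
Qed.

Lemma lebn_eball_scale n r : 0 < r -> lebn n (eball n r) = ((r ^+ n)%:E * lebn n (eball n 1))%E.
Proof.
move=> r0; rewrite (lebn_scale r0); last exact: measurable_eball.
congr (_ * lebn n _)%E; apply/seteqP; split => t; rewrite /eball /= enorm_tscale ?(ltW r0)//.
  by rewrite ger_pMr.
by rewrite ger_pMr.
Qed.

Lemma lebn_cube n (r : R) : 0 <= r ->
  (measurable [set t : n.-tuple RT | forall i, (tnth t i : R) \in `[-r, r] ] /\
  lebn n [set t : n.-tuple RT | forall i, (tnth t i : R) \in `[-r, r] ] = ((2 * r) ^+ n)%:E)%R.
Proof.
move=> r0.
have mc m : measurable [set t : m.-tuple RT | forall i, (tnth t i : R) \in `[-r, r] ].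
  rewrite (_ : [set t | _] = \bigcap_(i in [set: 'I_m])
      ((fun t : m.-tuple RT => tnth t i) @^-1` `[-r, r])).
    apply: fin_bigcap_measurable => [|i _]; first exact: finite_finset.
    by rewrite -[X in measurable X]setTI; exact: measurable_tnth.
  by apply/seteqP; split => t /= H i; [move=> _; exact: H|exact: H].
split => //; elim: n => [|n IH].
  rewrite expr0 /= diracE; have -> // : ([tuple] : 0.-tuple RT) \in
     [set t : 0.-tuple RT | forall i, (tnth t i : R) \in `[-r, r] ].
  by rewrite inE /=; case.
rewrite /= /lebn_step /pushforward.
rewrite (_ : _ @^-1` _ = (`[-r, r] : set R) `*`
   [set t : n.-tuple RT | forall i, (tnth t i : R) \in `[-r, r] ]).
  rewrite product_measure1E//; last exact: mc.
  rewrite IH.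
  transitivity (lebesgue_measure ([set` `[- r, r]%R] : set R) * ((2 * r) ^+ n)%:E)%E => //.
  rewrite lebesgue_measure_itv/= lte_fin; case: ltP => rr.
    by rewrite -EFinB -EFinM exprS; congr (_ * _)%:E; ring.
  have -> : r = 0 by lra.
  by rewrite mul0e mulr0 expr0n.
apply/seteqP; split => -[x t] /=.
  by move=> H; split; [have := H ord0|move=> i; have := H (lift ord0 i)]; rewrite (tnth_nth 0) //= -tnth_nth.
move=> [xr tr] i; case: (unliftP ord0 i) => [j|] ->.
  by rewrite (tnth_nth 0) /= -tnth_nth; exact: tr.
by rewrite (tnth_nth 0).
Qed.

Lemma lebn_eball1_fin n : (lebn n (eball n 1) < +oo)%E.
Proof.
have [mc cE] := @lebn_cube n 1 ler01.
apply: (@le_lt_trans _ _ (lebn n [set t : n.-tuple RT | forall i, (tnth t i : R) \in `[-1, 1] ])%R).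
  apply: le_measure; rewrite ?inE//; first exact: measurable_eball.
  move=> t /= t1 i; rewrite in_itv /= -ler_norml (le_trans _ t1)//.
  by have := coord_le_enorm (row_of_tuple t) i; rewrite mxE.
by rewrite cE ltry.
Qed.

End scaling.
Arguments eball {R} n r.

Section shells.
Context {R : realType}.
Local Notation RT := (measurableTypeR R).

Definition enormt n (t : n.-tuple RT) : R := enorm (row_of_tuple t).

Lemma measurable_enormt n : measurable_fun setT (@enormt n : n.-tuple RT -> RT).
Proof. by apply: continuous_measurable_row; exact: continuous_enorm. Qed.

Definition unit_vol n : R := fine (lebn n (eball n 1)).

Lemma unit_vol_ge0 n : 0 <= unit_vol n.
Proof. by apply: fine_ge0; exact: measure_ge0. Qed.

Lemma lebn_eball n r : 0 < r -> lebn n (eball n r) = (r ^+ n * unit_vol n)%:E.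
Proof.
move=> r0; rewrite lebn_eball_scale// EFinM /unit_vol fineK//.
by rewrite ge0_fin_numE ?lebn_eball1_fin// measure_ge0.
Qed.

Lemma expr_diff_le n (s : R) : 1 <= s -> s ^+ n - (s - 1) ^+ n <= n%:R * s ^+ n.-1.
Proof.
move=> s1; rewrite subrXX opprB addrC subrK mul1r.
rewrite mulr_natl -[X in _ *+ X]card_ord -sumr_const; apply: ler_sum => i _.
case: n i => [[]//|n i] /=.
have -> : s ^+ n = s ^+ (n - i) * s ^+ i by rewrite -exprD subnK// -ltnS.
by apply: ler_wpM2l; rewrite ?exprn_ge0// ?lerXn2r ?nnegrE//; lra.
Qed.

Let w nu (s : R) n (t : n.-tuple RT) : \bar R := (expR (- nu * (s - enormt t)))%:E.

Let mw nu s n D : measurable_fun D (@w nu s n).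
Proof.
apply/measurable_EFinP; apply: (measurable_funS measurableT) => //.
apply: measurableT_comp; first exact: measurable_expR.
apply: measurable_funM => //; apply: measurable_funB => //.
exact: measurable_enormt.
Qed.

(** The weight e^(-nu (s - |x|)) is concentrated in a shell of bounded width
    below |x| = s, of volume O(s^(n-1)).  In the induction on an integer bound
    for s, the ball of radius s is split into the ball of radius s - 1, on
    which the weight is e^(-nu) times the weight for s - 1, and a shell. *)
Lemma shell_integral_le n nu : (0 < n)%N -> 0 < nu -> exists2 A : R, 0 < A &
  forall s, 0 < s ->
  (\int[lebn n]_(t in eball n s) (expR (- nu * (s - enormt t)))%:E
     <= (A * (1 + s) ^+ n.-1)%:E)%E.
Proof.
move=> n0 nu0.
have e1 : expR (- nu) < 1 by rewrite expR_lt1 oppr_lt0.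
(* the last summand ensures that e^(-nu) A + n vol <= A, which closes the
   induction *)
pose A := 1 + unit_vol n + unit_vol n * n%:R / (1 - expR (- nu)).
have V0 := unit_vol_ge0 n.
have A1 : 0 <= unit_vol n * n%:R / (1 - expR (- nu)).
  by rewrite divr_ge0 ?mulr_ge0// subr_ge0 ltW.
have A0 : 0 < A by rewrite /A; lra.
exists A => //.
have crude s : (\int[lebn n]_(t in eball n s) (w nu s t) <= lebn n (eball n s))%E.
  rewrite -[leRHS]mul1e -integral_cst; last exact: measurable_eball.
  apply: ge0_le_integral => //.
  - exact: measurable_eball.
  - by move=> t _; rewrite lee_fin expR_ge0.
  - exact: mw.
  - move=> t /= ts; rewrite lee_fin -expR0 ler_expR mulNr oppr_le0.
    by rewrite mulr_ge0 ?(ltW nu0)// subr_ge0.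
suff main N s : 0 < s -> s <= N.+1%:R ->
    (\int[lebn n]_(t in eball n s) (w nu s t) <= (A * (1 + s) ^+ n.-1)%:E)%E.
  move=> s s0; have := main (Num.truncn s) s s0; apply.
  by rewrite ltW// truncnS_gt.
elim: N s => [|N IH] s s0 sN.
  apply: (le_trans (crude s)); rewrite lebn_eball// lee_fin.
  apply: (@le_trans _ _ (1 * A)); last by rewrite mulrC ler_wpM2l ?(ltW A0)// exprn_ege1//; lra.
  rewrite mul1r; apply: (@le_trans _ _ (1 * unit_vol n)).
    by apply: ler_wpM2r => //; rewrite exprn_ile1// ltW.
  by rewrite /A; lra.
have [s1|s1] := leP s 1; first by apply: IH => //; rewrite (le_trans s1)// ler1n.
set D := eball n s; set D' := eball n (s - 1).
have mD : measurable D by exact: measurable_eball.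
have mD' : measurable D' by exact: measurable_eball.
have D'D : D' `<=` D by move=> t; rewrite /D /D' /eball /=; lra.
rewrite -(setDUK D'D) ge0_integral_setU//; last 4 first.
- exact: measurableD.
- exact: mw.
- by move=> t _; rewrite lee_fin expR_ge0.
- by apply/disj_setPS => t [? []].
apply: (@le_trans _ _ ((expR (- nu) * (A * (1 + (s - 1)) ^+ n.-1))%:E +
    (unit_vol n * (n%:R * s ^+ n.-1))%:E)%E).
  apply: leeD.
    rewrite EFinM -lee_pdivrMl ?expR_gt0//.
    rewrite -ge0_integralZl; last 4 first.
    + exact: mD'.
    + exact: mw.
    + by move=> t _; rewrite lee_fin expR_ge0.
    + by rewrite lee_fin invr_ge0 expR_ge0.
    apply: le_trans (IH (s - 1) _ _); last 2 first.
    + by rewrite subr_gt0.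
    + by rewrite lerBlDr natr1.
    rewrite le_eqVlt; apply/orP; left; apply/eqP; apply: eq_integral => t _ /=.
    rewrite /w -EFinM -expRN -expRD; congr (expR _)%:E; ring.
  apply: (@le_trans _ _ (lebn n (D `\` D'))).
    rewrite -[leRHS]mul1e -integral_cst; last exact: measurableD.
    apply: ge0_le_integral => //.
    - exact: measurableD.
    - by move=> t _; rewrite lee_fin expR_ge0.
    - exact: mw.
    - move=> t /= [ts _]; rewrite lee_fin -expR0 ler_expR mulNr oppr_le0.
      by rewrite mulr_ge0 ?(ltW nu0)// subr_ge0.
  have -> : lebn n (D `\` D') = (lebn n D - lebn n D')%E.
    rewrite -[in RHS](setIidr D'D); apply: measureD => //.
    by have := ltry (s ^+ n * unit_vol n); rewrite -(lebn_eball n s0).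
  rewrite !lebn_eball ?subr_gt0// -EFinB lee_fin -mulrBl mulrC.
  by rewrite ler_wpM2l// expr_diff_le// ltW.
rewrite -EFinD lee_fin addrCA subrr addr0.
have E : unit_vol n * n%:R <= (1 - expR (- nu)) * A.
  rewrite /A mulrDr [X in _ + X]mulrC divfK; last by rewrite subr_eq0 eq_sym; lra.
  by rewrite lerDr mulr_ge0//; lra.
apply: (@le_trans _ _ (A * s ^+ n.-1)).
  have s0' : 0 <= s ^+ n.-1 by rewrite exprn_ge0// ltW.
  have := ler_wpM2r s0' E; lra.
by rewrite ler_wpM2l ?(ltW A0)// lerXn2r ?nnegrE; lra.
Qed.

End shells.

(** * Weighted volume integrals and a lower form of Hoelder's inequality *)

Section japanese_weight.
Context {R : realType}.

Lemma jap_gt0 (r : R) : 0 < jap r.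
Proof. by rewrite sqrtr_gt0 ltr_pwDl// sqr_ge0. Qed.

Lemma jap_ge1 (r : R) : 1 <= jap r.
Proof. by rewrite -sqrtr1 ler_wsqrtr// lerDl sqr_ge0. Qed.

Lemma jap_ge_norm (r : R) : `|r| <= jap r.
Proof. by rewrite -sqrtr_sqr ler_wsqrtr// lerDr. Qed.

Lemma one_plus_le_expR (k y : R) : 0 < k -> 0 <= y -> 1 + y <= (1 + k^-1) * expR (k * y).
Proof.
move=> k0 y0; rewrite mulrDl mul1r; apply: lerD.
  by rewrite -expR0 ler_expR mulr_ge0// ltW.
by rewrite -ler_pdivrMl ?invr_gt0// invrK (le_trans _ (expR_ge1Dx _))// lerDr.
Qed.

(** A polynomial weight at r can be moved to s at the cost of half of the
    exponential decay, since 1 + s <= (1 + r) (1 + (s - r)). *)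
Lemma jap_weight_le (lam al nu : R) : 0 < lam -> 0 <= al -> 0 < nu ->
  exists2 C : R, 0 < C & forall r s, 0 <= r -> r <= s ->
  jap (lam * r) `^ (- al) * expR (- nu * (s - r)) <=
  C * (1 + s) `^ (- al) * expR (- (nu / 2) * (s - r)).
Proof.
move=> lam0 al0 nu0.
(* k al <= nu / 2, so that the al-th power of the factor e^(k (s - r)) is
   absorbed by half of the exponential *)
pose k := nu / (2 * (al + 1)).
have k0 : 0 < k by rewrite divr_gt0// mulr_gt0//; lra.
have kal : k * al <= nu / 2.
  by rewrite -subr_ge0 (_ : _ - _ = k) ?(ltW k0)// /k; field; lra.
pose C := ((1 + lam^-1) * (1 + k^-1)).
have C0 : 0 < C by rewrite mulr_gt0// addr_gt0// invr_gt0.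
exists (C `^ al); first exact: powR_gt0.
move=> r s r0 rs.
have s1 : 0 < 1 + s by lra.
have j0 := jap_gt0 (lam * r).
have key : 1 + s <= C * jap (lam * r) * expR (k * (s - r)).
  have e1 : 1 + r <= (1 + lam^-1) * jap (lam * r).
    rewrite mulrDl mul1r; apply: lerD; first exact: jap_ge1.
    rewrite -ler_pdivrMl ?invr_gt0// invrK (le_trans _ (jap_ge_norm _))//.
    exact: ler_norm.
  have e2 := @one_plus_le_expR k (s - r) k0 (ltac:(by rewrite subr_ge0)).
  have e3 : 1 + s <= (1 + r) * (1 + (s - r)).
    have : 0 <= r * (s - r) by rewrite mulr_ge0// subr_ge0.
    lra.
  apply: (le_trans e3); rewrite [X in _ <= X](_ : _ =
    ((1 + lam^-1) * jap (lam * r)) * ((1 + k^-1) * expR (k * (s - r)))); last by rewrite /C; ring.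
  by apply: ler_pM => //; lra.
have keya : (1 + s) `^ al <= C `^ al * jap (lam * r) `^ al * expR ((nu / 2) * (s - r)).
  apply: (@le_trans _ _ ((C * jap (lam * r) * expR (k * (s - r))) `^ al)).
    apply: ge0_ler_powR => //; rewrite ?nnegrE; first lra.
    by apply: mulr_ge0; [apply: mulr_ge0; exact: ltW|exact: expR_ge0].
  have [C0w j0w] := (ltW C0, ltW j0).
  rewrite (powRM _ (mulr_ge0 C0w j0w) (expR_ge0 _)) (powRM _ C0w j0w).
  apply: ler_wpM2l; first by rewrite mulr_ge0 ?powR_ge0.
  by rewrite -expRM ler_expR mulrAC ler_wpM2r// subr_ge0.
have X0 : 0 < (1 + s) `^ al by exact: powR_gt0.
have J0 : 0 < jap (lam * r) `^ al by exact: powR_gt0.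
rewrite !powRN (_ : - nu * (s - r) = - (nu / 2 * (s - r)) - (nu / 2 * (s - r))); last by field.
rewrite mulNr expRD mulrA; apply: ler_wpM2r; first exact: expR_ge0.
rewrite expRN -invfM ler_pdivlMr// mulrC ler_pdivrMr ?mulr_gt0 ?expR_gt0//.
by rewrite mulrA.
Qed.

End japanese_weight.

Section volume_integrals.
Context {R : realType} {n : nat}.
Local Notation Rn := ('rV[R]_n).
Local Notation RT := (measurableTypeR R).
Variable g : Rn -> 'M[R]_n.
Hypothesis gP : riemannian_metric g.
Variable Cg : R.
Hypothesis gC : forall x, Num.sqrt (\det (g x)) <= Cg.
Implicit Types (F G h : Rn -> R).

Definition row_measurable F := measurable_fun setT (F \o row_of_tuple : n.-tuple RT -> RT).

Definition vintegrable F := (lebn n).-integrable setT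
  (EFin \o (fun t => F (row_of_tuple t) * Num.sqrt (\det (g (row_of_tuple t))))).

Lemma row_measurable_density : row_measurable (fun x => Num.sqrt (\det (g x))).
Proof. exact: (continuous_measurable_row (smooth_continuous (smooth_density gP))). Qed.

Lemma density_bound_ge0 : 0 <= Cg.
Proof. by apply: le_trans (gC 0); exact: sqrtr_ge0. Qed.

Lemma vintegrable_bounded F h (M r : R) : loc_integrable F -> row_measurable h ->
  (forall x, `|h x| <= M) -> (forall x, r < enorm x -> h x = 0) ->
  vintegrable (fun x => F x * h x).
Proof.
move=> [mF iF] mh hM hr.
have M0 : 0 <= M by apply: le_trans (hM 0).
have mB := @measurable_eball R n r.
have := integrableZl measurableT (M * Cg) (proj1 (integrable_mkcond _ mB) (iF r)).
apply: le_integrable => //.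
  apply/measurable_EFinP; apply: measurable_funM; last exact: row_measurable_density.
  exact: measurable_funM.
move=> t _ /=; rewrite patchE; case: ifPn => [_|].
  rewrite -EFinM lee_fin !normrM [`|M|]ger0_norm// [`|Cg|]ger0_norm ?density_bound_ge0//.
  rewrite [`|Num.sqrt _|]ger0_norm ?sqrtr_ge0// -mulrA [leRHS]mulrC.
  apply: ler_wpM2l => //; apply: ler_pM => //; exact: sqrtr_ge0.
rewrite notin_setE /eball /= => /negP; rewrite -ltNge => rt.
by rewrite hr// mulr0 mul0r normr0 lee_fin.
Qed.

Lemma vint_lin a F G : vintegrable F -> vintegrable G ->
  vint g (fun x => a * F x + G x) = a * vint g F + vint g G.
Proof.
move=> iF iG; rewrite /vint -RintegralZl// -RintegralD//; last first.
  by apply: eq_integrable (integrableZl measurableT a iF) => // t _ /=; rewrite EFinM.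
by apply: eq_Rintegral => t _; ring.
Qed.

Lemma vintZ a F : vintegrable F -> vint g (fun x => a * F x) = a * vint g F.
Proof.
move=> iF; rewrite /vint -RintegralZl//.
by apply: eq_Rintegral => t _; ring.
Qed.

Lemma vintegrable_lin a F G : vintegrable F -> vintegrable G ->
  vintegrable (fun x => a * F x + G x).
Proof.
move=> iF iG; have := integrableD measurableT (integrableZl measurableT a iF) iG.
apply: eq_integrable => // t _ /=.
by rewrite -EFinM -EFinD; congr EFin; ring.
Qed.

Lemma le_vint F G : vintegrable F -> vintegrable G -> (forall x, F x <= G x) ->
  vint g F <= vint g G.
Proof.
by move=> iF iG FG; apply: le_Rintegral => // t _; apply: ler_wpM2r => //; exact: sqrtr_ge0.
Qed.

Lemma vint_ge0 F : (forall x, 0 <= F x) -> 0 <= vint g F.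
Proof. by move=> F0; apply: Rintegral_ge0 => t _; rewrite mulr_ge0// sqrtr_ge0. Qed.

Lemma loc_integrable_cst (a : R) : loc_integrable (fun _ : Rn => a).
Proof.
split; first exact: measurable_cst.
move=> r; have mB := @measurable_eball R n r.
apply: measurable_bounded_integrable => //.
- apply: (@le_lt_trans _ _ (lebn n (eball n (Num.max 1 r)))).
    apply: le_measure; rewrite ?inE//; first exact: measurable_eball.
    by move=> t; rewrite /eball /= le_max => ->; rewrite orbT.
  rewrite lebn_eball ?ltry// lt_max ltr01//.
- by exists `|a|; split; rewrite ?num_real => // b ab t _ /=; exact: ltW.
Qed.

Lemma continuous_bounded_compact h r : continuous h -> (forall x, r < enorm x -> h x = 0) ->
  exists M, forall x, `|h x| <= M.
Proof.
move=> ch hr.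
have cb : compact (h @` [set x | 0 <= enorm x <= r]).
  apply: continuous_compact; last exact: compact_enorm_annulus.
  exact: continuous_subspaceT.
have [M [_ HM]] := compact_bounded cb.
exists (Num.max (M + 1) 0) => x; have [xr|xr] := leP (enorm x) r.
  rewrite le_max; apply/orP; left; apply: HM; first by rewrite ltrDl.
  by exists x => //=; rewrite enorm_ge0.
by rewrite hr// normr0 le_max lexx orbT.
Qed.

Lemma vintegrable_cont F h r : loc_integrable F -> continuous h ->
  (forall x, r < enorm x -> h x = 0) -> vintegrable (fun x => F x * h x).
Proof.
move=> iF ch hr; have [M hM] := continuous_bounded_compact ch hr.
by apply: (vintegrable_bounded iF _ hM hr); exact: continuous_measurable_row.
Qed.

Lemma vintegrable_test h : test h -> vintegrable h.
Proof.
move=> [sh [r hr]].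
have := vintegrable_cont (loc_integrable_cst 1) (smooth_continuous sh) hr.
by under eq_fun do rewrite mul1r.
Qed.

End volume_integrals.

Section young.
Context {R : realType}.

Lemma mul_powR (y e : R) : 0 <= y -> 0 < e -> y * y `^ e = y `^ (1 + e).
Proof.
move=> y0 e0; rewrite powRD; first by rewrite powRr1.
by rewrite gt_eqF//; lra.
Qed.

(** Either b <= th y^(p-1), and then y b <= th y^p, or y is at most
    (b / th)^(1/(p-1)).  This replaces Young's inequality with its optimal constants. *)
Lemma young_split (p y b th : R) : 1 < p -> 0 <= y -> 0 <= b -> 0 < th ->
  y * b <= th * y `^ p + th `^ (- (p - 1)^-1) * b `^ (p / (p - 1)).
Proof.
move=> p1 y0 b0 th0; have e0 : 0 < p - 1 by lra.
have [H|H] := leP b (th * y `^ (p - 1)).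
  rewrite -[leLHS]addr0 lerD ?mulr_ge0 ?powR_ge0//.
  apply: (le_trans (ler_wpM2l y0 H)).
  by rewrite mulrCA mul_powR// addrCA subrr addr0.
rewrite -[leLHS]add0r lerD ?mulr_ge0 ?powR_ge0 ?(ltW th0)//.
have y1 : y <= (th^-1 * b) `^ (p - 1)^-1.
  have -> : y = (y `^ (p - 1)) `^ (p - 1)^-1.
    by rewrite -powRrM divff ?gt_eqF// powRr1.
  apply: ge0_ler_powR; rewrite ?invr_ge0 ?(ltW e0) ?nnegrE ?powR_ge0//.
    by rewrite mulr_ge0// invr_ge0 ltW.
  by rewrite ler_pdivlMl// ltW.
apply: (le_trans (ler_wpM2r b0 y1)).
rewrite powRM ?invr_ge0 ?(ltW th0)// -powR_inv1 ?(ltW th0)// -powRrM mulN1r.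
rewrite -mulrA [_ * b]mulrC mul_powR ?invr_gt0//.
by rewrite (_ : 1 + (p - 1)^-1 = p / (p - 1))//; field; rewrite gt_eqF.
Qed.

(** The two summands of the constant serve the two signs of the exponent. *)
Lemma powR_compare (gam m M : R) : 0 < m -> 0 < M -> exists2 C : R, 0 < C &
  forall x y, 0 < y -> m * y <= x -> x <= M * y -> x `^ gam <= C * y `^ gam.
Proof.
move=> m0 M0; exists (M `^ gam + m `^ gam); first by rewrite addr_gt0// powR_gt0.
move=> x y y0 mx xM; rewrite mulrDl.
have x0 : 0 < x by apply: lt_le_trans mx; exact: mulr_gt0.
have [g0|g0] := leP 0 gam.
  apply: (@le_trans _ _ (M `^ gam * y `^ gam)); last first.
    by rewrite lerDl mulr_ge0// powR_ge0.
  rewrite -powRM ?(ltW M0) ?(ltW y0)//.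
  by apply: ge0_ler_powR; rewrite ?nnegrE ?(ltW x0)// mulr_ge0// ltW.
apply: (@le_trans _ _ (m `^ gam * y `^ gam)); last first.
  by rewrite lerDr mulr_ge0// powR_ge0.
rewrite -powRM ?(ltW m0) ?(ltW y0)// -[gam]opprK !(powRN _ (- gam)).
rewrite lef_pV2 ?posrE ?powR_gt0 ?mulr_gt0//.
apply: ge0_ler_powR; rewrite ?nnegrE ?(ltW x0) ?mulr_ge0 ?(ltW m0) ?(ltW y0)//.
by rewrite oppr_ge0 ltW.
Qed.

End young.

Section hoelder_from_below.
Context {R : realType} {n : nat}.
Local Notation Rn := ('rV[R]_n).
Local Notation RT := (measurableTypeR R).
Variable g : Rn -> 'M[R]_n.
Hypothesis gP : riemannian_metric g.
Variable Cg : R.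
Hypothesis gC : forall x, Num.sqrt (\det (g x)) <= Cg.
Implicit Types (F G h psi chi : Rn -> R).

Lemma vintegrable_test_powR psi (a : R) : 0 < a -> test psi -> (forall x, 0 <= psi x) ->
  vintegrable g (fun x => psi x `^ a).
Proof.
move=> a0 [sp [r pr]] psi0.
have [M hM] := continuous_bounded_compact (smooth_continuous sp) pr.
rewrite (_ : (fun x => _) = fun x => 1 * psi x `^ a); last first.
  by apply/funext => x; rewrite mul1r.
apply: (@vintegrable_bounded R n g gP Cg gC (fun=> 1) (fun x => psi x `^ a) (M `^ a) r
  (loc_integrable_cst 1)).
- rewrite /row_measurable (_ : _ \o _ = (fun s => s `^ a) \o (psi \o row_of_tuple))//.
  apply: measurableT_comp; first exact: measurable_powR.
  exact: continuous_measurable_row (smooth_continuous sp).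
- move=> x; rewrite ger0_norm ?powR_ge0//.
  have M0 : 0 <= M by apply: le_trans (hM x).
  by apply: ge0_ler_powR; rewrite ?nnegrE ?(ltW a0)// (le_trans (ler_norm _)).
- by move=> x /pr ->; rewrite powR0// gt_eqF.
Qed.

(** Hoelder's inequality in the form in which it bounds int |f|^p from below.
    Integrating [young_split] gives L <= th int |f|^p + th^(-1/(p-1)) B, and th
    is chosen so that the last term is L / 2. *)
Lemma hoelder_below (p L B : R) f psi chi : 1 < p ->
  loc_integrable f -> loc_integrable (fun x => `|f x| `^ p) ->
  test psi -> test chi -> (forall x, 0 <= psi x) -> (forall x, 0 <= chi x) ->
  (forall x, psi x != 0 -> chi x = 1) -> 0 < L -> 0 < B ->
  L <= `|vint g (fun x => f x * psi x)| ->
  vint g (fun x => psi x `^ (p / (p - 1))) <= B ->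
  2 `^ (- p) * L `^ p * B `^ (- (p - 1)) <= vint g (fun x => `|f x| `^ p * chi x).
Proof.
move=> p1 lf lfp tpsi tchi psi0 chi0 pc L0 B0 HL HB.
have e0 : 0 < p - 1 by lra.
have p'0 : 0 < p / (p - 1) by rewrite divr_gt0//; lra.
(* th^(-1/(p-1)) B = L / 2 *)
pose th := (2 * B / L) `^ (p - 1).
have q0 : 0 < 2 * B / L by rewrite divr_gt0// mulr_gt0.
have th0 : 0 < th by exact: powR_gt0.
pose G x := th `^ (- (p - 1)^-1) * psi x `^ (p / (p - 1)).
have [spsi [r1 hr1]] := tpsi; have [schi [r2 hr2]] := tchi.
have if1 : vintegrable g (fun x => f x * psi x).
  exact: (vintegrable_cont gP gC lf (smooth_continuous spsi) hr1).
have if2 : vintegrable g (fun x => `|f x| `^ p * chi x).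
  exact: (vintegrable_cont gP gC lfp (smooth_continuous schi) hr2).
have if3 := vintegrable_test_powR p'0 tpsi psi0.
have if0 : vintegrable g (fun=> 0) by apply: (vintegrable_test gP gC); exact: test0.
have iG : vintegrable g G.
  rewrite (_ : G = fun x => th `^ (- (p - 1)^-1) * psi x `^ (p / (p - 1)) + 0).
    exact: vintegrable_lin.
  by apply/funext => x; rewrite addr0.
have iT := vintegrable_lin th if2 iG.
have bnd x : `|f x * psi x| <= th * (`|f x| `^ p * chi x) + G x.
  rewrite normrM (ger0_norm (psi0 x)).
  have [->|/pc ->] := eqVneq (psi x) 0.
    by rewrite mulr0 /G addr_ge0 ?mulr_ge0 ?powR_ge0 ?(ltW th0).
  by rewrite mulr1; apply: young_split.
have H : L <= th * vint g (fun x => `|f x| `^ p * chi x) + vint g G.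
  rewrite -vint_lin//; apply: (le_trans HL); rewrite ler_norml; apply/andP; split.
    rewrite -mulN1r -vintZ//.
    have := vintegrable_lin (-1) iT if0; under eq_fun do rewrite addr0.
    move=> iN; apply: le_vint => // x.
    by rewrite mulN1r lerNl (le_trans _ (bnd x))// -normrN ler_norm.
  by apply: le_vint => // x; rewrite (le_trans _ (bnd x))// ler_norm.
have HG : vint g G <= L / 2.
  rewrite /G vintZ// /th -powRrM (_ : (p - 1) * _ = - 1); last by field; rewrite gt_eqF.
  rewrite powR_inv1 ?(ltW q0)// invf_div mulrAC ler_pdivrMr ?mulr_gt0//.
  rewrite (_ : L / 2 * _ = L * B); last by field.
  by rewrite ler_wpM2l// ltW.
have {}H : L / 2 <= th * vint g (fun x => `|f x| `^ p * chi x) by lra.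
apply: le_trans (_ : th^-1 * (L / 2) <= _); last by rewrite ler_pdivrMl.
rewrite /th -powRN.
have Li0 : 0 <= L^-1 by rewrite invr_ge0 ltW.
rewrite !powRM// ?mulr_ge0 ?(ltW B0)//.
rewrite -(powR_inv1 (ltW L0)) -powRrM mulN1r opprK.
have E1 : (2:R) `^ (- p) = 2 `^ (- (p - 1)) * 2^-1.
  rewrite -(@powR_inv1 _ 2)// -powRD; last by rewrite pnatr_eq0 implybT.
  by congr (_ `^ _); ring.
have E2 : L `^ p = L * L `^ (p - 1).
  by rewrite mul_powR ?(ltW L0)//; congr (_ `^ _); ring.
by rewrite E1 E2 le_eqVlt; apply/orP; left; apply/eqP; ring.
Qed.

(** The integral of phi^(p/(p-1)) over a section of the cone has this form, with
    al the decay of the eigenfunction and nu its exponential rate; the result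
    shows the volume s^(n-1) of the boundary shell times the weight there. *)
Lemma weighted_vint_le (lam al nu : R) : (0 < n)%N -> 0 < lam -> 0 <= al -> 0 < nu ->
  exists2 C : R, 0 < C & forall s D F, 0 < s -> 0 <= D -> row_measurable F ->
    (forall x, 0 <= F x) -> (forall x, s < enorm x -> F x = 0) ->
    (forall x, enorm x <= s ->
       F x <= D * (jap (lam * enorm x) `^ (- al) * expR (- nu * (s - enorm x)))) ->
    vint g F <= C * D * ((1 + s) ^+ n.-1 * (1 + s) `^ (- al)).
Proof.
move=> n0 lam0 al0 nu0.
have [A A0 HA] := @shell_integral_le R n (nu / 2) n0 (divr_gt0 nu0 (ltr0n _ 2)).
have [C C0 HC] := jap_weight_le lam0 al0 nu0.
have Cg0 : 0 < Cg by apply: lt_le_trans (gC 0); exact: density_gt0.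
exists (C * A * Cg); first by rewrite !mulr_gt0.
move=> s D F s0 D0 mF F0 Fs Fle.
pose c : R := D * (C * (1 + s) `^ (- al)) * Cg.
have c0 : 0 <= c.
  by rewrite /c; do 3 ?apply: mulr_ge0; rewrite ?powR_ge0 ?(ltW C0) ?(ltW Cg0).
have mw : measurable_fun (eball n s)
    (fun t => (c%:E * (expR (- (nu / 2) * (s - enormt t)))%:E)%E).
  apply/measurable_EFinP; apply: (measurable_funS measurableT) => //.
  apply: measurable_funM => //; apply: measurableT_comp; first exact: measurable_expR.
  apply: measurable_funM => //; apply: measurable_funB => //.
  exact: measurable_enormt.
have mb := @measurable_eball R n s.
have mFd : measurable_fun setT (fun t : n.-tuple RT =>
    (F (row_of_tuple t) * Num.sqrt (\det (g (row_of_tuple t))))%:E).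
  apply/measurable_EFinP; apply: measurable_funM => //.
  exact: (row_measurable_density gP).
have Fd0 t : (0 <= (F (row_of_tuple t) * Num.sqrt (\det (g (row_of_tuple t))))%:E)%E.
  by rewrite lee_fin mulr_ge0// sqrtr_ge0.
have H : (\int[lebn n]_t (F (row_of_tuple t) * Num.sqrt (\det (g (row_of_tuple t))))%:E
    <= (C * A * Cg * D * ((1 + s) ^+ n.-1 * (1 + s) `^ (- al)))%:E)%E.
  apply: (@le_trans _ _ (\int[lebn n]_(t in eball n s)
      (c%:E * (expR (- (nu / 2) * (s - enormt t)))%:E))%E).
    rewrite [leRHS]integral_mkcond; apply: ge0_le_integral => //.
    - exact/(measurable_restrictT _ mb).
    - move=> t _; rewrite patchE; case: ifPn => [/set_mem ts|].
        rewrite -EFinM lee_fin /c [leRHS]mulrAC; apply: ler_pM => //.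
        apply: (le_trans (Fle _ ts)); rewrite -mulrA; apply: ler_wpM2l => //.
        exact: HC (enorm_ge0 _) ts.
      rewrite notin_setE /eball /= => /negP; rewrite -ltNge => /Fs ->.
      by rewrite mul0r.
  have mE : measurable_fun (eball n s) (fun t => (expR (- (nu / 2) * (s - enormt t)))%:E).
    apply/measurable_EFinP; apply: (measurable_funS measurableT) => //.
    apply: measurableT_comp; first exact: measurable_expR.
    apply: measurable_funM => //; apply: measurable_funB => //.
    exact: measurable_enormt.
  rewrite (ge0_integralZl _ mb mE)//.
  apply: (@le_trans _ _ (c%:E * (A * (1 + s) ^+ n.-1)%:E)%E).
    by apply: lee_wpmul2l; [rewrite lee_fin|exact: HA].
  by rewrite -EFinM lee_fin le_eqVlt /c; apply/orP; left; apply/eqP; ring.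
rewrite /vint /Rintegral -lee_fin fineK//.
by rewrite ge0_fin_numE ?(le_lt_trans H) ?ltry// integral_ge0.
Qed.

End hoelder_from_below.

(** * The radial distance *)

Section radial_function.
Context {R : realType}.
Variables (K : R -> R) (d : R).
Hypothesis d0 : 0 < d.
Hypothesis dK : forall r, 0 < r -> derivable K r 1.
Hypothesis bK : forall r, 0 < r -> d < K r < d^-1.
Local Notation mu := (@lebesgue_measure R).

Let itv_fin a b : (mu (`]a, b] : set R) < +oo)%E.
Proof.
rewrite lebesgue_measure_itv /=; case: ifPn => // _.
by rewrite -EFinB ltry.
Qed.

Lemma radial_integrable b : mu.-integrable `]0, b] (EFin \o K).
Proof.
apply: measurable_bounded_integrable => //.
- exact: itv_fin.
- apply: (@measurable_funS _ _ _ _ (`]0, +oo[%classic : set R)) => //.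
    by move=> x /=; rewrite !in_itv /= andbT => /andP[].
  apply: open_continuous_measurable_fun; first exact: interval_open.
  move=> x; rewrite inE /= in_itv /= andbT => x0.
  by apply: differentiable_continuous; apply/derivable1_diffP; exact: dK.
- exists d^-1; split; first exact: num_real.
  move=> M dM x /=; rewrite in_itv /= => /andP[x0 _].
  have /andP[k1 k2] := bK x0.
  by rewrite ger0_norm ?(ltW (lt_trans k2 dM))// ltW// (lt_trans d0).
Qed.

(** K is controlled on r > 0 only, while [radial] integrates over [0, r]. *)
Lemma radialE b : radial K b = \int[mu]_(t in `]0, b]) K t.
Proof. by rewrite /radial -Rintegral_itv_obnd_cbnd//; exact: radial_integrable. Qed.

Lemma radial_incr a b : 0 <= a -> a <= b ->
  d * (b - a) <= radial K b - radial K a <= d^-1 * (b - a).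
Proof.
move=> a0 ab.
rewrite !radialE Rintegral_itvB//; last exact: radial_integrable.
have sub : `]a, b] `<=` `]0, b].
  by move=> x /=; rewrite !in_itv /= => /andP[ax ->]; rewrite (le_lt_trans a0 ax).
have iK : mu.-integrable `]a, b] (EFin \o K).
  by apply: integrableS (radial_integrable b).
have ic (c : R) : mu.-integrable `]a, b] (EFin \o (fun=> c)).
  apply: measurable_bounded_integrable => //.
    exact: itv_fin.
  by exists `|c|; split; rewrite ?num_real// => M cM x _ /=; exact: ltW.
have Ec (c : R) : \int[mu]_(x in `]a, b]) c = c * (b - a).
  rewrite Rintegral_cst//= lebesgue_measure_itv /= lte_fin; case: ltP => // ba.
  by rewrite (le_anti (introT andP (conj ab ba))) subrr.
rewrite -!Ec; apply/andP; split; apply: le_Rintegral => // x /=; rewrite in_itv /= => /andP[ax _];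
  by have /andP[? ?] := bK (le_lt_trans a0 ax); exact: ltW.
Qed.

Lemma radial0 : radial K 0 = 0.
Proof. by rewrite radialE set_itvoc0 Rintegral_set0. Qed.

(** The intermediate value theorem, applied to the radial distance extended by
    0 to negative radii, where it is Lipschitz. *)
Lemma radial_onto s : 0 <= s -> exists2 r, 0 <= r & radial K r = s.
Proof.
move=> s0.
pose f x := radial K (Num.max 0 x).
have lip x y : `|f x - f y| <= d^-1 * `|x - y|.
  wlog xy : x y / y <= x.
    move=> H; have [xy|xy] := leP y x; first exact: H.
    by rewrite distrC [in leRHS]distrC; apply: H; exact: ltW.
  have m0 : 0 <= Num.max 0 y by rewrite le_max lexx.
  have mxy : Num.max 0 y <= Num.max 0 x by rewrite ge_max !le_max lexx xy !orbT.
  have /andP[H1 H2] := radial_incr m0 mxy.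
  have H0 : 0 <= f x - f y by apply: le_trans H1; rewrite mulr_ge0 ?subr_ge0// ltW.
  rewrite ger0_norm// [`|x - y|]ger0_norm ?subr_ge0//; apply: (le_trans H2).
  rewrite ler_wpM2l ?invr_ge0 ?(ltW d0)//.
  rewrite lerBlDr ge_max; apply/andP; split.
    by rewrite addr_ge0// subr_ge0.
  by rewrite -[leLHS](subrK y) lerD2l le_max lexx orbT.
have cf : continuous f.
  move=> x; apply/cvgrPdist_le => e e0; near=> y.
  apply: (le_trans (lip _ _)); rewrite -ler_pdivlMl ?invr_gt0// invrK.
  near: y; apply: cvgr_dist_le => //; first exact: mulr_gt0.
have [r r1 fr] : exists2 r, r \in `[0, s / d] & f r = s.
  apply: IVT.
  - by rewrite divr_ge0// ltW.
  - exact: continuous_subspaceT.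
  - rewrite /f maxxx radial0 [Num.max 0 (s / d)]max_r ?divr_ge0 ?(ltW d0)//.
    have /andP[H1 _] := radial_incr (lexx 0) (ltac:(by rewrite divr_ge0// ltW) : 0 <= s / d).
    move: H1; rewrite radial0 !subr0 mulrC divfK ?gt_eqF// => H1.
    by rewrite min_l ?max_r ?s0// (le_trans s0).
move: r1; rewrite in_itv /= => /andP[r0 _].
by exists r => //; rewrite -fr /f max_r.
Unshelve. all: by end_near. Qed.

End radial_function.

(** * Differential inequalities in time *)

Section one_sided_derivatives.
Context {R : realType}.
Implicit Types (T : \bar R) (f : R -> R).

Lemma has_derivative_on_eps T f f1 t : has_derivative_on T f f1 -> time_interval T t ->
  forall e, 0 < e -> exists2 d, 0 < d & forall s, time_interval T s -> s != t ->
    `|s - t| < d -> `|f1 t - (f s - f t) / (s - t)| < e.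
Proof.
move=> df tT e e0; have /cvgrPdist_lt/(_ e e0) := df t tT.
rewrite near_withinE => /nbhs_ballP[d /= d0 H]; exists d => // s sT st std.
by apply: H => //; rewrite /ball /= distrC.
Qed.

Lemma has_derivative_on_interior T f f1 t : has_derivative_on T f f1 -> 0 < t ->
  (t%:E < T)%E -> is_derive t 1 f (f1 t).
Proof.
move=> df t0 tT.
have [m [tm mT]] : exists m, t < m /\ (m%:E < T)%E.
  case: T tT {df} => [T||] //; last by exists (t + 1); rewrite ltrDl ltry.
  by rewrite lte_fin => tT; exists ((t + T) / 2); rewrite lte_fin; split; lra.
have lim : (fun h : R => h^-1 *: ((f \o shift t) (h *: (1:R)) - f t)) @ 0^' --> f1 t.
  apply/cvgrPdist_lt => e e0.
  have [d d0 H] := has_derivative_on_eps df (conj (ltW t0) tT) e0.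
  near=> h.
  have h0 : h != 0 by near: h; exact: nbhs_dnbhs_neq.
  rewrite /= /GRing.scale /= mulr1 mulrC.
  have ht : `|h| < Num.min d (Num.min t (m - t)).
    by near: h; apply: dnbhs0_lt; rewrite !lt_min d0 t0 subr_gt0.
  move: ht; rewrite !lt_min => /and3P[hd]; rewrite !ltr_norml => /andP[h1 h2] /andP[h3 h4].
  have := H (h + t); rewrite addrK => H'; rewrite -ltr_norml; apply: H' => //.
    split; first by lra.
    by apply: lt_trans mT; rewrite lte_fin; lra.
  by rewrite -subr_eq0 addrK.
split; first by apply/cvg_ex; exists (f1 t).
exact/cvg_lim.
Unshelve. all: by end_near. Qed.

Lemma has_derivative_on_continuous T f f1 a b : has_derivative_on T f f1 -> 0 <= a ->
  a < b -> (b%:E < T)%E -> {within `[a, b], continuous f}.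
Proof.
move=> df a0 ab bT.
have cint x : 0 < x -> (x%:E < T)%E -> {for x, continuous f}.
  move=> x0 xT; apply: differentiable_continuous; apply/derivable1_diffP.
  exact: (@ex_derive _ _ _ _ _ _ _ (has_derivative_on_interior df x0 xT)).
apply/continuous_within_itvP => //; split.
- move=> x; rewrite in_itv /= => /andP[ax xb]; apply: cint; first exact: le_lt_trans ax.
  by apply: lt_trans bT; rewrite lte_fin.
- have aT : time_interval T a by split => //; apply: lt_trans bT; rewrite lte_fin.
  have [d d0 H] := has_derivative_on_eps df aT ltr01.
  have M0 : 0 < `|f1 a| + 1 by rewrite ltr_wpDl.
  apply/cvgrPdist_le => e e0; near=> x.
  have ax : a < x by near: x; exact: nbhs_right_gt.
  have xd : x < a + Num.min d (Num.min (b - a) (e / (`|f1 a| + 1))).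
    near: x; apply: nbhs_right_lt; rewrite ltrDl !lt_min d0 subr_gt0 ab /=.
    exact: divr_gt0.
  move: xd; rewrite -ltrBlDl !lt_min => /and3P[xd xb]; rewrite ltr_pdivlMr// => xe.
  have xa0 : 0 < x - a by rewrite subr_gt0.
  have := H x; rewrite gt_eqF// ger0_norm ?(ltW xa0)// => {}H.
  have {}H : `|f1 a - (f x - f a) / (x - a)| < 1.
    apply: H => //; split; first exact: (le_trans a0 (ltW ax)).
    by apply: lt_trans bT; rewrite lte_fin; lra.
  have {}H : `|(f x - f a) / (x - a)| <= `|f1 a| + 1.
    have := ler_normB (f1 a) (f1 a - (f x - f a) / (x - a)).
    by rewrite opprB addrC subrK => /le_trans; apply; rewrite lerD2l ltW.
  move: H; rewrite normrM normfV [`|x - a|]ger0_norm ?(ltW xa0)// ler_pdivrMr// => H.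
  by rewrite distrC (le_trans H)// mulrC ltW.
- apply: cvg_at_left_filter; apply: cint => //.
  exact: le_lt_trans ab.
Unshelve. all: by end_near. Qed.

Lemma le_increment T f f1 a b k : has_derivative_on T f f1 -> 0 <= a -> a <= b ->
  (b%:E < T)%E -> (forall s, a < s -> s < b -> k <= f1 s) -> k * (b - a) <= f b - f a.
Proof.
move=> df a0; rewrite le_eqVlt => /predU1P[->|ab] bT kf; first by rewrite !subrr mulr0.
have [|c /andP[ac cb] ->] := @MVT R f f1 a b ab _ (has_derivative_on_continuous df a0 ab bT).
  move=> x; rewrite in_itv /= => /andP[ax xb].
  apply: (has_derivative_on_interior df); first exact: le_lt_trans ax.
  by apply: lt_trans bT; rewrite lte_fin.
by apply: ler_wpM2r; [rewrite subr_ge0 ltW|exact: kf].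
Qed.

End one_sided_derivatives.

Section differential_inequalities.
Context {R : realType}.
Implicit Types (T : \bar R).

(** e^(-k s) y is nondecreasing. *)
Lemma gronwall_lower T (y y1 : R -> R) (k b : R) : has_derivative_on T y y1 ->
  0 <= b -> (b%:E < T)%E -> (forall s, 0 < s -> s < b -> k * y s <= y1 s) ->
  expR (k * b) * y 0 <= y b.
Proof.
move=> dy; rewrite le_eqVlt => /predU1P[<-|b0] bT ky; first by rewrite mulr0 expR0 mul1r.
pose e (s : R) : R := expR (- k * s).
pose h (s : R) : R := e s * y s.
have de (s : R) : is_derive s 1 e (- k * e s).
  have d1 : is_derive s 1 (fun s => - k * s) (- k).
    have := is_deriveZ (- k) (is_derive_id s (1:R)).
    by rewrite /GRing.scale /= mulr1.
  by have := is_derive1_comp (is_derive_expR (- k * s)) d1; rewrite mulrC.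
have dh (s : R) : 0 < s -> s < b -> is_derive s 1 h (e s * (y1 s - k * y s)).
  move=> s0 sb.
  have ds : is_derive s 1 y (y1 s).
    by apply: (has_derivative_on_interior dy) => //; apply: lt_trans bT; rewrite lte_fin.
  have := is_deriveM (de s) ds.
  by move/is_derive_eq; apply; rewrite /GRing.scale/=; ring.
have ch : {within `[0, b], continuous h}.
  have cy := has_derivative_on_continuous dy (lexx 0) b0 bT.
  have ce : {within `[0, b], continuous e}.
    apply: continuous_subspaceT => s; apply: differentiable_continuous.
    by apply/derivable1_diffP; exact: (@ex_derive _ _ _ _ _ _ _ (de s)).
  move=> s; have := @continuousM R (subspace `[0, b]) e y s (ce s) (cy s). exact.
have [s /andP[s0 sb] E] := @MVT R h (fun s => e s * (y1 s - k * y s)) 0 b b0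
  (fun s sb => dh s (ltac:(by move: sb; rewrite in_itv => /andP[]))
                    (ltac:(by move: sb; rewrite in_itv => /andP[]))) ch.
have : h 0 <= h b.
  rewrite -subr_ge0 E mulr_ge0 ?subr_ge0 ?(ltW b0)// mulr_ge0 ?expR_ge0// subr_ge0.
  exact: ky.
rewrite /h /e mulr0 expR0 mul1r mulNr expRN => H.
by rewrite -ler_pdivlMl ?expR_gt0.
Qed.

(** z = y' - k y satisfies z' >= - k z, hence stays nonnegative, and then
    y' >= k y. *)
Lemma exponential_growth T (y y1 y2 : R -> R) (k b : R) :
  has_derivative_on T y y1 -> has_derivative_on T y1 y2 ->
  0 < k -> 0 <= y 0 -> k * y 0 <= y1 0 -> 0 <= b -> (b%:E < T)%E ->
  (forall s, 0 < s -> s < b -> k ^+ 2 * y s <= y2 s) ->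
  expR (k * b) * y 0 <= y b /\ k * (expR (k * b) * y 0) <= y1 b.
Proof.
move=> dy dy1 k0 y0 y10 b0 bT H.
pose z s := y1 s - k * y s.
have dz : has_derivative_on T z (fun s => y2 s - k * y1 s).
  move=> t tT; have c1 := dy t tT; have c2 := dy1 t tT.
  rewrite (_ : (fun s => (z s - z t) / (s - t)) =
      (fun s => (y1 s - y1 t) / (s - t) - k * ((y s - y t) / (s - t)))).
    by apply: cvgB => //; apply: cvgM => //; exact: cvg_cst.
  by apply/funext => s; rewrite /z; ring.
have z_ge0 s : 0 <= s -> s <= b -> 0 <= z s.
  move=> s0 sb.
  have sT : (s%:E < T)%E by apply: le_lt_trans bT; rewrite lee_fin.
  apply: le_trans (@gronwall_lower T z _ (- k) s dz s0 sT _).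
    by rewrite mulr_ge0 ?expR_ge0// /z subr_ge0.
  move=> u u0 us; have := H u u0 (lt_le_trans us sb).
  by rewrite /z expr2; lra.
have H1 : expR (k * b) * y 0 <= y b.
  apply: (gronwall_lower dy b0 bT) => s s0 sb.
  by have := z_ge0 s (ltW s0) (ltW sb); rewrite /z subr_ge0.
split => //; apply: (@le_trans _ _ (k * y b)); first by rewrite ler_wpM2l// ltW.
by have := z_ge0 b b0 (lexx b); rewrite /z subr_ge0.
Unshelve. all: by end_near. Qed.

Section coupled_system.
Variables (T : \bar R) (V V1 V2 W W1 : R -> R) (A B p q a b : R).
Hypotheses (dV : has_derivative_on T V V1) (dV1 : has_derivative_on T V1 V2)
  (dW : has_derivative_on T W W1) (A0 : 0 < A) (B0 : 0 < B) (p0 : 1 < p) (q0 : 1 < q)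
  (a0 : 0 <= a) (ab : a < b) (bT : (b%:E < T)%E)
  (Va : 0 <= V a) (V1a : 0 <= V1 a) (Wa : 0 <= W a)
  (HW : forall s, a < s -> s < b -> A * `|V s| `^ p <= W1 s)
  (HV : forall s, a < s -> s < b -> B * `|W s| `^ q <= V2 s).

Let p_ge0 : 0 <= p. Proof. by rewrite ltW// (lt_trans ltr01). Qed.

Let q_ge0 : 0 <= q. Proof. by rewrite ltW// (lt_trans ltr01). Qed.

Let inc (f f1 : R -> R) k x y : has_derivative_on T f f1 -> a <= x -> x <= y -> y <= b ->
  (forall s, x < s -> s < y -> k <= f1 s) -> k * (y - x) <= f y - f x.
Proof.
move=> df ax xy yb; apply: (le_increment df) => //; first exact: le_trans ax.
by apply: le_lt_trans bT; rewrite lee_fin.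
Qed.

Let mono (f f1 : R -> R) x y : has_derivative_on T f f1 -> a <= x -> x <= y -> y <= b ->
  (forall s, x < s -> s < y -> 0 <= f1 s) -> f x <= f y.
Proof.
by move=> df ax xy yb /(inc df ax xy yb); rewrite mul0r subr_ge0.
Qed.

Let W_mono x y : a <= x -> x <= y -> y <= b -> W x <= W y.
Proof.
move=> ax xy yb; apply: (mono dW) => // s xs sy; apply: le_trans (HW _ _).
- by rewrite mulr_ge0 ?powR_ge0 ?ltW.
- exact: le_lt_trans xs.
- exact: lt_le_trans yb.
Qed.

Let V1_mono x y : a <= x -> x <= y -> y <= b -> V1 x <= V1 y.
Proof.
move=> ax xy yb; apply: (mono dV1) => // s xs sy; apply: le_trans (HV _ _).
- by rewrite mulr_ge0 ?powR_ge0 ?ltW.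
- exact: le_lt_trans xs.
- exact: lt_le_trans yb.
Qed.

Let V_mono x y : a <= x -> x <= y -> y <= b -> V x <= V y.
Proof.
move=> ax xy yb; apply: (mono dV) => // s xs sy; apply: le_trans V1a _.
by apply: V1_mono => //; [exact: ltW (le_lt_trans ax xs)|exact: ltW (lt_le_trans sy yb)].
Qed.

(** A lower bound on W acts on V through V'': two successive steps of length h,
    one for V' and one for V. *)
Lemma V_from_W x h Z : a <= x -> 0 < h -> x + 2 * h <= b -> 0 <= Z -> Z <= W x ->
  B * h ^+ 2 * Z `^ q <= V (x + 2 * h).
Proof.
move=> ax h0 xh Z0 ZW.
have H2 : B * Z `^ q * h <= V1 (x + h).
  have := @inc V1 V2 (B * Z `^ q) x (x + h) dV1 ax.
  rewrite addrAC subrr add0r => H.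
  apply: (@le_trans _ _ (V1 (x + h) - V1 x)).
    apply: H; [lra|lra|move=> s xs sh].
    apply: le_trans (HV _ _); [|lra|lra].
    apply: ler_wpM2l; first exact: ltW.
    apply: ge0_ler_powR; rewrite ?nnegrE ?q_ge0//.
    rewrite (le_trans ZW)// (le_trans _ (ler_norm _))//; apply: W_mono; lra.
  by rewrite gerBl (le_trans V1a)// V1_mono//; lra.
have := @inc V V1 (B * Z `^ q * h) (x + h) (x + 2 * h) dV.
rewrite (_ : x + 2 * h - (x + h) = h); last by ring.
move=> H; apply: (@le_trans _ _ (V (x + 2 * h) - V (x + h))).
  rewrite (_ : B * h ^+ 2 * Z `^ q = B * Z `^ q * h * h); last by ring.
  apply: H; [lra|lra|lra|move=> s xs sh].
  by apply: (le_trans H2); apply: V1_mono; lra.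
by rewrite gerBl (le_trans Va)// V_mono//; lra.
Qed.

(** One full cycle V -> W -> V, in three steps of length h. *)
Lemma V_from_V x h : a <= x -> 0 < h -> x + 3 * h <= b ->
  B * h ^+ 2 * (A * h * V x `^ p) `^ q <= V (x + 3 * h).
Proof.
move=> ax h0 xh.
have Vx : 0 <= V x by rewrite (le_trans Va)// V_mono//; lra.
rewrite (_ : x + 3 * h = (x + h) + 2 * h); last by ring.
apply: V_from_W; [lra|by []|lra| |].
  by rewrite !mulr_ge0 ?powR_ge0// ltW.
have := @inc W W1 (A * V x `^ p) x (x + h) dW ax.
rewrite addrAC subrr add0r mulrAC => H.
apply: (@le_trans _ _ (W (x + h) - W x)).
  apply: H; [lra|lra|move=> s xs sh].
  apply: le_trans (HW _ _); [|lra|lra].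
  apply: ler_wpM2l; [exact: ltW|apply: ge0_ler_powR; rewrite ?nnegrE ?p_ge0//].
  by rewrite (le_trans _ (ler_norm _))//; apply: V_mono; lra.
by rewrite gerBl (le_trans Wa)// W_mono//; lra.
Qed.

(** Iteration of [V_from_V] along times tau_j that accumulate at b, with steps
    h_j proportional to 2^-j.  The smallness of the steps costs a factor
    2^-(2+q) per cycle, compensated by the superlinear exponent p q - 1 as soon
    as V gains the factor D = 2^((2+q)/(pq-1)): the lower bound for
    V(tau_{j+1}) / V(tau_j) is then reproduced at every step, V(tau_j) grows
    like D^j, and V b would exceed every bound. *)
Lemma no_global_solution :
  0 < V a ->
  B * A `^ q * ((b - a) / 6) `^ (2 + q) * V a `^ (p * q - 1) >= 2 `^ ((2 + q) / (p * q - 1)) ->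
  False.
Proof.
move=> Va0 Hc.
have pq : 0 < p * q - 1.
  by rewrite subr_gt0 (lt_le_trans p0)// ler_peMr// ltW.
set D := 2 `^ _ in Hc.
have D1 : 1 < D.
  rewrite /D /powR pnatr_eq0 /= expR_gt1 mulr_gt0 ?ln_gt0 ?ltr1n//.
  by rewrite divr_gt0// ltr_wpDr.
have D0 : 0 < D by lra.
pose l := b - a; have l0 : 0 < l by rewrite subr_gt0.
pose tau (j : nat) := b - l * 2^-1 ^+ j.
(* three steps h_j lead from tau_j to tau_{j+1} *)
pose h (j : nat) := l / 6 * 2^-1 ^+ j.
have h0 j : 0 < h j by rewrite /h mulr_gt0 ?exprn_gt0// divr_gt0.
have tauS j : tau j.+1 = tau j + 3 * h j by rewrite /tau /h exprS; field.
have taub j : tau j <= b by rewrite /tau gerBl mulr_ge0 ?exprn_ge0// ltW.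
have atau j : a <= tau j.
  rewrite /tau lerBrDr -lerBrDl -/l -[leRHS]mulr1 ler_pM2l//.
  by rewrite exprn_ile1//; lra.
have main j : D <= B * A `^ q * (h j) `^ (2 + q) * V (tau j) `^ (p * q - 1)
     /\ D ^+ j * V a <= V (tau j).
  elim: j => [|j [IH1 IH2]].
    by rewrite /h /tau !expr0 !mulr1 mul1r /l opprB addrCA subrr addr0.
  have Vj : 0 < V (tau j) by rewrite (lt_le_trans _ IH2)// mulr_gt0// exprn_gt0.
  have step : D * V (tau j) <= V (tau j.+1).
    have := V_from_V (atau j) (h0 j); rewrite -tauS => /(_ (taub _)); apply: le_trans.
    have {}IH1 := ler_wpM2r (ltW Vj) IH1; apply: (le_trans IH1).
    have hj := ltW (h0 j).
    rewrite (powRM _ (mulr_ge0 (ltW A0) hj) (powR_ge0 _ _)).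
    rewrite (powRM _ (ltW A0) hj) -powRrM.
    rewrite powRD ?(gt_eqF (h0 j)) ?implybT// powR_mulrn ?(ltW (h0 j))//.
    have -> : V (tau j) `^ (p * q) = V (tau j) `^ (p * q - 1) * V (tau j).
      by rewrite [RHS]mulrC mul_powR ?(ltW Vj)//; congr (_ `^ _); ring.
    by rewrite le_eqVlt; apply/orP; left; apply/eqP; ring.
  split; last by rewrite exprS -mulrA (le_trans _ step)// ler_pM2l.
  apply: (le_trans IH1).
  have DE : D `^ (p * q - 1) = 2 `^ (2 + q).
    by rewrite /D -powRrM divfK// gt_eqF.
  have H1 : D `^ (p * q - 1) * V (tau j) `^ (p * q - 1) <= V (tau j.+1) `^ (p * q - 1).
    rewrite -powRM ?(ltW D0) ?(ltW Vj)//.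
    apply: ge0_ler_powR => //; rewrite ?nnegrE ?(ltW pq)//.
      by rewrite mulr_ge0// ltW.
    by apply: le_trans step; rewrite mulr_ge0// ltW.
  have H2 : h j `^ (2 + q) = 2 `^ (2 + q) * h j.+1 `^ (2 + q).
    rewrite -powRM ?(ltW (h0 _))//; congr (_ `^ _).
    by rewrite /h exprS; field.
  rewrite H2 -DE -!mulrA; apply: ler_wpM2l; first exact: ltW.
  apply: ler_wpM2l; first exact: powR_ge0.
  by rewrite mulrCA; apply: ler_wpM2l => //; exact: powR_ge0.
have : forall j, D ^+ j * V a <= V b.
  by move=> j; have [_ H] := main j; rewrite (le_trans H)// V_mono.
move=> H.
have bern (j : nat) : j%:R * (D - 1) <= D ^+ j.
  elim: j => [|j IH]; first by rewrite mul0r expr0.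
  have Dj : 1 <= D ^+ j by rewrite exprn_ege1// ltW.
  rewrite -natr1 mulrDl mul1r exprS.
  have := ler_wpM2r (ltac:(lra) : 0 <= D - 1) Dj.
  lra.
pose j := (Num.truncn (V b / V a / (D - 1))).+1.
have : V b / V a / (D - 1) < j%:R by exact: truncnS_gt.
rewrite ltr_pdivrMr ?subr_gt0// ltr_pdivrMr// => Hj.
have := le_lt_trans (H j) Hj.
by rewrite ltr_pM2r// ltNge bern.
Qed.

End coupled_system.
End differential_inequalities.

(** * Blow-up of the coupled system of ordinary differential inequalities *)

Section blowup_at_scale.
Context {R : realType}.

Lemma powR_large (D c z : R) : 0 < D -> 0 < c -> 0 < z ->
  exists2 C : R, 0 < C & forall X, C <= X -> D <= c * X `^ z.
Proof.
move=> D0 c0 z0; have Dc : 0 < D / c by rewrite divr_gt0.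
exists ((D / c) `^ z^-1); first exact: powR_gt0.
move=> X XC; rewrite -ler_pdivrMl// mulrC.
apply: (@le_trans _ _ (((D / c) `^ z^-1) `^ z)).
  by rewrite -powRrM mulVf ?gt_eqF// powRr1// ltW.
by apply: ge0_ler_powR; rewrite ?nnegrE ?powR_ge0 ?(ltW z0)// (le_trans _ XC)// powR_ge0.
Qed.

(** All quantities at the scale tau are monomials in eps and tau; multiplying
    and raising them to powers acts on the exponents, and the exponent
    Gamma_SG comes out by field arithmetic. *)
Definition monomial (eps tau c x y : R) := c * (eps `^ x * tau `^ y).

Section monomials.
Variables (eps tau : R).
Hypotheses (e0 : 0 < eps) (t0 : 0 < tau).
Local Notation mono := (monomial eps tau).

Lemma monomialM c c' x x' y y' : mono c x y * mono c' x' y' = mono (c * c') (x + x') (y + y').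
Proof.
rewrite /monomial !powRD ?(gt_eqF e0) ?(gt_eqF t0) ?implybT//.
ring.
Qed.

Lemma monomial_powR c x y z : 0 < c -> mono c x y `^ z = mono (c `^ z) (x * z) (y * z).
Proof.
move=> c0; rewrite /monomial powRM ?mulr_ge0 ?powR_ge0 ?(ltW c0)//.
by rewrite powRM ?powR_ge0// -!powRrM.
Qed.

Lemma monomial_gt0 c x y : 0 < c -> 0 < mono c x y.
Proof. by move=> c0; rewrite !mulr_gt0// powR_gt0. Qed.

Lemma monomial_diag c G z : mono c z (G * z) = c * (eps * tau `^ G) `^ z.
Proof. by rewrite /monomial powRM ?powR_ge0 ?(ltW e0)// -powRrM. Qed.

End monomials.

Section fixed_scale.
Variables (T : \bar R) (V V1 V2 W W1 : R -> R) (A B v w p q tau : R).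
Hypotheses (dV : has_derivative_on T V V1) (dV1 : has_derivative_on T V1 V2)
  (dW : has_derivative_on T W W1) (A0 : 0 < A) (B0 : 0 < B) (v0 : 0 < v) (w0 : 0 < w)
  (p1 : 1 < p) (q1 : 1 < q) (tau0 : 0 < tau) (tauT : ((2 * tau)%:E < T)%E)
  (V0 : 0 <= V 0) (V10 : 0 <= V1 0) (W0 : 0 <= W 0)
  (W1_ge0 : forall s, 0 < s -> s < 2 * tau -> 0 <= W1 s)
  (V2_ge0 : forall s, 0 < s -> s < 2 * tau -> 0 <= V2 s)
  (HW : forall s, tau / 2 < s -> s < 2 * tau -> A * `|V s| `^ p <= W1 s)
  (HV : forall s, tau / 2 < s -> s < 2 * tau -> B * `|W s| `^ q <= V2 s)
  (Hw : forall s, tau / 2 < s -> s < 2 * tau -> w <= W1 s)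
  (Hv : forall s, tau / 2 < s -> s < 2 * tau -> v <= V2 s).

Let sub s : s <= 2 * tau -> (s%:E < T)%E.
Proof. by move=> st; apply: le_lt_trans tauT; rewrite lee_fin. Qed.

Let nondecreasing_from0 (f f1 : R -> R) y : has_derivative_on T f f1 -> 0 <= f 0 -> 0 <= y ->
  y <= 2 * tau -> (forall s, 0 < s -> s < 2 * tau -> 0 <= f1 s) -> 0 <= f y.
Proof.
move=> df f0 y0 y2 f10; apply: (le_trans f0).
rewrite -subr_ge0 -[leLHS](mul0r (y - 0)).
apply: (le_increment df) => //; first exact: sub.
by move=> s s0 sy; apply: f10 => //; exact: lt_le_trans y2.
Qed.

Let V1_ge0 t : 0 <= t -> t <= 2 * tau -> 0 <= V1 t.
Proof. by move=> t0 t2; exact: (nondecreasing_from0 dV1). Qed.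

Let V_ge0 t : 0 <= t -> t <= 2 * tau -> 0 <= V t.
Proof.
move=> t0 t2; apply: (nondecreasing_from0 dV) => // s s0 s2.
by apply: V1_ge0; exact: ltW.
Qed.

Let W_ge0 t : 0 <= t -> t <= 2 * tau -> 0 <= W t.
Proof. by move=> t0 t2; exact: (nondecreasing_from0 dW). Qed.

(** Integrating v <= V'' twice over [tau/2, tau]. *)
Lemma V_at_scale : v * (tau / 4) ^+ 2 <= V tau.
Proof.
have t0 := tau0.
have step1 s : tau / 2 + tau / 4 <= s -> s <= tau -> v * (tau / 4) <= V1 s.
  move=> s1 s2.
  have H := @le_increment R T V1 V2 (tau / 2) s v dV1.
  apply: (@le_trans _ _ (V1 s - V1 (tau / 2))).
    apply: le_trans (H _ _ _ _); [|lra|lra|by apply: sub; lra|].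
      by apply: ler_wpM2l; [exact: ltW|lra].
    by move=> u u1 u2; apply: Hv => //; lra.
  by rewrite gerBl V1_ge0//; lra.
have H := @le_increment R T V V1 (tau / 2 + tau / 4) tau (v * (tau / 4)) dV.
apply: (@le_trans _ _ (V tau - V (tau / 2 + tau / 4))).
  apply: le_trans (H _ _ _ _); [|lra|lra|by apply: sub; lra|].
    rewrite (_ : tau - _ = tau / 4); last by field.
    by rewrite expr2 mulrA.
  by move=> u u1 u2; apply: step1; lra.
by rewrite gerBl V_ge0//; lra.
Qed.

Lemma W_at_scale : w * (tau / 2) <= W tau.
Proof.
have t0 := tau0.
have H := @le_increment R T W W1 (tau / 2) tau w dW.
apply: (@le_trans _ _ (W tau - W (tau / 2))).
  apply: le_trans (H _ _ _ _); [|lra|lra|by apply: sub; lra|].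
    by rewrite (_ : tau - _ = tau / 2)//; field.
  by move=> u u1 u2; apply: Hw; lra.
by rewrite gerBl W_ge0//; lra.
Qed.

Lemma V_at_scale_from_W : B * (tau / 4) ^+ 2 * (w * (tau / 2)) `^ q <= V (3 / 2 * tau).
Proof.
have t0 := tau0; have ww := w0.
have t2 : tau <= 2 * tau by lra.
have H := V_from_W dV dV1 dW A0 B0 q1 (ltW tau0) tauT (V_ge0 (ltW tau0) t2)
   (V1_ge0 (ltW tau0) t2).
rewrite (_ : 3 / 2 * tau = tau + 2 * (tau / 4)); last by field.
apply: (H p) => //; last exact: W_at_scale.
- by move=> s s1 s2; apply: HW => //; lra.
- by move=> s s1 s2; apply: HV => //; lra.
- by lra.
- by lra.
- by apply: mulr_ge0; lra.
Qed.

Lemma no_solution_from Y a : 0 < Y -> tau <= a -> a <= 3 / 2 * tau -> Y <= V a ->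
  2 `^ ((2 + q) / (p * q - 1)) <= B * A `^ q * (1 / 12 * tau) `^ (2 + q) * Y `^ (p * q - 1) ->
  False.
Proof.
move=> Y0 ta ta2 YV HD; have t0 := tau0.
have pq : 0 < p * q - 1.
  by rewrite subr_gt0 (lt_le_trans p1)// ler_peMr// ltW// (lt_trans ltr01).
have q0 : 0 <= 2 + q by rewrite addr_ge0// ltW// (lt_trans ltr01).
have a0 : 0 <= a by lra.
have ab : a < 2 * tau by lra.
have Va : 0 < V a by exact: lt_le_trans YV.
apply: (no_global_solution dV dV1 dW A0 B0 p1 q1 a0 ab tauT (ltW Va)
  (V1_ge0 a0 (ltW ab)) (W_ge0 a0 (ltW ab)) _ _ Va _).
- by move=> s s1 s2; apply: HW => //; lra.
- by move=> s s1 s2; apply: HV => //; lra.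
apply: (le_trans HD); apply: ler_pM.
- by apply: mulr_ge0; [apply: mulr_ge0; [exact: ltW|exact: powR_ge0]|exact: powR_ge0].
- exact: powR_ge0.
- apply: ler_wpM2l; first by apply: mulr_ge0; [exact: ltW|exact: powR_ge0].
  by apply: ge0_ler_powR => //; rewrite ?nnegrE; lra.
- by apply: ge0_ler_powR; rewrite ?nnegrE ?(ltW pq) ?(ltW Y0) ?(ltW Va).
Qed.

Lemma no_solution_from_V :
  2 `^ ((2 + q) / (p * q - 1)) <=
    B * A `^ q * (1 / 12 * tau) `^ (2 + q) * (v * (tau / 4) ^+ 2) `^ (p * q - 1) -> False.
Proof.
have t0 := tau0.
apply: (@no_solution_from _ tau) => //; [|lra|exact: V_at_scale].
by apply: mulr_gt0 => //; apply: exprn_gt0; lra.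
Qed.

Lemma no_solution_from_W :
  2 `^ ((2 + q) / (p * q - 1)) <= B * A `^ q * (1 / 12 * tau) `^ (2 + q) *
     (B * (tau / 4) ^+ 2 * (w * (tau / 2)) `^ q) `^ (p * q - 1) -> False.
Proof.
have t0 := tau0.
apply: (@no_solution_from _ (3 / 2 * tau)); [|lra|lra|exact: V_at_scale_from_W].
apply: mulr_gt0; first by apply: mulr_gt0 => //; apply: exprn_gt0; lra.
by apply: powR_gt0; apply: mulr_gt0 => //; lra.
Qed.

End fixed_scale.

(** The constants v and w of the preceding lemmas are taken of the order of the
    lower bounds that involve eps.  Then [no_solution_from_V] bounds
    eps tau^(G1 - (n-1)/2) and [no_solution_from_W] bounds
    eps tau^(G2 - (n-1)/2), where G1 and G2 are the two entries of the maximum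
    in Gamma_SG; the larger entry decides which one is applied. *)
Lemma blowup_at_scale (n : nat) (p q k : R) : 1 < p -> 1 < q -> 0 < k ->
  exists2 C : R, 0 < C &
  forall (T : \bar R) (V V1 V2 W W1 : R -> R) (eps tau : R),
    has_derivative_on T V V1 -> has_derivative_on T V1 V2 -> has_derivative_on T W W1 ->
    0 < eps -> 1 <= tau -> ((2 * tau)%:E < T)%E ->
    0 <= V 0 -> 0 <= V1 0 -> 0 <= W 0 ->
    (forall t, 0 < t -> t < 2 * tau ->
      [/\ k * `|V t| `^ p * (1 + t) `^ (- (n%:R * (p - 1))) <= W1 t,
          k * eps `^ p * (1 + t) `^ ((n%:R - 1) * (1 - p / 2)) <= W1 t,
          k * `|W t| `^ q * (1 + t) `^ (- (n%:R * (q - 1))) <= V2 t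
        & k * eps `^ q * (1 + t) `^ ((n%:R - 1) * (1 - q / 2)) <= V2 t]) ->
    eps * tau `^ Gamma_SG p q n < C.
Proof.
move=> p1 q1 k0.
have p0 : 0 < p by lra.
have q0 : 0 < q by lra.
have pq : 0 < p * q - 1.
  by rewrite subr_gt0 (lt_le_trans p1)// ler_peMr// ltW.
have cmp (e : R) : exists2 c : R, 0 < c & forall t tau, 1 <= tau -> tau / 2 < t -> t < 2 * tau ->
    c * tau `^ e <= (1 + t) `^ e.
  have [C C0 HC] := @powR_compare R e (1 / 3) 2 ltac:(lra) ltac:(lra).
  exists C^-1; first by rewrite invr_gt0.
  move=> t tau tau1 t1 t2; rewrite ler_pdivrMl//.
  by apply: HC; lra.
have [c1 c10 H1] := cmp (- (n%:R * (p - 1))).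
have [c2 c20 H2] := cmp ((n%:R - 1) * (1 - p / 2)).
have [c3 c30 H3] := cmp (- (n%:R * (q - 1))).
have [c4 c40 H4] := cmp ((n%:R - 1) * (1 - q / 2)).
set D : R := 2 `^ ((2 + q) / (p * q - 1)).
have D0 : 0 < D by exact: powR_gt0.
have kc1 := mulr_gt0 k0 c10; have kc2 := mulr_gt0 k0 c20.
have kc3 := mulr_gt0 k0 c30; have kc4 := mulr_gt0 k0 c40.
have h16 : (0:R) < 1 / 16 by lra.
have h12 : (0:R) < 1 / 12 by lra.
have h2 : (0:R) < 1 / 2 by lra.
have Z20 := mulr_gt0 kc2 h2.
have Y10 := mulr_gt0 kc4 h16.
have Y20 := mulr_gt0 (mulr_gt0 kc3 h16) (powR_gt0 q Z20).
pose cc Y := (k * c3) * (k * c1) `^ q * (1 / 12) `^ (2 + q) * Y `^ (p * q - 1).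
have cc0 Y : 0 < Y -> 0 < cc Y by move=> Y0; rewrite /cc !mulr_gt0 ?powR_gt0.
have z1 : 0 < q * (p * q - 1) by rewrite mulr_gt0.
have z2 : 0 < p * q * (p * q - 1) by rewrite !mulr_gt0.
have [C1 C10 HC1] := powR_large D0 (cc0 _ Y10) z1.
have [C2 C20 HC2] := powR_large D0 (cc0 _ Y20) z2.
exists (C1 + C2); first exact: addr_gt0.
move=> T V V1 V2 W W1 eps tau dV dV1 dW eps0 tau1 tT V0 V10 W0 Hin.
have tau0 : 0 < tau by exact: lt_le_trans tau1.
have eps_p := powR_gt0 p eps0; have eps_q := powR_gt0 q eps0.
have th : 0 < tau / 2 by exact: divr_gt0.
rewrite ltNge; apply/negP => Hbig.
have W1ge0 t : 0 < t -> t < 2 * tau -> 0 <= W1 t.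
  move=> t0 t2; have [H _ _ _] := Hin t t0 t2; apply: le_trans H.
  by do 2 (apply: mulr_ge0; last exact: powR_ge0); exact: ltW.
have V2ge0 t : 0 < t -> t < 2 * tau -> 0 <= V2 t.
  move=> t0 t2; have [_ _ H _] := Hin t t0 t2; apply: le_trans H.
  by do 2 (apply: mulr_ge0; last exact: powR_ge0); exact: ltW.
have rearr (c e x t : R) : 0 <= x -> c * tau `^ e <= (1 + t) `^ e ->
    (k * c) * tau `^ e * x <= k * x * (1 + t) `^ e.
  move=> x0 H; rewrite -[_ * _ * tau `^ e]mulrA mulrAC; apply: ler_wpM2l H.
  by apply: mulr_ge0 => //; exact: ltW.
pose mon := monomial eps tau.
have HW s : tau / 2 < s -> s < 2 * tau ->
    mon (k * c1) 0 (- (n%:R * (p - 1))) * `|V s| `^ p <= W1 s.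
  move=> s1 s2; have [H _ _ _] := Hin s (lt_trans th s1) s2.
  apply: le_trans H; rewrite /mon /monomial powRr0 mul1r.
  by apply: rearr; [exact: powR_ge0|exact: H1].
have Hw s : tau / 2 < s -> s < 2 * tau ->
    mon (k * c2) p ((n%:R - 1) * (1 - p / 2)) <= W1 s.
  move=> s1 s2; have [_ H _ _] := Hin s (lt_trans th s1) s2.
  apply: le_trans H; rewrite /mon /monomial [eps `^ _ * _]mulrC mulrA.
  by apply: rearr; [exact: powR_ge0|exact: H2].
have HV s : tau / 2 < s -> s < 2 * tau ->
    mon (k * c3) 0 (- (n%:R * (q - 1))) * `|W s| `^ q <= V2 s.
  move=> s1 s2; have [_ _ H _] := Hin s (lt_trans th s1) s2.
  apply: le_trans H; rewrite /mon /monomial powRr0 mul1r.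
  by apply: rearr; [exact: powR_ge0|exact: H3].
have Hv s : tau / 2 < s -> s < 2 * tau ->
    mon (k * c4) q ((n%:R - 1) * (1 - q / 2)) <= V2 s.
  move=> s1 s2; have [_ _ _ H] := Hin s (lt_trans th s1) s2.
  apply: le_trans H; rewrite /mon /monomial [eps `^ _ * _]mulrC mulrA.
  by apply: rearr; [exact: powR_ge0|exact: H4].
have A0 := monomial_gt0 eps0 tau0 0 (- (n%:R * (p - 1))) kc1.
have B0 := monomial_gt0 eps0 tau0 0 (- (n%:R * (q - 1))) kc3.
have w0 := monomial_gt0 eps0 tau0 p ((n%:R - 1) * (1 - p / 2)) kc2.
have v0 := monomial_gt0 eps0 tau0 q ((n%:R - 1) * (1 - q / 2)) kc4.
have t12 : 1 / 12 * tau = mon (1 / 12) 0 1.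
  by rewrite /mon /monomial powRr0 !mul1r powRr1// ltW.
have t2 : tau / 2 = mon (1 / 2) 0 1.
  by rewrite /mon /monomial powRr0 !mul1r powRr1 ?(ltW tau0)// mulrC.
have t4 : (tau / 4) ^+ 2 = mon (1 / 16) 0 2.
  by rewrite /mon /monomial powRr0 mul1r powR_mulrn ?(ltW tau0)//; field.
move: Hbig; rewrite /Gamma_SG.
set G1 := (p + 1 + q^-1) / _; set G2 := (2 + p^-1) / _.
have [G12|G12] := leP G1 G2 => Hb.
- apply: (no_solution_from_W dV dV1 dW A0 B0 w0 p1 q1 tau0 tT V0 V10 W0 W1ge0 V2ge0 HW HV Hw).
  rewrite t12 t2 t4 /mon !(monomialM eps0 tau0).
  rewrite ![monomial _ _ _ _ _ `^ q]monomial_powR//.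
  rewrite ![monomial _ _ _ _ _ `^ (2 + q)]monomial_powR// !(monomialM eps0 tau0).
  rewrite monomial_powR// !(monomialM eps0 tau0).
  set cst := (X in monomial _ _ X); set ex := (X in monomial _ _ _ X).
  set ey := (X in monomial _ _ _ _ X).
  have -> : ex = p * q * (p * q - 1) by rewrite /ex; ring.
  have -> : ey = (G2 - (n%:R - 1) / 2) * (p * q * (p * q - 1)).
    by rewrite /ey /G2; field; rewrite !gt_eqF.
  rewrite monomial_diag//; apply: HC2.
  by apply: le_trans Hb; rewrite lerDr ltW.
- apply: (no_solution_from_V dV dV1 dW A0 B0 v0 p1 q1 tau0 tT V0 V10 W0 W1ge0 V2ge0 HW HV Hv).
  rewrite t12 t4 /mon !(monomialM eps0 tau0).
  rewrite ![monomial _ _ _ _ _ `^ q]monomial_powR//.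
  rewrite ![monomial _ _ _ _ _ `^ (2 + q)]monomial_powR// !(monomialM eps0 tau0).
  rewrite monomial_powR// !(monomialM eps0 tau0).
  set cst := (X in monomial _ _ X); set ex := (X in monomial _ _ _ X).
  set ey := (X in monomial _ _ _ _ X).
  have -> : ex = q * (p * q - 1) by rewrite /ex; ring.
  have -> : ey = (G1 - (n%:R - 1) / 2) * (q * (p * q - 1)).
    by rewrite /ey /G1; field; rewrite !gt_eqF.
  rewrite monomial_diag//; apply: HC1.
  by apply: le_trans Hb; rewrite lerDl ltW.
Qed.

End blowup_at_scale.

(** * Finite speed of propagation for distributions *)

Section finite_speed.
Context {R : realType} {n : nat}.
Local Notation Rn := ('rV[R]_n).
Variables (K : R -> R) (d : R).
Hypothesis d0 : 0 < d.
Hypothesis dK : forall r, 0 < r -> derivable K r 1.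
Hypothesis bK : forall r, 0 < r -> d < K r < d^-1.
Implicit Types (f h phi chi : Rn -> R) (T : \bar R) (L : (Rn -> R) -> R).

(** The margin 1 leaves room for cutoff functions that are constant near the
    ball of radius r. *)
Definition null_beyond L (r : R) :=
  forall f, test f -> (forall x, enorm x <= r + 1 -> f x = 0) -> L f = 0.

Lemma distribution_linear L : is_distribution L -> linear_on_tests L.
Proof. by case. Qed.

(** The complement of the support is described pointwise;
    [locally_null_functional] on a closed annulus outside the cone turns this
    into a statement about test functions. *)
Lemma null_beyond_cone T (w : R -> (Rn -> R) -> R) (c R1 t r : R) :
  st_support T w `<=` light_cone K c R1 -> linear_on_tests (w t) ->
  time_interval T t -> 0 <= r -> radial K r = c * t + R1 -> null_beyond (w t) r.
Proof.
move=> supp lw tT r0 rE f tf fr.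
have [_ [rho hrho]] := tf.
apply: (locally_null_functional lw (@compact_enorm_annulus R n (r + 1) rho)) => //; last first.
  move=> x fx; apply/andP; split; rewrite leNgt; apply/negP => H.
    by move: fx; rewrite fr ?eqxx// ltW.
  by move: fx; rewrite hrho ?eqxx.
move=> x /= /andP[rx _].
have : ~ st_support T w (t, x).
  move=> /supp; rewrite /light_cone /= -rE => H.
  have rx' : r <= enorm x by lra.
  have /andP[H1 _] := radial_incr d0 dK bK r0 rx'.
  have : 0 < d * (enorm x - r) by rewrite mulr_gt0//; lra.
  lra.
move=> /not_andP[//|/contrapT[e e0 He]]; exists e => // h th hh.
by apply: (He t h) => //=; rewrite subrr normr0.
Qed.

Lemma cone_radius_mono (r r' s s' : R) : 0 <= r' -> radial K r = s -> radial K r' = s' ->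
  s <= s' -> r <= r'.
Proof.
move=> r0 <- <- H; rewrite leNgt; apply/negP => rr.
have /andP[H1 _] := radial_incr d0 dK bK r0 (ltW rr).
have : 0 < d * (r - r') by rewrite mulr_gt0// subr_gt0.
lra.
Qed.

Lemma null_beyond_mono L r r' : r <= r' -> null_beyond L r -> null_beyond L r'.
Proof. by move=> rr H f tf fr; apply: H => // x xr; apply: fr; lra. Qed.

(** For s <= t the cone is smaller, so the pairing vanishes for all earlier times
    and its left derivative at t > 0 is 0. *)
Lemma null_beyond_derivative T (w w1 : R -> (Rn -> R) -> R) (c R1 t r : R) :
  0 < c -> 0 < R1 ->
  st_support T w `<=` light_cone K c R1 ->
  (forall s, time_interval T s -> linear_on_tests (w s)) ->
  (forall f, test f -> has_derivative_on T (w^~ f) (w1^~ f)) ->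
  0 < t -> (t%:E < T)%E -> 0 <= r -> radial K r = c * t + R1 -> null_beyond (w1 t) r.
Proof.
move=> c0 R10 supp lw dw t0 tT r0 rE f tf fr.
have null s : 0 <= s -> s <= t -> w s f = 0.
  move=> s0 st.
  have sT : time_interval T s by split => //; apply: le_lt_trans tT; rewrite lee_fin.
  have cs : 0 <= c * s + R1 by rewrite addr_ge0 ?mulr_ge0// ltW.
  have [r' r'0 r'E] := radial_onto d0 dK bK cs.
  have rr : r' <= r.
    by apply: cone_radius_mono r0 r'E rE _; rewrite lerD2r ler_pM2l.
  apply: (null_beyond_mono rr (null_beyond_cone supp (lw s sT) sT r'0 r'E)) => //.
apply/eqP/negPn/negP => w0.
have [e e0 H] := has_derivative_on_eps (dw f tf) (conj (ltW t0) tT) (ltac:(by rewrite normr_gt0) : 0 < `|w1 t f|).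
pose s := t - Num.min t (e / 2).
have m0 : 0 < Num.min t (e / 2) by rewrite lt_min t0 divr_gt0.
have mt : Num.min t (e / 2) <= t by rewrite ge_min lexx.
have me : Num.min t (e / 2) <= e / 2 by rewrite ge_min lexx orbT.
have s0 : 0 <= s by rewrite subr_ge0.
have st : s < t by rewrite /s; lra.
have := H s; rewrite (null s s0 (ltW st)) (null t (ltW t0) (lexx t)) subrr mul0r subr0 ltxx => H'.
suff: false by []; apply: H'.
- by split => //; apply: lt_trans tT; rewrite lte_fin.
- by rewrite lt_eqF.
- by rewrite /s addrAC subrr add0r normrN gtr0_norm//; lra.
Qed.

End finite_speed.

Section localised_equation.
Context {R : realType} {n : nat}.
Local Notation Rn := ('rV[R]_n).
Variable g : Rn -> 'M[R]_n.
Hypothesis gP : riemannian_metric g.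
Implicit Types (f h phi chi : Rn -> R) (L : (Rn -> R) -> R).

Lemma null_beyond_eq L r f h : linear_on_tests L -> null_beyond L r -> test f -> test h ->
  (forall x, enorm x <= r + 1 -> f x = h x) -> L f = L h.
Proof.
move=> lL nL tf th fh.
have tN := test_lin (-1) th tf.
have : L (fun x => -1 * h x + f x) = 0.
  by apply: nL => // x xr; rewrite fh// mulN1r addNr.
by rewrite lL// mulN1r addrC => /subr0_eq.
Qed.

Lemma linear_on_testsZ L a f : linear_on_tests L -> test f -> L (fun x => a * f x) = a * L f.
Proof.
move=> lL tf; have := lL a f _ tf test0; rewrite linear_on_tests0// addr0 => <-.
by congr (L _); apply/funext => x; rewrite addr0.
Qed.

(** The cutoff for a whole time interval, when r is the radius of the cone at the
    final time. *)
Definition slab r := cutoff (0 : Rn) (r + 2) (r + 3).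

Lemma test_slab r : 0 <= r -> test (slab r).
Proof. by move=> r0; apply: test_cutoff; lra. Qed.

Lemma slab_near1 r x : 0 <= r -> enorm x <= r + 1 -> {near x, slab r =1 cst 1}.
Proof.
move=> r0 xr.
have : nbhs x ((@enorm R n) @^-1` [set t | t < r + 2]).
  by apply: continuous_enorm; apply: lt_nbhsl; lra.
apply: filterS => y /= yr; rewrite /slab cutoff_eq1 ?subr0//; last exact: ltW.
by apply/andP; split; lra.
Qed.

(** The cutoff is constant near the ball on which the functional lives. *)
Lemma laplace_slab_null L r : linear_on_tests L -> 0 <= r -> null_beyond L r ->
  L (laplace_beltrami g (slab r)) = 0.
Proof.
move=> lL r0 nL; apply: nL; first exact: test_laplace_beltrami (test_slab r0).
by move=> x xr; rewrite (laplace_beltrami_local _ (slab_near1 r0 xr)) laplace_beltrami_cst.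
Qed.

Lemma laplace_slab_eigen L r mu phi : linear_on_tests L -> 0 <= r -> null_beyond L r ->
  smooth phi -> (forall x, laplace_beltrami g phi x = mu * phi x) ->
  L (laplace_beltrami g (fun x => slab r x * phi x)) = mu * L (fun x => slab r x * phi x).
Proof.
move=> lL r0 nL sphi ephi.
have ts : test (fun x => slab r x * phi x) by apply: test_mul => //; exact: test_slab.
rewrite -linear_on_testsZ//; apply: (null_beyond_eq lL nL).
- exact: test_laplace_beltrami.
- have := test_lin mu ts test0; congr test.
  by apply/funext => x; rewrite addr0.
move=> x xr; have n1 := slab_near1 r0 xr.
rewrite (nbhs_singleton n1) /= mul1r -ephi; apply: laplace_beltrami_local.
by apply: filterS n1 => y /= ->; rewrite mul1r.
Qed.

End localised_equation.

(** * Lower bounds for the nonlinear terms *)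

Section source_terms.
Context {R : realType} {n : nat}.
Local Notation Rn := ('rV[R]_n).
Local Notation RT := (measurableTypeR R).
Variable g : Rn -> 'M[R]_n.
Hypothesis gP : riemannian_metric g.
Variable Cg : R.
Hypothesis gC : forall x, Num.sqrt (\det (g x)) <= Cg.

Lemma vint_ball_le s D (F : Rn -> R) : 0 < s -> 0 <= D -> row_measurable F ->
  (forall x, 0 <= F x) -> (forall x, s < enorm x -> F x = 0) -> (forall x, F x <= D) ->
  vint g F <= Cg * D * unit_vol n * s ^+ n.
Proof.
move=> s0 D0 mF F0 Fs FD.
have mb := @measurable_eball R n s.
have Cg0 := density_bound_ge0 gC.
have H : (\int[lebn n]_t (F (row_of_tuple t) * Num.sqrt (\det (g (row_of_tuple t))))%:E
    <= (Cg * D * unit_vol n * s ^+ n)%:E)%E.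
  apply: (@le_trans _ _ (\int[lebn n]_(t in eball n s) (cst (D * Cg)%:E) t)%E).
    rewrite [leRHS]integral_mkcond; apply: ge0_le_integral => //.
    - by move=> t _; rewrite lee_fin mulr_ge0// sqrtr_ge0.
    - apply/measurable_EFinP; apply: measurable_funM => //.
      exact: (row_measurable_density gP).
    - by apply/(measurable_restrictT _ mb); exact: measurable_cst.
    - move=> t _; rewrite patchE; case: ifPn => [_|].
        by rewrite lee_fin; apply: ler_pM => //; exact: sqrtr_ge0.
      rewrite notin_setE /eball /= => /negP; rewrite -ltNge => /Fs ->.
      by rewrite mul0r.
  rewrite integral_cst//.
  rewrite (_ : (_ * _)%E = ((D * Cg)%:E * lebn n (eball n s))%E)// lebn_eball//.
  by rewrite -EFinM lee_fin le_eqVlt; apply/orP; left; apply/eqP; ring.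
rewrite /vint /Rintegral -lee_fin fineK//.
rewrite ge0_fin_numE ?(le_lt_trans H) ?ltry// integral_ge0// => t _.
by rewrite lee_fin mulr_ge0// sqrtr_ge0.
Qed.

Lemma row_measurable_powR (psi : Rn -> R) a : continuous psi ->
  row_measurable (fun x => psi x `^ a).
Proof.
move=> cpsi.
rewrite /row_measurable (_ : _ \o _ = (fun s => s `^ a) \o (psi \o row_of_tuple))//.
apply: measurableT_comp; first exact: measurable_powR.
exact: continuous_measurable_row.
Qed.

Variables (K : R -> R) (d : R).
Hypothesis d0 : 0 < d.
Hypothesis dK : forall r, 0 < r -> derivable K r 1.
Hypothesis bK : forall r, 0 < r -> d < K r < d^-1.
Variables (c R1 : R).
Hypotheses (c0 : 0 < c) (R10 : 0 < R1).

Lemma cone_radius_compare : exists m M : R, [/\ 0 < m, 0 < M & forall t r,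
  0 <= t -> 0 <= r -> radial K r = c * t + R1 ->
  m * (1 + t) <= 1 + (r + 2) <= M * (1 + t)].
Proof.
have dc : 0 < d * c by rewrite mulr_gt0.
have di : 0 < d^-1 by rewrite invr_gt0.
exists (Num.min 3 (d * c)), (d^-1 * (c + R1) + 3).
have M0 : 0 < d^-1 * (c + R1) by rewrite mulr_gt0// addr_gt0.
split; [by rewrite lt_min dc andbT|lra|move=> t r t0 r0 E].
have /andP[] := radial_incr d0 dK bK (lexx 0) r0.
rewrite (radial0 d0 dK bK) !subr0 E => H1 H2.
have H3 : r <= d^-1 * (c * t + R1) by rewrite ler_pdivlMl.
have H4 : d * (c * t + R1) <= r.
  by rewrite -(ler_pM2l di) mulrA mulVf ?gt_eqF// mul1r.
have m3 : Num.min 3 (d * c) <= 3 by rewrite ge_min lexx.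
have mdc : Num.min 3 (d * c) <= d * c by rewrite ge_min lexx orbT.
apply/andP; split.
  have : Num.min 3 (d * c) * t <= d * c * t by rewrite ler_wpM2r.
  have : 0 < d * R1 by rewrite mulr_gt0.
  by rewrite mulrDr mulr1; move: H4; rewrite mulrDr; lra.
have : 0 <= d^-1 * R1 * t by rewrite !mulr_ge0// ltW.
have : 0 <= d^-1 * c by rewrite mulr_ge0// ltW.
lra.
Qed.

(** The cutoff adapted to the section of the cone at a single time, when r is its
    radius.  It has the same pairing as [slab] but a support of the right size
    for Hoelder's inequality. *)
Definition bulk r := cutoff (0 : Rn) (r + 1) (r + 2).

Lemma test_bulk r : 0 <= r -> test (bulk r).
Proof. by move=> r0; apply: test_cutoff; lra. Qed.

Lemma slab_bulk_eq z r R' (phi : Rn -> R) : linear_on_tests z -> null_beyond z r ->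
  0 <= r -> r <= R' -> smooth phi ->
  z (fun x => slab R' x * phi x) = z (fun x => bulk r x * phi x).
Proof.
move=> lz nz r0 rR sphi; apply: (null_beyond_eq lz nz).
- by apply: test_mul => //; apply: test_slab; lra.
- by apply: test_mul => //; exact: test_bulk.
by move=> x xr; rewrite /slab /bulk !cutoff_eq1 ?subr0 //; try (apply/andP; split); lra.
Qed.

Lemma bulk_slab r R' x : 0 <= r -> r <= R' -> bulk r x != 0 -> slab R' x = 1 :> R.
Proof.
move=> r0 rR bx; rewrite /slab cutoff_eq1 ?subr0//; first by apply/andP; split; lra.
rewrite leNgt; apply/negP => xR; move: bx; rewrite /bulk cutoff_eq0 ?eqxx//; first lra.
by rewrite subr0; lra.
Qed.

Lemma bulk_le1 r x : 0 <= r -> bulk r x <= 1.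
Proof. by move=> r0; apply: cutoff_le1; apply/andP; split; lra. Qed.

Lemma bulk_out r x : 0 <= r -> r + 2 < enorm x -> bulk r x = 0.
Proof. by move=> r0 xr; apply: cutoff_eq0; rewrite ?subr0; lra. Qed.

Variable p : R.
Hypothesis p1 : 1 < p.

Let p'_gt0 : 0 < p / (p - 1).
Proof. by rewrite divr_gt0 ?subr_gt0// (lt_trans ltr01). Qed.

(** The functional z is tested against bulk h, and the power of f against the
    larger cutoff. *)
Lemma source_lower z N f r R' (h : Rn -> R) L B : 0 <= r -> r <= R' ->
  linear_on_tests z -> null_beyond z r ->
  represents g f z -> represents g (fun x => `|f x| `^ p) N ->
  smooth h -> (forall x, 0 <= h x) -> 0 < L -> 0 < B ->
  L <= `|z (fun x => slab R' x * h x)| ->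
  vint g (fun x => (bulk r x * h x) `^ (p / (p - 1))) <= B ->
  2 `^ (- p) * L `^ p * B `^ (- (p - 1)) <= N (slab R').
Proof.
move=> r0 rR lz nz [lf fE] [lfp NE] sh h0 L0 B0 HL HB.
have R'0 : 0 <= R' by exact: le_trans rR.
have tch := test_slab (n := n) R'0.
have tpsi : test (fun x => bulk r x * h x) by exact: test_mul (test_bulk r0) sh.
rewrite NE//.
apply: (hoelder_below gP gC p1 lf lfp tpsi tch _ _ _ L0 B0 _ HB).
- by move=> x; apply: mulr_ge0; [exact: cutoff_ge0|exact: h0].
- by move=> x; exact: cutoff_ge0.
- by move=> x; rewrite mulf_eq0 negb_or => /andP[bx _]; exact: bulk_slab bx.
- rewrite -fE; last exact: tpsi.
  by rewrite -(slab_bulk_eq lz nz r0 rR sh).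
Qed.

Lemma bulk_mass_le : exists2 CB : R, 0 < CB & forall t r,
  0 <= t -> 0 <= r -> radial K r = c * t + R1 ->
  vint g (fun x => bulk r x `^ (p / (p - 1))) <= CB * (1 + t) `^ n%:R.
Proof.
have [m [M [m0 M0 HM]]] := cone_radius_compare.
have Cg0 : 0 < Cg by apply: lt_le_trans (gC 0); exact: density_gt0.
have V0 : 0 < unit_vol n + 1 :> R by rewrite ltr_wpDl// unit_vol_ge0.
exists (Cg * (unit_vol n + 1) * M `^ n%:R); first by rewrite !mulr_gt0// powR_gt0.
move=> t r t0 r0 rE.
have /andP[_ rM] := HM t r t0 r0 rE.
have r20 : 0 < r + 2 by rewrite ltr_wpDl.
have Mt : 0 <= M * (1 + t) by apply: mulr_ge0; rewrite ?addr_ge0// ltW.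
have rM' : r + 2 <= M * (1 + t) by lra.
have H := @vint_ball_le (r + 2) 1 (fun x => bulk r x `^ (p / (p - 1))) r20 ler01.
apply: (le_trans (H _ _ _ _)).
- by apply: row_measurable_powR; apply: smooth_continuous; exact: smooth_cutoff.
- by move=> x; exact: powR_ge0.
- by move=> x xr; rewrite bulk_out// powR0// gt_eqF.
- move=> x; apply: (@le_trans _ _ (1 `^ (p / (p - 1)))); last by rewrite powR1.
  by apply: ge0_ler_powR; rewrite ?nnegrE ?bulk_le1 ?cutoff_ge0 ?(ltW p'_gt0).
rewrite mulr1 -[leRHS]mulrA -powRM ?(ltW M0) ?addr_ge0// powR_mulrn//.
apply: ler_pM.
- by apply: mulr_ge0; [exact: ltW|exact: unit_vol_ge0].
- by rewrite exprn_ge0// ltW.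
- by apply: ler_wpM2l; [exact: ltW|rewrite lerDl].
- by rewrite lerXn2r ?nnegrE ?(ltW r20).
Qed.

(** [source_lower] with h = 1: the mass of the cutoff is of order (1+t)^n. *)
Lemma source_from_mass : exists2 k : R, 0 < k & forall z N f t r R',
  0 <= t -> 0 <= r -> radial K r = c * t + R1 -> linear_on_tests z -> null_beyond z r ->
  represents g f z -> represents g (fun x => `|f x| `^ p) N -> r <= R' ->
  k * `|z (slab R')| `^ p * (1 + t) `^ (- (n%:R * (p - 1))) <= N (slab R').
Proof.
have [CB CB0 HCB] := bulk_mass_le.
exists (2 `^ (- p) * CB `^ (- (p - 1))); first by rewrite mulr_gt0// powR_gt0.
move=> z N f t r R' t0 r0 rE lz nz fz fN rR.
have t1 : 0 < 1 + t by exact: ltr_wpDr.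
have R'0 : 0 <= R' by exact: le_trans rR.
have times1 (h : Rn -> R) : (fun x => h x * (fun=> 1) x) = h.
  by apply/funext => x; rewrite mulr1.
have [z0|z0] := eqVneq (z (slab R')) 0.
  rewrite z0 normr0 powR0; last by rewrite gt_eqF// (lt_trans ltr01).
  rewrite mulr0 mul0r; case: fN => _ ->; last exact: test_slab.
  by apply: vint_ge0 => x; apply: mulr_ge0; [exact: powR_ge0|exact: cutoff_ge0].
have L0 : 0 < `|z (slab R')| by rewrite normr_gt0.
have B0 : 0 < CB * (1 + t) `^ n%:R by rewrite mulr_gt0// powR_gt0.
have s1 : smooth ((fun=> 1) : Rn -> R) by move=> k; exact: Ck_cst.
have HL : `|z (slab R')| <= `|z (fun x => slab R' x * (fun=> 1) x)|.
  by rewrite (times1 (slab R')) lexx.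
have HB : vint g (fun x => (bulk r x * (fun=> 1) x) `^ (p / (p - 1))) <= CB * (1 + t) `^ n%:R.
  rewrite (_ : (fun x => _) = fun x => bulk r x `^ (p / (p - 1))); last first.
    by apply/funext => x; rewrite mulr1.
  exact: HCB t r t0 r0 rE.
apply: le_trans (source_lower r0 rR lz nz fz fN s1 (fun=> ler01) L0 B0 HL HB).
rewrite (powRM _ (ltW CB0) (powR_ge0 _ _)) -powRrM mulrN.
by rewrite le_eqVlt; apply/orP; left; apply/eqP; ring.
Qed.

Variables (lam k0 : R) (phi : Rn -> R).
Hypotheses (n0 : (0 < n)%N) (lam0 : 0 < lam) (k00 : 0 < k0) (hphi : is_phi g K lam k0 phi).

Local Notation p' := (p / (p - 1)).
Local Notation al := ((n%:R - 1) / 2 * p').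

Let phi_gt0 x : 0 < phi x.
Proof. by have [_ _ bphi] := hphi; have /andP[+ _] := bphi x; exact: lt_trans. Qed.

(* the distance to the boundary of the cone, in the metric K dr, is at least d
   times the Euclidean one *)
Let phi_weight r t x : 0 <= r -> radial K r = c * t + R1 -> enorm x <= r + 2 ->
  phi x `^ p' <= k0^-1 `^ p' * expR (lam * p' * (c * t + R1 + 2 / d)) *
    (jap (lam * enorm x) `^ (- al) * expR (- (lam * p' * d) * (r + 2 - enorm x))).
Proof.
move=> r0 rE xr; have [_ _ bphi] := hphi; have /andP[_ phix] := bphi x.
set J := jap _ `^ _ in phix; set Ex := expR _ in phix.
have J0 : 0 <= J by exact: powR_ge0.
have Ex0 : 0 <= Ex by exact: expR_ge0.
have k0i : 0 <= k0^-1 by rewrite invr_ge0 ltW.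
apply: (@le_trans _ _ ((k0^-1 * J * Ex) `^ p')).
  apply: ge0_ler_powR; rewrite ?(ltW p'_gt0) ?nnegrE ?(ltW phix) ?(ltW (phi_gt0 x))//.
  by apply: mulr_ge0 => //; exact: mulr_ge0.
rewrite (powRM _ (mulr_ge0 k0i J0) Ex0) (powRM _ k0i J0) -[leLHS]mulrA -[leRHS]mulrA.
apply: ler_wpM2l; first exact: powR_ge0.
rewrite /J -powRrM mulNr [leRHS]mulrCA; apply: ler_wpM2l; first exact: powR_ge0.
rewrite /Ex -expRM -expRD ler_expR.
have /andP[H1 _] := radial_incr d0 dK bK (enorm_ge0 x) xr.
have rr : r <= r + 2 by rewrite lerDl.
have /andP[_ H2] := radial_incr d0 dK bK r0 rr.
have H3 : radial K (enorm x) <= c * t + R1 + 2 / d - d * (r + 2 - enorm x).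
  have E2 : d^-1 * (r + 2 - r) = 2 / d by rewrite addrAC subrr add0r mulrC.
  by move: H2; rewrite E2 rE; move: H1; lra.
have lp : 0 <= lam * p' by apply: mulr_ge0; exact: ltW.
apply: le_trans (_ : lam * p' * radial K (enorm x) <= _); first by rewrite mulrAC.
apply: (le_trans (ler_wpM2l lp H3)).
by rewrite le_eqVlt; apply/orP; left; apply/eqP; ring.
Qed.

Let weight_powR (x a : R) : 0 < x -> x ^+ n.-1 * x `^ (- a) = x `^ (n%:R - 1 - a).
Proof.
move=> x0; rewrite -[x ^+ _]powR_mulrn ?(ltW x0)// -powRD; last first.
  by rewrite (gt_eqF x0) implybT.
by rewrite -subn1 natrB.
Qed.

Lemma bulk_eigenfunction_le : exists2 CB : R, 0 < CB & forall t r,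
  0 <= t -> 0 <= r -> radial K r = c * t + R1 ->
  vint g (fun x => (bulk r x * phi x) `^ p') <=
    CB * (expR (lam * p' * c * t) * (1 + t) `^ (n%:R - 1 - al)).
Proof.
have [sphi _ _] := hphi.
have [m [M [m0 M0 HM]]] := cone_radius_compare.
have n1 : 0 <= (n%:R - 1) / 2 :> R by rewrite divr_ge0// subr_ge0 ler1n.
have al0 : 0 <= al by apply: mulr_ge0 => //; exact: ltW.
have nu0 : 0 < lam * p' * d by apply: mulr_gt0 => //; exact: mulr_gt0.
have [C C0 HC] := weighted_vint_le gP gC n0 lam0 al0 nu0.
have [C' C'0 HC'] := powR_compare (n%:R - 1 - al) m0 M0.
pose D t := k0^-1 `^ p' * expR (lam * p' * (c * t + R1 + 2 / d)).
have D0 t : 0 < D t by rewrite mulr_gt0 ?expR_gt0// powR_gt0// invr_gt0.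
exists (C * k0^-1 `^ p' * expR (lam * p' * (R1 + 2 / d)) * C').
  by rewrite !mulr_gt0 ?expR_gt0// powR_gt0// invr_gt0.
move=> t r t0 r0 rE.
have t1 : 0 < 1 + t by exact: ltr_wpDr.
have r20 : 0 < r + 2 by exact: ltr_wpDl.
have psi0 x : 0 <= bulk r x * phi x.
  by apply: mulr_ge0; [exact: cutoff_ge0|exact: ltW].
apply: le_trans (HC (r + 2) (D t) _ r20 (ltW (D0 t)) _ _ _ _) _.
- apply: row_measurable_powR; apply: smooth_continuous => k.
  by apply: Ck_mul; [exact: smooth_cutoff|exact: sphi].
- by move=> x; exact: powR_ge0.
- by move=> x xr; rewrite bulk_out// mul0r powR0// gt_eqF.
- move=> x xr; apply: le_trans (phi_weight r0 rE xr).
  apply: ge0_ler_powR; rewrite ?(ltW p'_gt0) ?nnegrE ?psi0 ?(ltW (phi_gt0 x))//.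
  by rewrite ger_pMl ?bulk_le1.
have s0 : 0 < 1 + (r + 2) by exact: addr_gt0.
rewrite (weight_powR _ s0).
have /andP[Hm1 Hm2] := HM t r t0 r0 rE.
have Hg := HC' _ _ t1 Hm1 Hm2.
have X0 : 0 <= C * D t by apply: mulr_ge0; exact: ltW.
apply: (le_trans (ler_wpM2l X0 Hg)).
rewrite /D (_ : lam * p' * (c * t + R1 + 2 / d) = lam * p' * (R1 + 2 / d) + lam * p' * c * t); last by ring.
by rewrite expRD le_eqVlt; apply/orP; left; apply/eqP; ring.
Qed.

(** [source_lower] with h = phi.  The exponential growth of the pairing is
    cancelled by that of the integral of phi^p', since p' (p - 1) = p; what
    remains are the powers of 1 + t, with exponent
    - (p - 1) (n - 1 - (n - 1)/2 p') = (n - 1) (1 - p/2). *)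
Lemma source_from_eigenfunction : exists2 k : R, 0 < k & forall z N f t r R' E,
  0 <= t -> 0 <= r -> radial K r = c * t + R1 -> linear_on_tests z -> null_beyond z r ->
  represents g f z -> represents g (fun x => `|f x| `^ p) N -> r <= R' -> 0 < E ->
  E * expR (c * lam * t) <= z (fun x => slab R' x * phi x) ->
  k * E `^ p * (1 + t) `^ ((n%:R - 1) * (1 - p / 2)) <= N (slab R').
Proof.
have [sphi _ _] := hphi.
have [CB CB0 HCB] := bulk_eigenfunction_le.
have e0 : p - 1 != 0 by rewrite gt_eqF// subr_gt0.
exists (2 `^ (- p) * CB `^ (- (p - 1))); first by rewrite mulr_gt0// powR_gt0.
move=> z N f t r R' E t0 r0 rE lz nz fz fN rR E0 Hz.
have t1 : 0 < 1 + t by exact: ltr_wpDr.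
have L0 : 0 < E * expR (c * lam * t) by rewrite mulr_gt0// expR_gt0.
have Y0 : 0 < expR (lam * p' * c * t) * (1 + t) `^ (n%:R - 1 - al).
  by rewrite mulr_gt0 ?expR_gt0 ?powR_gt0.
have B0 := mulr_gt0 CB0 Y0.
have := source_lower r0 rR lz nz fz fN sphi (fun x => ltW (phi_gt0 x)) L0 B0
  (le_trans Hz (ler_norm _)) (HCB t r t0 r0 rE).
apply: le_trans.
rewrite (powRM _ (ltW CB0) (ltW Y0)).
rewrite (powRM _ (expR_ge0 _) (powR_ge0 _ _)) (powRM _ (ltW E0) (expR_ge0 _)).
rewrite -powRrM -!expRM.
have -> : expR (lam * p' * c * t * - (p - 1)) = (expR (c * lam * t * p))^-1.
  by rewrite -expRN; congr expR; field.
have -> : (n%:R - 1 - al) * - (p - 1) = (n%:R - 1) * (1 - p / 2) by field.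
rewrite le_eqVlt; apply/orP; left; apply/eqP.
have : expR (c * lam * t * p) != 0 by rewrite gt_eqF ?expR_gt0.
by move: (expR (c * lam * t * p)) => e e1; field.
Qed.

End source_terms.

(** * The two wave equations and the lifespan *)

Section wave_component.
Context {R : realType} {n : nat}.
Local Notation Rn := ('rV[R]_n).
Local Notation functional := ((Rn -> R) -> R).

(** The uniform ellipticity bounds the entries of g, hence its volume density. *)
Lemma asymptotically_euclidean_bounds (g : Rn -> 'M[R]_n) (K : R -> R) :
  asymptotically_euclidean g K -> exists d Cg : R,
  [/\ 0 < d, riemannian_metric g, forall x, Num.sqrt (\det (g x)) <= Cg,
      forall r, 0 < r -> derivable K r 1 & forall r, 0 < r -> d < K r < d^-1].
Proof.
move=> [gP [g2 [rho [beta [d [C [_ _ /andP[d0 _] _ [[Kd _] _ ell bK]]]]]]]].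
exists d, (Num.sqrt ((n`!)%:R * d^-1 ^+ n)); split => //; last by move=> r /Kd[].
move=> x; apply: ler_wsqrtr; apply: (le_trans (ler_norm _)); apply: det_le.
have [_ sg _] := gP; apply: (posdef_entry_le d0 (sg x)).
  by rewrite unitmxE unitfE gt_eqF// metric_det_gt0.
by move=> xi; have /andP[] := ell x xi.
Qed.

Variable g : Rn -> 'M[R]_n.
Hypothesis gP : riemannian_metric g.
Variable Cg : R.
Hypothesis gC : forall x, Num.sqrt (\det (g x)) <= Cg.
Variables (K : R -> R) (d : R).
Hypothesis d0 : 0 < d.
Hypothesis dK : forall r, 0 < r -> derivable K r 1.
Hypothesis bK : forall r, 0 < r -> d < K r < d^-1.
Variables (R1 lam : R) (phi : Rn -> R).
Hypotheses (R10 : 0 < R1) (lam0 : 0 < lam) (sphi : smooth phi)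
  (ephi : forall x, laplace_beltrami g phi x = lam ^+ 2 * phi x)
  (phi0 : forall x, 0 < phi x).

(** The data are supported where the cutoff is 1. *)
Lemma initial_pairing (f h : Rn -> R) (Rad R' eps : R) : test f -> smooth h ->
  (forall x, Rad < enorm x -> f x = 0) -> 0 <= R' -> Rad <= R' ->
  vint g (fun x => eps * f x * (slab R' x * h x)) = eps * vint g (fun x => f x * h x).
Proof.
move=> tf sh fRad R'0 RR.
rewrite -vintZ; last by apply: (vintegrable_test gP gC); exact: test_mul tf sh.
congr (vint g _); apply/funext => x.
have [xR|/fRad ->] := leP (enorm x) Rad; last by rewrite mulr0 !mul0r mulr0.
have xR' : enorm x <= R' + 2 by lra.
have RR' : 0 <= R' + 2 < R' + 3 by lra.
by rewrite /slab cutoff_eq1 ?subr0// mul1r mulrA.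
Qed.

Section component.
Variables (T : \bar R) (w w1 w2 N : R -> functional) (c : R).
Hypotheses (c0 : 0 < c) (C2w : C2_distribution T w w1 w2)
  (suppw : st_support T w `<=` light_cone K c R1)
  (eqw : forall t f, 0 < t -> (t%:E < T)%E -> test f ->
     w2 t f - c ^+ 2 * w t (laplace_beltrami g f) = N t f)
  (N0 : forall t f, 0 < t -> (t%:E < T)%E -> test f -> (forall x, 0 <= f x) -> 0 <= N t f).

Let lin_w t : time_interval T t -> linear_on_tests (w t).
Proof. by move=> tT; have [H _] := C2w; have [/distribution_linear] := H t tT. Qed.

Let der_w f : test f -> has_derivative_on T (w^~ f) (w1^~ f).
Proof. by move=> tf; have [_ H] := C2w; have [] := H f tf. Qed.

Let der_w1 f : test f -> has_derivative_on T (w1^~ f) (w2^~ f).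
Proof. by move=> tf; have [_ H] := C2w; have [] := H f tf. Qed.

Lemma null_at t r : time_interval T t -> 0 <= r -> radial K r = c * t + R1 ->
  null_beyond (w t) r.
Proof.
move=> tT r0 rE.
exact: (null_beyond_cone d0 dK bK suppw (lin_w tT) tT r0 rE).
Qed.

Lemma derivative_null_at t r : 0 < t -> (t%:E < T)%E -> 0 <= r ->
  radial K r = c * t + R1 -> null_beyond (w1 t) r.
Proof.
move=> t0 tT r0 rE.
exact: (null_beyond_derivative d0 dK bK c0 R10 suppw lin_w der_w t0 tT r0 rE).
Qed.

Variables (b R' : R).
Hypotheses (bT : (b%:E < T)%E) (R'0 : 0 <= R') (bR' : c * b + R1 <= radial K R').

Lemma cone_radius_exists t : 0 <= t -> t <= b -> exists r,
  [/\ 0 <= r, radial K r = c * t + R1 & r <= R'].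
Proof.
move=> t0 tb.
have ct : 0 <= c * t + R1 by apply: addr_ge0; [apply: mulr_ge0 => //|]; exact: ltW.
have [r r0 rE] := radial_onto d0 dK bK ct.
exists r; split => //; apply: (cone_radius_mono d0 dK bK R'0 rE erefl).
by apply: le_trans bR'; rewrite lerD2r ler_pM2l.
Qed.

Let ti t : 0 <= t -> t <= b -> time_interval T t.
Proof. by move=> t0 tb; split => //; apply: le_lt_trans bT; rewrite lee_fin. Qed.

Let null_slab t : 0 <= t -> t <= b -> null_beyond (w t) R'.
Proof.
move=> t0 tb; have [r [r0 rE rR]] := cone_radius_exists t0 tb.
by apply: (null_beyond_mono rR); exact: (null_at (ti t0 tb) r0 rE).
Qed.

Lemma mass_equation t : 0 < t -> t <= b -> w2 t (slab R') = N t (slab R').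
Proof.
move=> t0 tb; have tT := ti (ltW t0) tb.
rewrite -(eqw t0 (proj2 tT) (test_slab R'0)).
rewrite (laplace_slab_null gP (lin_w tT) R'0 (null_slab (ltW t0) tb)).
by rewrite mulr0 subr0.
Qed.

Let chi_phi := fun x => slab R' x * phi x.

Let test_chi_phi : test chi_phi.
Proof. exact: test_mul (test_slab R'0) sphi. Qed.

(** The pairing F of w with the truncated eigenfunction satisfies
    F'' = (c lam)^2 F + N >= (c lam)^2 F. *)
Lemma eigenfunction_growth t : 0 <= w 0 chi_phi -> c * lam * w 0 chi_phi <= w1 0 chi_phi ->
  0 <= t -> t <= b ->
  expR (c * lam * t) * w 0 chi_phi <= w t chi_phi /\
  c * lam * (expR (c * lam * t) * w 0 chi_phi) <= w1 t chi_phi.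
Proof.
move=> F0 F1 t0 tb.
have cl : 0 < c * lam by exact: mulr_gt0.
apply: (exponential_growth (der_w test_chi_phi) (der_w1 test_chi_phi) cl F0 F1 t0).
  by case: (ti t0 tb).
move=> s s0 st; have sb := le_trans (ltW st) tb.
have [_ sT] := ti (ltW s0) sb.
have := N0 s0 sT test_chi_phi.
rewrite -(eqw s0 sT test_chi_phi).
rewrite (laplace_slab_eigen gP (lin_w (ti (ltW s0) sb)) R'0 (null_slab (ltW s0) sb) sphi ephi).
rewrite subr_ge0 mulrA -exprMn; apply => x.
by apply: mulr_ge0; [exact: cutoff_ge0|exact: ltW].
Qed.

End component.
End wave_component.

Section lifespan_bound.
Context {R : realType}.

Lemma abs_power_ge0 n (g : 'rV[R]_n -> 'M[R]_n) (T : \bar R) a w N t f : abs_power g T a w N ->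
  0 < t -> (t%:E < T)%E -> test f -> (forall x, 0 <= f x) -> 0 <= N t f.
Proof.
move=> [h [H _]] t0 tT tf f0; have [_ [_ ->//]] := H t (conj (ltW t0) tT).
by apply: vint_ge0 => x; apply: mulr_ge0; [exact: powR_ge0|exact: f0].
Qed.

(** If a solution existed beyond 2 tau, its two pairings with the cutoff would
    satisfy the inequalities excluded by [blowup_at_scale]. *)
Lemma lifespan_le_scale (n : nat) (p q c : R)
  (g : 'rV[R]_n -> 'M[R]_n) (K : R -> R)
  (lam c0 : R) (phi : 'rV[R]_n -> R)
  (Rad R1 : R) (u0 u1 v0 v1 : 'rV[R]_n -> R) :
  (2 <= n)%N -> 1 < p -> 1 < q -> 0 < c ->
  asymptotically_euclidean g K ->
  0 < lam -> 0 < c0 -> is_phi g K lam c0 phi ->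
  0 < Rad -> radial K Rad <= R1 ->
  [/\ test u0, test u1, test v0 & test v1] ->
  (forall x, Rad < enorm x -> [/\ u0 x = 0, u1 x = 0, v0 x = 0 & v1 x = 0]) ->
  [/\ 0 < vint g u0, 0 < vint g u1, 0 < vint g (fun x => u0 x * phi x)
    & 0 < vint g (fun x => (u1 x - c * lam * u0 x) * phi x)] ->
  [/\ 0 < vint g v0, 0 < vint g v1, 0 < vint g (fun x => v0 x * phi x)
    & 0 < vint g (fun x => (v1 x - lam * v0 x) * phi x)] ->
  exists2 C : R, 0 < C & forall eps tau, 0 < eps -> 1 <= tau ->
    C <= eps * tau `^ Gamma_SG p q n ->
    (lifespan g K c p q R1 eps u0 u1 v0 v1 <= (2 * tau)%:E)%E.
Proof.
move=> n2 p1 q1 c_gt0 hg lam0 c00 hphi Rad0 RadR1 [tu0 tu1 tv0 tv1] supp.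
move=> [mu0 mu1 mu0phi mu1phi] [mv0 mv1 mv0phi mv1phi].
have n0 : (0 < n)%N by exact: ltn_trans n2.
have [d [Cg [d0 gP gC dK bK]]] := asymptotically_euclidean_bounds hg.
have [sphi ephi bphi] := hphi.
have phi0 x : 0 < phi x by have /andP[+ _] := bphi x; exact: lt_trans.
have R10 : 0 < R1.
  apply: lt_le_trans RadR1; have /andP[+ _] := radial_incr d0 dK bK (lexx 0) (ltW Rad0).
  by rewrite (radial0 d0 dK bK) !subr0; apply: lt_le_trans; exact: mulr_gt0.
have one0 : (0:R) < 1 by exact: ltr01.
have [k1 k10 Hk1] := source_from_mass gP gC d0 dK bK one0 R10 p1.
have [k2 k20 Hk2] := source_from_eigenfunction gP gC d0 dK bK one0 R10 p1 n0 lam0 c00 hphi.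
have [k3 k30 Hk3] := source_from_mass gP gC d0 dK bK c_gt0 R10 q1.
have [k4 k40 Hk4] := source_from_eigenfunction gP gC d0 dK bK c_gt0 R10 q1 n0 lam0 c00 hphi.
set mv := vint g (fun x => v0 x * phi x) in mv0phi.
set mu := vint g (fun x => u0 x * phi x) in mu0phi.
have clmu : 0 < c * lam * mu by rewrite !mulr_gt0.
(* one constant for the four inequalities; the pairings with the eigenfunction
   enter with the sizes mv and c lam mu of the data *)
pose k := Num.min (Num.min k1 (k2 * mv `^ p)) (Num.min k3 (k4 * (c * lam * mu) `^ q)).
have k0 : 0 < k by rewrite !lt_min k10 k30 !mulr_gt0 ?powR_gt0.
have kk1 : k <= k1 by rewrite /k !ge_min lexx.
have kk2 : k <= k2 * mv `^ p by rewrite /k !ge_min lexx orbT.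
have kk3 : k <= k3 by rewrite /k !ge_min lexx !orbT.
have kk4 : k <= k4 * (c * lam * mu) `^ q by rewrite /k !ge_min lexx !orbT.
have [C C0 HC] := blowup_at_scale n p1 q1 k0.
exists C => // eps tau eps0 tau1 CG.
apply: ub_ereal_sup => T [u [v [[T0 [ut [utt [vt [vtt [Np [Nq [[C2u C2v] [aNp aNq] eqn init]]]]]]]] su sv]]].
rewrite leNgt; apply/negP => tauT.
have tau0 : 0 < tau by exact: lt_le_trans tau1.
have b0 : 0 <= 2 * tau by rewrite mulr_ge0// ltW.
have S0 : 0 <= Num.max 1 c * (2 * tau) + R1.
  by apply: addr_ge0; [apply: mulr_ge0; rewrite ?le_max ?ler01|exact: ltW].
(* one cutoff radius for both cones, which may have different slopes *)
have [R' R'0 R'E] := radial_onto d0 dK bK S0.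
have bR'u : c * (2 * tau) + R1 <= radial K R'.
  by rewrite R'E lerD2r ler_wpM2r// le_max lexx orbT.
have bR'v : 1 * (2 * tau) + R1 <= radial K R'.
  by rewrite R'E lerD2r ler_wpM2r// le_max lexx.
have RadR' : Rad <= R'.
  apply: (cone_radius_mono d0 dK bK R'0 erefl erefl); apply: (le_trans RadR1).
  by apply: le_trans bR'u; rewrite lerDr mulr_ge0// ltW.
pose chi := slab (n := n) R'.
have tchi : test chi by exact: test_slab.
have eqv t f : 0 < t -> (t%:E < T)%E -> test f ->
    vtt t f - 1 ^+ 2 * v t (laplace_beltrami g f) = Nq t f.
  by move=> t0 tT tf; rewrite expr1n mul1r; have [_] := eqn t f t0 tT tf.
have equ t f : 0 < t -> (t%:E < T)%E -> test f ->
    utt t f - c ^+ 2 * u t (laplace_beltrami g f) = Np t f.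
  by move=> t0 tT tf; have [] := eqn t f t0 tT tf.
have Np0 t f := @abs_power_ge0 n g T p v Np t f aNp.
have Nq0 t f := @abs_power_ge0 n g T q ut Nq t f aNq.
have s1 : smooth ((fun=> 1) : 'rV[R]_n -> R) by move=> m; exact: Ck_cst.
have supp0 x : Rad < enorm x -> u0 x = 0 by case/supp.
have supp1 x : Rad < enorm x -> u1 x = 0 by case/supp.
have supp2 x : Rad < enorm x -> v0 x = 0 by case/supp.
have supp3 x : Rad < enorm x -> v1 x = 0 by case/supp.
have tcp : test (fun x => chi x * phi x) by exact: test_mul tchi sphi.
have times1 (h : 'rV[R]_n -> R) : (fun x => h x * (fun=> 1) x) = h.
  by apply/funext => x; rewrite mulr1.
have mass (f : 'rV[R]_n -> R) : test f -> (forall x, Rad < enorm x -> f x = 0) ->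
    vint g (fun x => eps * f x * chi x) = eps * vint g f.
  move=> tf sf; have := initial_pairing gP gC eps tf s1 sf R'0 RadR'.
  under eq_fun do rewrite mulr1.
  by rewrite (times1 f).
have pair (f : 'rV[R]_n -> R) : test f -> (forall x, Rad < enorm x -> f x = 0) ->
    vint g (fun x => eps * f x * (chi x * phi x)) = eps * vint g (fun x => f x * phi x).
  by move=> tf sf; have H := initial_pairing gP gC eps tf sphi sf R'0 RadR'; exact: H.
have [I1 I2 I3 I4] := init _ tchi.
have [J1 J2 J3 J4] := init _ tcp.
rewrite mass// in I2; rewrite mass// in I3; rewrite mass// in I4.
rewrite pair// in J1; rewrite pair// in J2; rewrite pair// in J3; rewrite pair// in J4.
have split_data (a b : 'rV[R]_n -> R) s : test a -> test b ->
    vint g (fun x => (a x - s * b x) * phi x) =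
    vint g (fun x => a x * phi x) - s * vint g (fun x => b x * phi x).
  move=> ta tb.
  have ia := vintegrable_test gP gC (test_mul ta sphi).
  have ib := vintegrable_test gP gC (test_mul tb sphi).
  rewrite addrC -mulNr -vint_lin//; congr (vint g _); apply/funext => x; ring.
have growth_v t : 0 <= t -> t <= 2 * tau ->
    expR (1 * lam * t) * (eps * mv) <= v t (fun x => chi x * phi x).
  move=> t0 tb; rewrite -J3.
  have [] // := eigenfunction_growth gP d0 dK bK R10 lam0 sphi ephi phi0 one0 C2v sv eqv Nq0
     tauT R'0 bR'v _ _ t0 tb.
  - by rewrite J3 mulr_ge0// ltW.
  - rewrite J3 J4 mul1r mulrCA ler_pM2l//.
    by rewrite -subr_ge0 -split_data// ltW.
have growth_u t : 0 <= t -> t <= 2 * tau ->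
    c * lam * (expR (c * lam * t) * (eps * mu)) <= ut t (fun x => chi x * phi x).
  move=> t0 tb; rewrite -J1.
  have [] // := eigenfunction_growth gP d0 dK bK R10 lam0 sphi ephi phi0 c_gt0 C2u su equ Np0
     tauT R'0 bR'u _ _ t0 tb.
  - by rewrite J1 mulr_ge0// ltW.
  - rewrite J1 J2 mulrCA ler_pM2l//.
    by rewrite -subr_ge0 -split_data// ltW.
have [_ dv] := C2v; have [dv1 dv2 _] := dv _ tchi.
have [_ du] := C2u; have [du1 du2 _] := du _ tchi.
have := HC T _ _ _ _ _ eps tau dv1 dv2 du2 eps0 tau1 tauT.
rewrite I2 I3 I4 => /(_ (ltac:(by rewrite mulr_ge0// ltW)) (ltac:(by rewrite mulr_ge0// ltW))
  (ltac:(by rewrite mulr_ge0// ltW))) H.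
suff : eps * tau `^ Gamma_SG p q n < C by rewrite ltNge CG.
apply: H => t t0 tb; have tb' := ltW tb.
have tT : (t%:E < T)%E by apply: lt_trans tauT; rewrite lte_fin.
have tiT : time_interval T t by split => //; exact: ltW.
have t1 : 0 <= 1 + t by rewrite addr_ge0// ltW.
have -> : utt t chi = Np t chi.
  exact: (mass_equation gP d0 dK bK R10 c_gt0 C2u su equ tauT R'0 bR'u t0 tb').
have -> : vtt t chi = Nq t chi.
  exact: (mass_equation gP d0 dK bK R10 one0 C2v sv eqv tauT R'0 bR'v t0 tb').
have [r [r0 rE rR]] := cone_radius_exists d0 dK bK R10 one0 R'0 bR'v (ltW t0) tb'.
have [r' [r'0 r'E r'R]] := cone_radius_exists d0 dK bK R10 c_gt0 R'0 bR'u (ltW t0) tb'.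
have lv : linear_on_tests (v t).
  by have [H' _] := C2v; have [/distribution_linear] := H' t tiT.
have lut : linear_on_tests (ut t).
  by have [H' _] := C2u; have [_ /distribution_linear] := H' t tiT.
have nv := null_at d0 dK bK C2v sv tiT r0 rE.
have nut := derivative_null_at d0 dK bK R10 c_gt0 C2u su t0 tT r'0 r'E.
have [f [Hf _]] := aNp; have [fv fNp] := Hf t tiT.
have [h [Hh _]] := aNq; have [hut hNq] := Hh t tiT.
split.
- apply: le_trans (Hk1 _ _ _ _ _ _ (ltW t0) r0 rE lv nv fv fNp rR).
  by apply: ler_wpM2r; [exact: powR_ge0|apply: ler_wpM2r; [exact: powR_ge0|]].
- have E0 : 0 < eps * mv by exact: mulr_gt0.
  have g' : eps * mv * expR (1 * lam * t) <= v t (fun x => slab R' x * phi x).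
    by rewrite mulrC; exact: growth_v (ltW t0) tb'.
  apply: le_trans (Hk2 _ _ _ _ _ _ _ (ltW t0) r0 rE lv nv fv fNp rR E0 g').
  apply: ler_wpM2r; first exact: powR_ge0.
  rewrite powRM ?(ltW eps0) ?(ltW mv0phi)// mulrCA mulrC.
  by apply: ler_wpM2l kk2; exact: powR_ge0.
- apply: le_trans (Hk3 _ _ _ _ _ _ (ltW t0) r'0 r'E lut nut hut hNq r'R).
  by apply: ler_wpM2r; [exact: powR_ge0|apply: ler_wpM2r; [exact: powR_ge0|]].
- have E0 : 0 < eps * (c * lam * mu) by exact: mulr_gt0.
  have g' : eps * (c * lam * mu) * expR (c * lam * t) <= ut t (fun x => slab R' x * phi x).
    apply: le_trans (growth_u t (ltW t0) tb').
    by rewrite le_eqVlt; apply/orP; left; apply/eqP; ring.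
  apply: le_trans (Hk4 _ _ _ _ _ _ _ (ltW t0) r'0 r'E lut nut hut hNq r'R E0 g').
  apply: ler_wpM2r; first exact: powR_ge0.
  rewrite powRM ?(ltW eps0) ?(ltW clmu)// mulrCA mulrC.
  by apply: ler_wpM2l kk4; exact: powR_ge0.
Qed.

(** The scale tau = C' eps^(-1/M) makes eps tau^M a large constant, and
    tau^M <= tau^G as tau >= 1. *)
Lemma lifespan_exponent (C G M : R) : 0 < C -> 0 < M -> M <= G ->
  exists2 C' : R, 0 < C' & forall eps, 0 < eps -> eps < 1 ->
    1 <= C' * eps `^ (- M^-1) /\ C <= eps * (C' * eps `^ (- M^-1)) `^ G.
Proof.
move=> C0 M0 MG.
have X1 : 1 <= Num.max 1 (C `^ M^-1) by rewrite le_max lexx.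
exists (Num.max 1 (C `^ M^-1)); first exact: lt_le_trans X1.
set X := Num.max _ _ in X1 *; move=> eps eps0 eps1.
have e1 : 1 <= eps `^ (- M^-1).
  rewrite powRN -[leLHS]invr1 lef_pV2 ?posrE ?powR_gt0//.
  rewrite [leRHS](_ : 1 = 1 `^ M^-1); last by rewrite powR1.
  by apply: ge0_ler_powR; rewrite ?invr_ge0 ?nnegrE ?(ltW M0) ?(ltW eps0) ?ler01 ?(ltW eps1).
have Y1 : 1 <= X * eps `^ (- M^-1) by apply: mulr_ege1.
split => //.
apply: (@le_trans _ _ (eps * (X * eps `^ (- M^-1)) `^ M)); last first.
  by apply: ler_wpM2l; [exact: ltW|exact: ler_powR].
rewrite powRM ?powR_ge0 ?(le_trans ler01 X1)// -powRrM mulNr mulVf ?gt_eqF//.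
rewrite powR_inv1 ?(ltW eps0)// mulrCA divff ?gt_eqF// mulr1.
apply: (@le_trans _ _ ((C `^ M^-1) `^ M)).
  by rewrite -powRrM mulVf ?gt_eqF// powRr1// ltW.
apply: ge0_ler_powR; rewrite ?nnegrE ?powR_ge0 ?(ltW M0) ?(le_trans ler01 X1)//.
by rewrite /X le_max lexx orbT.
Qed.

End lifespan_bound.

Theorem theorem1p3 (R : realType) (n : nat) (p q c : R)
  (g : 'rV[R]_n -> 'M[R]_n) (K : R -> R)
  (lam c0 : R) (phi : 'rV[R]_n -> R)
  (Rad R1 : R) (u0 u1 v0 v1 : 'rV[R]_n -> R)
  (hn : (2 <= n)%N) (hp : 1 < p) (hq : 1 < q) (hc : 0 < c)
  (hM : c = 1 -> 0 < M_exp p q n)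
  (hMstar : c <> 1 -> 0 < M_star p q n)
  (hg : asymptotically_euclidean g K)
  (hlam : 0 < lam) (hc0 : 0 < c0) (hphi : is_phi g K lam c0 phi)
  (hRad : 0 < Rad) (hR1 : radial K Rad <= R1)
  (htest : [/\ test u0, test u1, test v0 & test v1])
  (hsupp : forall x, Rad < enorm x ->
     [/\ u0 x = 0, u1 x = 0, v0 x = 0 & v1 x = 0])
  (hnontriv : exists x, ~ [/\ u0 x = 0, u1 x = 0, v0 x = 0 & v1 x = 0])
  (hu : [/\ 0 < vint g u0, 0 < vint g u1,
            0 < vint g (fun x => u0 x * phi x)
          & 0 < vint g (fun x => (u1 x - c * lam * u0 x) * phi x)])
  (hv : [/\ 0 < vint g v0, 0 < vint g v1,
            0 < vint g (fun x => v0 x * phi x)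
          & 0 < vint g (fun x => (v1 x - lam * v0 x) * phi x)]) :
  exists2 eps0 : R, 0 < eps0 &
  exists2 C : R, 0 < C &
  forall eps : R, 0 < eps < eps0 ->
    let T_eps := lifespan g K c p q R1 eps u0 u1 v0 v1 in
    (T_eps < +oo)%E /\
    (c = 1 -> (T_eps <= (C * eps `^ (- (M_exp p q n)^-1))%:E)%E) /\
    (c <> 1 -> (T_eps <= (C * eps `^ (- (M_star p q n)^-1))%:E)%E).
Proof.
have [C C0 HC] := lifespan_le_scale hn hp hq hc hg hlam hc0 hphi hRad hR1 htest hsupp hu hv.
pose M := if c == 1 then M_exp p q n else M_star p q n.
have M0 : 0 < M.
  by rewrite /M; case: eqP => [/hM|/hMstar].
have MG : M <= Gamma_SG p q n.
  by rewrite /M /M_exp /M_star; case: ifP => _; rewrite ge_min lexx orbT.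
have [C' C'0 HC'] := lifespan_exponent C0 M0 MG.
exists 1 => //; exists (2 * C'); first exact: mulr_gt0.
move=> eps /andP[eps0 eps1] T_eps.
have [tau1 Hbig] := HC' eps eps0 eps1.
have H : (T_eps <= (2 * C' * eps `^ (- M^-1))%:E)%E.
  by rewrite -mulrA; exact: HC.
split; first by rewrite (le_lt_trans H)// ltry.
by split=> hc1; move: H; rewrite /M; case: eqP.
Qed.
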